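(* The map $\mathrm{Trop}:Z_1(E)\to Z_1^{\mathrm{trop}}(\mathrm{trop}(E))$ is surjective.
   Context: Let $K$ be an algebraically closed field, $n\in\mathbb N$, $S=K[x_0^{\pm1},\dots,x_n^{\pm1}]$ with the standard grading, $S_0$ the degree-$0$ part of $S$, and $X=\mathrm{Spec}(S_0)$ the $n$-dimensional torus. Let $L\subset S$ be an ideal generated by $n-2$ independent linear forms with $\dim(S/L)=3$, $L_0=L\cap S_0$, and $E=\mathrm{Spec}(S_0/L_0)\subset X$ (an arbitrary plane in $X$). Tropical cycles: $\mathbf 1=(1,\dots,1)$; $\mathbb R^{n+1}/\langle\mathbf 1\rangle$ has lattice $\mathbb Z^{n+1}/\langle\mathbf 1\rangle$. A tropical $1$-cycle is a $1$-dimensional rational fan with (possibly negative) integer multiplicities $m(\sigma)$ on the rays satisfying $\sum_\sigma m(\sigma)u_\sigma=0$, with $u_\sigma$ the primitive lattice generator of $\sigma$; cycles are considered up to refinement and form a group; $Z_1^{\mathrm{trop}}(\mathrm{trop}(E))$ is the group of those supported in $\mathrm{trop}(E)$. Tropicalization (trivial valuation, min-convention): for $f=\sum_\nu a_\nu x^\nu\in S_0$ and $\omega\in\mathbb R^{n+1}$ let $\mathrm{in}_\omega(f)$ be the sum of the terms $a_\nu x^\nu$, $a_\nu\ne0$, with $\omega\cdot\nu$ minimal; $\mathrm{in}_\omega(I)$ is the ideal generated by all $\mathrm{in}_\omega(f)$, $f\in I$. For an irreducible closed $Y\subset X$ with prime ideal $P\subset S_0$, $\mathrm{trop}(Y)\subset\mathbb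 R^{n+1}/\langle\mathbf 1\rangle$ is the image of $\{\omega:\mathrm{in}_\omega(P)\ne S_0\}$, a fan whose maximal cones $\sigma$ carry the multiplicities $\sum_Q\ell((S_0/\mathrm{in}_\omega(P))_Q)$, with $\omega$ in the relative interior of $\sigma$, $Q$ running over the minimal primes of $\mathrm{in}_\omega(P)$, and $\ell$ denoting length. $Z_1(E)$ is the free abelian group on the irreducible curves in $E$, and $\mathrm{Trop}$ is the group homomorphism extending $Y\mapsto\mathrm{trop}(Y)$ linearly. *)

(* Defs.v *)
From HB Require Import structures.
From mathcomp Require Import all_boot all_order all_algebra.
From mathcomp Require Import finmap.
From mathcomp Require Import monalg freeg.
From mathcomp Require Import boolp classical_sets functions cardinality fsbigop.
From mathcomp Require Import reals.

Set Implicit Arguments.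
Unset Strict Implicit.
Unset Printing Implicit Defensive.

Import Order.TTheory GRing.Theory Num.Theory.
Local Open Scope quotient_scope.
Local Open Scope classical_set_scope.
Local Open Scope ring_scope.

(* Group algebra of an additive abelian group G.  The multiplication of       *)
(* monalg is only available for monoids whose sole unit is the identity, so   *)
(* the convolution product has to be set up on an alias.                      *)
Definition galg (K : comNzRingType) (G : zmodType) : Type := {malg K[G]}.

Section GroupAlgebra.
Context (K : comNzRingType) (G : zmodType).
Implicit Types (f g h : {malg K[G]}).

HB.instance Definition _ := GRing.Lmodule.on (galg K G).

Definition galg_one : galg K G := << (0 : G) >>.

Definition galg_mul (f g : galg K G) : galg K G :=
  \sum_(a <- msupp f) \sum_(b <- msupp g) << f@_a * g@_b *g (a + b) >>.

Let mulw (d1 d2 : {fset G}) f g :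
  (msupp f `<=` d1)%fset -> (msupp g `<=` d2)%fset ->
  galg_mul f g = \sum_(a <- d1) \sum_(b <- d2) << f@_a * g@_b *g (a + b) >>.
Proof.
move=> le_d1 le_d2; rewrite /galg_mul (big_fset_incl _ le_d1) /=.
  apply/eq_bigr=> a _; apply/big_fset_incl => // b _ /mcoeff_outdom ->.
  by rewrite mulr0 monalgU0.
move=> a _ /mcoeff_outdom fa.
by rewrite big1 => // b _; rewrite fa mul0r monalgU0.
Qed.

Lemma galg_mulUU (c1 c2 : K) (a b : G) :
  galg_mul << c1 *g a >> << c2 *g b >> = << c1 * c2 *g (a + b) >>.
Proof. by rewrite (mulw msuppU_le msuppU_le) !big_seq_fset1 !mcoeffUU. Qed.

Let mulC : commutative galg_mul.
Proof.
move=> f g; rewrite /galg_mul exchange_big /=; apply/eq_bigr=> b _.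
by apply/eq_bigr=> a _; rewrite mulrC addrC.
Qed.

Let mulDl : left_distributive galg_mul +%R.
Proof.
move=> f g h; rewrite (@mulw (msupp f `|` msupp g)%fset (msupp h)) //; last first.
  exact: msuppD_le.
rewrite (@mulw (msupp f `|` msupp g)%fset (msupp h) f) ?fsubsetUl //.
rewrite (@mulw (msupp f `|` msupp g)%fset (msupp h) g) ?fsubsetUr //.
rewrite -big_split /=; apply/eq_bigr=> a _.
rewrite -big_split /=; apply/eq_bigr=> b _.
by rewrite mcoeffD mulrDl monalgUD.
Qed.

Let mulDr : right_distributive galg_mul +%R.
Proof. by move=> f g h; rewrite mulC mulDl !(mulC f). Qed.

Let mul0 f : galg_mul 0 f = 0.
Proof. by rewrite /galg_mul msupp0 big_seq_fset0. Qed.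

Let mulr0' f : galg_mul f 0 = 0.
Proof. by rewrite mulC mul0. Qed.

Let mulEl f g :
  galg_mul f g = \sum_(a <- msupp f) galg_mul << f@_a *g a >> g.
Proof.
apply/eq_bigr=> a _; rewrite (mulw msuppU_le (fsubset_refl _)) big_seq_fset1.
by apply/eq_bigr => b _; rewrite mcoeffUU.
Qed.

Let mulEr f g :
  galg_mul f g = \sum_(b <- msupp g) galg_mul f << g@_b *g b >>.
Proof. by rewrite mulC mulEl; apply/eq_bigr=> b _; rewrite mulC. Qed.

Let mulA : associative galg_mul.
Proof.
move=> f g h.
rewrite [RHS](big_morph (galg_mul^~ _) (fun _ _ => mulDl _ _ _) (mul0 _)).
rewrite mulEl; apply/eq_bigr=> a _.
rewrite [LHS](big_morph (galg_mul _) (fun _ _ => mulDr _ _ _) (mulr0' _)).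
rewrite [RHS](big_morph (galg_mul^~ _) (fun _ _ => mulDl _ _ _) (mul0 _)).
apply/eq_bigr=> b _.
rewrite [LHS](big_morph (galg_mul _) (fun _ _ => mulDr _ _ _) (mulr0' _)).
by rewrite mulEr; apply/eq_bigr=> c _; rewrite !galg_mulUU mulrA addrA.
Qed.

Let mul1 : left_id galg_one galg_mul.
Proof.
move=> f; rewrite (mulw msuppU_le (fsubset_refl _)) big_seq_fset1.
rewrite [RHS]monalgE; apply/eq_bigr => b _.
by rewrite mcoeffUU mul1r add0r.
Qed.

Let one_neq0 : galg_one != 0.
Proof. by apply/eqP/malgP=> /(_ 0) /eqP; rewrite !mcoeffsE oner_eq0. Qed.

HB.instance Definition _ := GRing.Zmodule_isComNzRing.Build (galg K G)
  mulA mulC mul1 mulDl one_neq0.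

Lemma galg_mulE (f g : galg K G) : f * g = galg_mul f g.
Proof. by []. Qed.

End GroupAlgebra.

Section CommutativeAlgebra.
Context (A : comNzRingType).
Implicit Types (I P Q : set A).

Definition is_ideal I :=
  [/\ I 0, forall f g, I f -> I g -> I (f + g) & forall a f, I f -> I (a * f)].

Definition prime_ideal P :=
  [/\ is_ideal P, ~ P 1 & forall f g, P (f * g) -> P f \/ P g].

Definition ideal_gen (G : set A) : set A := smallest is_ideal G.

(* Irreducible closed subsets of Spec (A / I) are given by the primes of A     *)
(* containing I, so that dim_quot I d says that A / I has Krull dimension d.  *)
Definition prime_chain I (k : nat) := exists c : nat -> set A,
  (forall i, (i <= k)%N -> prime_ideal (c i) /\ I `<=` c i) /\
  (forall i, (i < k)%N -> c i `<` c i.+1).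

Definition dim_quot I (d : nat) :=
  prime_chain I d /\ forall k, prime_chain I k -> (k <= d)%N.

Definition minimal_primes I : set (set A) :=
  [set Q | [/\ prime_ideal Q, I `<=` Q &
     forall P, prime_ideal P -> I `<=` P -> P `<=` Q -> P = Q]].

(* The local ring (A / I)_Q as a setoid: a pair (a, s) with s outside Q       *)
(* stands for the fraction a / s, with numerator taken modulo I.              *)
Section Localization.
Context (I Q : set A).
Implicit Types (x y : A * A).

Definition loc_frac : set (A * A) := [set x | ~ Q x.2].

Definition loc_eq x y :=
  exists2 u, ~ Q u & I (u * (x.1 * y.2 - y.1 * x.2)).

Record loc_ideal (N : set (A * A)) : Prop := {
  loc_ideal_frac : N `<=` loc_frac;
  loc_ideal_eq : forall x y, N x -> loc_frac y -> loc_eq x y -> N y;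
  loc_ideal0 : N (0, 1);
  loc_idealD : forall x y, N x -> N y -> N (x.1 * y.2 + y.1 * x.2, x.2 * y.2);
  loc_idealM : forall x y, loc_frac x -> N y -> N (x.1 * y.1, x.2 * y.2)
}.

Definition loc_chain (k : nat) := exists c : nat -> set (A * A),
  (forall i, (i <= k)%N -> loc_ideal (c i)) /\
  (forall i, (i < k)%N -> c i `<` c i.+1).

(* Length of (A / I)_Q as a module over itself.  The value 0 stands for       *)
(* infinite length, which does not occur for A Noetherian and Q a minimal     *)
(* prime of I.                                                                *)
Definition loc_length : nat :=
  xget 0%N [set l | loc_chain l /\ forall k, loc_chain k -> (k <= l)%N].
End Localization.

(* The sum is finite for A Noetherian.                                        *)
Definition multiplicity I : int :=
  \sum_(Q \in minimal_primes I) (loc_length I Q)%:Z.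

End CommutativeAlgebra.

Section Torus.
Context (K : closedFieldType) (n : nat).

Definition laurent : Type := galg K 'rV[int]_n.+1.
HB.instance Definition _ := GRing.ComNzRing.on laurent.
HB.instance Definition _ := GRing.Lmodule.on laurent.

Definition laurentX (i : 'I_n.+1) : laurent := << delta_mx 0 i >>.

Definition linear_form (a : 'rV[K]_n.+1) : laurent :=
  \sum_i (a 0 i *: laurentX i).

Definition degx (v : 'rV[int]_n.+1) : int := \sum_i v 0 i.

Definition deg0 : {pred laurent} :=
  [pred f : laurent | all (fun v => degx v == 0) (msupp f)].

Lemma deg0P (f : laurent) :
  reflect (forall v, f@_v != 0 -> degx v = 0) (f \in deg0).
Proof.
apply: (iffP allP) => /= H v.
  by rewrite mcoeff_neq0 => /H/eqP.
by rewrite -mcoeff_neq0 => /H ->.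
Qed.

Lemma deg0_subring : subring_closed deg0.
Proof.
split.
- apply/deg0P => v; rewrite -[1]/(galg_one K _) mcoeffU.
  have [<- _|_] := eqVneq 0 v; last by rewrite eqxx.
  by rewrite /degx big1 // => i _; rewrite mxE.
- move=> f g /deg0P f0 /deg0P g0; apply/deg0P => v.
  rewrite mcoeffB => nz.
  have [fv|/f0 //] := eqVneq (f@_v) 0; have [gv|/g0 //] := eqVneq (g@_v) 0.
  by rewrite fv gv subr0 eqxx in nz.
- move=> f g /allP f0 /allP g0; apply/deg0P => v.
  apply: contraNeq => nz; rewrite galg_mulE raddf_sum /= big_seq big1 // => a fa.
  rewrite raddf_sum /= big_seq big1 // => b gb; rewrite mcoeffU.
  have [ab|//] := eqVneq (a + b) v; move: nz; rewrite -ab.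
  have -> : degx (a + b) = degx a + degx b.
    by rewrite /degx -big_split; apply: eq_bigr => i _; rewrite mxE.
  by rewrite (eqP (f0 _ fa)) (eqP (g0 _ gb)) eqxx.
Qed.
HB.instance Definition _ := GRing.isSubringClosed.Build laurent deg0 deg0_subring.

Record laurent0 := Laurent0 { laurent0_val :> laurent; _ : laurent0_val \in deg0 }.
HB.instance Definition _ := [isSub for laurent0_val].
HB.instance Definition _ := [Choice of laurent0 by <:].
HB.instance Definition _ := [SubChoice_isSubComNzRing of laurent0 by <:].

Context (R : realType).

Definition weight (w : 'rV[R]_n.+1) (v : 'rV[int]_n.+1) : R :=
  \sum_i w 0 i * (v 0 i)%:~R.

Definition init_form (w : 'rV[R]_n.+1) (f : laurent) : laurent :=
  \sum_(v <- msupp f | all (fun v' => weight w v <= weight w v') (msupp f))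
    << f@_v *g v >>.

Lemma init_form_deg0 w (f : laurent0) : init_form w (val f) \in deg0.
Proof.
apply: rpred_sum => v _; apply/deg0P => v'; rewrite mcoeffU.
have [<-|_] := eqVneq v v'; last by rewrite eqxx.
by rewrite mulr1n; case: f => f /= /deg0P; apply.
Qed.
Definition init_form0 w (f : laurent0) : laurent0 := Laurent0 (init_form_deg0 w f).

Definition init_ideal w (I : set laurent0) : set laurent0 :=
  ideal_gen (init_form0 w @` I).

End Torus.

Arguments laurent0 : clear implicits.

(* V^(n+1) / <1>, for V = int (the lattice) or V = R (the ambient space)      *)
Section ModOne.
Context (V : nzRingType) (n : nat).

Definition span1 : {pred 'rV[V]_n.+1} := [pred v : 'rV[V]_n.+1 | v == const_mx (v 0 0)].

Lemma span1_zmod_closed : zmod_closed span1.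
Proof.
split=> [|v w]; rewrite !inE.
  by apply/eqP/rowP => i; rewrite !mxE.
move=> /eqP /rowP ev /eqP /rowP ew; apply/eqP/rowP => i; rewrite !mxE.
by have := ev i; have := ew i; rewrite !mxE => -> ->.
Qed.
HB.instance Definition _ :=
  GRing.isZmodClosed.Build 'rV[V]_n.+1 span1 span1_zmod_closed.

Definition modone : zmodType := @Quotient.quot 'rV[V]_n.+1 span1.

Definition modone_pi (v : 'rV[V]_n.+1) : modone := \pi v.
Definition modone_repr (u : modone) : 'rV[V]_n.+1 := repr u.
End ModOne.

Section Tropical.
Context (K : closedFieldType) (n : nat) (R : realType).
Local Notation N := (modone int n).
Local Notation NR := (modone R n).

(* Initial ideals of ideals of laurent0 only depend on the weight vector      *)
(* modulo 1, so that the choice of the representative is immaterial.          *)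
Definition lattice_vec (u : N) : 'rV[R]_n.+1 :=
  map_mx intr (modone_repr u).

Definition primitive (u : N) :=
  u <> 0 /\ forall (v : N) (k : nat), u = v *+ k -> k = 1%N.

Definition ray (u : N) : set NR :=
  [set modone_pi (t *: lattice_vec u) | t in [set t : R | 0 <= t]].

Definition trop_set (P : set (laurent0 K n)) : set NR :=
  @modone_pi R n @` [set w | init_ideal w P <> setT].

(* A rational ray is identified with its primitive generator.  As rays cannot *)
(* be subdivided, a one-dimensional weighted fan up to refinement is the      *)
(* finitely supported function giving the multiplicity of each ray.           *)
Definition tropical_cycle : set (N -> int) :=
  [set m | [/\ finite_set [set u | m u <> 0],
               forall u, m u <> 0 -> primitive u &
               \sum_(u \in [set u | m u <> 0]) u *~ m u = 0]].

Definition Z1trop (X : set NR) : set (N -> int) :=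
  [set m | tropical_cycle m /\ forall u, m u <> 0 -> ray u `<=` X].

(* trop(Y) for a curve Y with prime ideal P.  The primitive generator u lies  *)
(* in the relative interior of its ray; if the ray is not in trop(Y), then    *)
(* the initial ideal has no minimal prime and the multiplicity is 0.          *)
Definition trop_curve (P : set (laurent0 K n)) : N -> int^o :=
  fun u => if `[< primitive u >] then multiplicity (init_ideal (lattice_vec u) P)
           else 0.

Definition curves (I : set (laurent0 K n)) : set (set (laurent0 K n)) :=
  [set P | [/\ prime_ideal P, I `<=` P & dim_quot P 1]].

Definition Z1 (I : set (laurent0 K n)) := {freeg (set_type (curves I))}.

Definition Trop (I : set (laurent0 K n)) : Z1 I -> N -> int^o :=
  fglift (fun Y : set_type (curves I) => trop_curve (val Y)).

End Tropical.

Arguments trop_set {K n} R P.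
Arguments Trop {K n} R I.

Definition linear_ideal (K : closedFieldType) (n k : nat) (A : 'M[K]_(k, n.+1)) :
    set (laurent K n) :=
  ideal_gen [set linear_form (row j A) | j in setT].

Definition deg0_part (K : closedFieldType) (n : nat) (L : set (laurent K n)) :
    set (laurent0 K n) :=
  [set f | L (val f)].

(* Main.v *)
(* Choose linear coordinates on the plane, so that each                        *)
(* x_m is a linear form, and call two indices parallel if their forms define   *)
(* the same line.  A primitive ray u of trop(E) is given by a basis (i, j, k)  *)
(* of the matroid and weights e0 >= e1 >= 0 with gcd(e0, e1) = 1: x_m has      *)
(* weight 0, e1 or e0 according to its position in the flag formed by the      *)
(* point x_i = x_j = 0 on the line x_i = 0.  For e1 = 0 this is the ray e_l of *)
(* a line l of the arrangement.  For e1 > 0, put b = e1, a = e0 - e1 and take  *)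
(* the curve x_i^b x_k^a = ka (x_j - la x_i)^(a + b) with la, ka generic.  It  *)
(* is rational and unibranch at the point of the flag, and its tropicalization *)
(* is u plus a combination of the rays e_l.  Subtracting m(u) trop(C_u) for    *)
(* all u with e1 > 0 from a tropical cycle m leaves a cycle supported on the   *)
(* rays e_l; balancing forces its multiplicities to agree, so that it is a     *)
(* multiple of the tropicalization of a general line (b = 0, a = 1).           *)
(* The multiplicities are computed by substituting monomials in S, T adapted   *)
(* to the weights: the lowest coefficient in S of the equation is a monomial   *)
(* times a polynomial p in T, and the multiplicity of the initial ideal is the *)
(* degree of p, provided that no initial form of an x_m vanishes at a root.    *)

Require Import Defs.
From HB Require Import structures.
From mathcomp Require Import all_boot all_order all_algebra.
From mathcomp Require Import finmap monalg freeg.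
From mathcomp Require Import boolp classical_sets functions cardinality fsbigop.
From mathcomp Require Import reals.
From mathcomp Require Import perm ring lra zify.

Set Implicit Arguments.
Unset Strict Implicit.
Unset Printing Implicit Defensive.

Import Order.TTheory GRing.Theory Num.Theory.
Local Open Scope classical_set_scope.
Local Open Scope ring_scope.

(** The fan trop(E) is covered by the cones of the flags (a point on a line) of the arrangement of
    the lines x_m = 0, and every cycle on it can be reached with two kinds of curves.

    Let u be a primitive ray of trop(E) that is no e_l. [flag_exists] gives a flag and weights e0 >=
    e1 > 0. With d = e0 and b = e1, the curve C_u parametrized by x_i = t^d, x_j = la t^d + ga t^b,
    x_k = 1 has one branch at the point of the flag, and its contact orders produce u with
    multiplicity 1. For generic [la], [ka] it avoids all other points where two lines meet, so its
    remaining rays are rays e_l. By Bezout it meets a line d times, and the branch absorbs d, b or 0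
    of these intersections, which is the height of u there. So e_l has multiplicity d minus the
    height of u on l ([ray_curve_exists]). A cycle m minus the sum of m(u) trop(C_u) then lives on
    the rays e_l. Balancing modulo 1 makes its multiplicities equal, so it is a multiple of a
    general line ([general_line_exists]). This is [trop_surjective].

    The work lies in the multiplicities. Frame coordinates are replaced by monomials S^e T^tau with
    a unimodular exponent matrix, so that the weight becomes the degree in S. Over L0 the ideal of
    C_u is generated by one equation ([curve_div]). Hence modulo its initial ideal the ring is a
    localization of K[S,T]/(p), where p(T) comes from the lowest coefficient in S of that equation
    ([multiplicity_degeneration]), and the multiplicity is deg p ([multiplicity_principal]). One
    lemma per type of ray computes p. That C_u is a curve is [curve_ideal_dim]. *)

Local Notation "x %:F" := (@FracField.tofrac _ x).

(** * Congruences modulo ideals, and kernels as prime ideals *)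

Section Ideals.
Context (A : comNzRingType).
Implicit Types (I Q : set A).

Lemma ideal0 I : is_ideal I -> I 0. Proof. by case. Qed.

Lemma idealD I f g : is_ideal I -> I f -> I g -> I (f + g).
Proof. by case=> _ + _; apply. Qed.

Lemma idealMl I a f : is_ideal I -> I f -> I (a * f).
Proof. by case=> _ _; apply. Qed.

Lemma idealMr I a f : is_ideal I -> I f -> I (f * a).
Proof. by rewrite mulrC; apply: idealMl. Qed.

Lemma idealN I f : is_ideal I -> I f -> I (- f).
Proof. by move=> hI; rewrite -mulN1r; apply: idealMl. Qed.

Lemma idealB I f g : is_ideal I -> I f -> I g -> I (f - g).
Proof. by move=> hI If Ig; apply: idealD => //; apply: idealN. Qed.

Lemma ideal_sum I (T : Type) (s : seq T) (P : pred T) (F : T -> A) :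
  is_ideal I -> (forall i, P i -> I (F i)) -> I (\sum_(i <- s | P i) F i).
Proof.
by move=> hI IF; elim/big_ind: _ => //; [exact: ideal0|move=> x y; exact: idealD].
Qed.

Lemma ideal_sub_trans I f g h : is_ideal I -> I (f - g) -> I (g - h) -> I (f - h).
Proof. by move=> hI fg gh; rewrite -(subrKA g); apply: idealD. Qed.

Lemma ideal_subM I f g f' g' :
  is_ideal I -> I (f - g) -> I (f' - g') -> I (f * f' - g * g').
Proof.
move=> hI fg fg'; have -> : f * f' - g * g' = (f - g) * f' + g * (f' - g') by ring.
by apply: idealD => //; [apply: idealMr|apply: idealMl].
Qed.

Lemma ideal_sub_multiple I x g g' h :
  is_ideal I -> I (x - g * h) -> I (g - g') -> I (x - g' * h).
Proof.
move=> hI xg gg'; have -> : x - g' * h = (x - g * h) + (g - g') * h by ring.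
by apply: idealD => //; apply: idealMr.
Qed.

Lemma ideal_subX I f g n : is_ideal I -> I (f - g) -> I (f ^+ n - g ^+ n).
Proof.
move=> hI fg; elim: n => [|n IHn]; first by rewrite subrr; apply: ideal0.
by rewrite !exprS; apply: ideal_subM.
Qed.

Lemma ideal_congr I f g : is_ideal I -> I (f - g) -> I g -> I f.
Proof. by move=> hI fg Ig; rewrite -[f](subrK g); apply: idealD. Qed.

Lemma ideal_unit I a b f : is_ideal I -> a * b = 1 -> I (a * f) -> I f.
Proof.
by move=> hI ab If; rewrite -[f]mul1r -ab mulrAC mulrC; apply: idealMl.
Qed.

Lemma ideal_gen_ideal (G : set A) : is_ideal (ideal_gen G).
Proof.
split=> [J [[]]//|f g If Ig J hJ|a f If J hJ].
- by apply: (idealD hJ.1); [exact: If|exact: Ig].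
- by apply: (idealMl _ hJ.1); exact: If.
Qed.

Lemma sub_ideal_gen (G : set A) : G `<=` ideal_gen G.
Proof. exact: sub_gen_smallest. Qed.

Lemma ideal_gen_sub (G I : set A) : is_ideal I -> G `<=` I -> ideal_gen G `<=` I.
Proof. exact: smallest_sub. Qed.

Lemma ideal_genS (G G' : set A) : G `<=` G' -> ideal_gen G `<=` ideal_gen G'.
Proof.
move=> GG'; apply: ideal_gen_sub; first exact: ideal_gen_ideal.
by apply: subset_trans GG' _; apply: sub_ideal_gen.
Qed.

Lemma kernel_ideal (B : comNzRingType) (f : {rmorphism A -> B}) :
  is_ideal [set x | f x = 0].
Proof.
split=> /= [|x y|a x]; first exact: rmorph0.
- by move=> fx fy; rewrite rmorphD fx fy addr0.
- by move=> fx; rewrite rmorphM fx mulr0.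
Qed.

Lemma kernel_prime (F : idomainType) (f : {rmorphism A -> F}) :
  prime_ideal [set x | f x = 0].
Proof.
split; first exact: kernel_ideal.
  by move=> /=; rewrite rmorph1 => /eqP; rewrite oner_eq0.
by move=> x y /=; rewrite rmorphM => /eqP; rewrite mulf_eq0 => /orP[] /eqP; [left|right].
Qed.

Lemma prime_expr Q f n : prime_ideal Q -> Q (f ^+ n) -> Q f.
Proof.
move=> [hQ Q1 pQ]; elim: n => [//|n IHn].
by rewrite exprS => /pQ[].
Qed.

Lemma multiplicity_setT : multiplicity [set: A] = 0.
Proof.
rewrite /multiplicity (_ : minimal_primes _ = set0) ?fsbig_set0 //.
by apply/seteqP; split=> // Q [] [_ Q1 _] /(_ 1 I).
Qed.

End Ideals.

(** * Length of a local ring whose ideals are the powers of one element *)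

Section LocalLength.
Context (A : comNzRingType) (I Q : set A) (p : A) (m : nat).
Hypotheses (hI : is_ideal I) (hQ : prime_ideal Q).
Hypothesis uniformizer : forall f,
  exists j u u', [/\ ~ Q u, ~ Q u' & I (u * f - u' * p ^+ j)].
Hypothesis nilpotent : exists2 u, ~ Q u & I (u * p ^+ m).
Hypothesis nilpotent_min : forall u j, ~ Q u -> I (u * p ^+ j) -> (m <= j)%N.

Let nQM u v : ~ Q u -> ~ Q v -> ~ Q (u * v).
Proof. by case: hQ => _ _ pQ nu nv /pQ[]. Qed.

Let nQ1 : ~ Q 1. Proof. by case: hQ. Qed.

Let powers (j : nat) : set (A * A) :=
  [set x | ~ Q x.2 /\ exists u a, ~ Q u /\ I (u * x.1 - a * p ^+ j)].

Let powers_ideal j : (j <= m)%N -> loc_ideal I Q (powers j).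
Proof.
move=> jm; split.
- by move=> x [].
- move=> [f s] [f' s'] [/= ns [u [a [nu Iu]]]] /= ns' [v nv /= Iv].
  split=> //=; exists (u * v * s), (a * v * s'); split; first by do 2 apply: nQM => //.
  have -> : u * v * s * f' - a * v * s' * p ^+ j =
    (v * s') * (u * f - a * p ^+ j) - u * (v * (f * s' - f' * s)) by ring.
  by apply: idealB => //; apply: idealMl.
- split=> //=; exists 1, 0; split=> //.
  by rewrite mulr0 mul0r subrr; apply: ideal0.
- move=> [f s] [f' s'] [/= ns [u [a [nu Iu]]]] [/= ns' [v [b [nv Iv]]]].
  split=> /=; first exact: nQM.
  exists (u * v), (a * v * s' + b * u * s); split; first exact: nQM.
  have -> : u * v * (f * s' + f' * s) - (a * v * s' + b * u * s) * p ^+ j =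
    (v * s') * (u * f - a * p ^+ j) + (u * s) * (v * f' - b * p ^+ j) by ring.
  by apply: idealD => //; apply: idealMl.
- move=> [f s] [f' s'] /= ns [/= ns' [v [b [nv Iv]]]]; split=> /=; first exact: nQM.
  exists v, (f * b); split=> //.
  have -> : v * (f * f') - f * b * p ^+ j = f * (v * f' - b * p ^+ j) by ring.
  exact: idealMl.
Qed.

Let powers_lt j : (j < m)%N -> powers j.+1 `<` powers j.
Proof.
move=> jm; split.
  move=> [f s] [/= ns [u [a [nu Iu]]]]; split=> //=; exists u, (a * p); split=> //.
  by rewrite -mulrA -exprS.
move=> /(_ (p ^+ j, 1)) []; first split=> //=.
  by exists 1, 1; split=> //; rewrite subrr; apply: ideal0.
move=> /= _ [u [a [nu Iu]]]; have [w nw Iw] := nilpotent.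
(* If [p ^+ j] were a multiple of [p ^+ j.+1], multiplying by [p ^+ (m.-1 - j)] would kill
   [p ^+ m.-1], against [nilpotent_min]. *)
have : I (w * u * p ^+ m.-1).
  have -> : w * u * p ^+ m.-1 = w * p ^+ (m.-1 - j) * (u * p ^+ j - a * p ^+ j.+1)
     + a * (w * p ^+ m).
    have jm1 : (j <= m.-1)%N by rewrite -ltnS (ltn_predK jm).
    have e1 : p ^+ m.-1 = p ^+ (m.-1 - j) * p ^+ j by rewrite -exprD subnK.
    have e2 : p ^+ m = p ^+ (m.-1 - j) * p ^+ j.+1.
      by rewrite -exprD addnS subnK ?(ltn_predK jm).
    by rewrite e1 e2; move: (p ^+ (m.-1 - j)) (p ^+ j) (p ^+ j.+1) => x y z; ring.
  by apply: idealD => //; apply: idealMl.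
move/(nilpotent_min (nQM nw nu)); case: (m) jm => // k _ /=.
by rewrite ltnn.
Qed.

Let loc_ideal_power N f s j u u' : loc_ideal I Q N -> ~ Q s -> ~ Q u -> ~ Q u' ->
  I (u * f - u' * p ^+ j) -> N (f, s) <-> N (p ^+ j, 1).
Proof.
move=> hN ns nu nu' Iuf; split.
  move=> /(loc_idealM hN (x := (u * s, u')) nu') /= NN.
  apply: (loc_ideal_eq hN NN) => //=; exists 1 => //=.
  have -> : 1 * (u * s * f * 1 - p ^+ j * (u' * s)) = s * (u * f - u' * p ^+ j) by ring.
  exact: idealMl.
move=> /(loc_idealM hN (x := (u', u * s)) (nQM nu ns)) /= NN.
apply: (loc_ideal_eq hN NN) => //=; exists 1 => //=.
have -> : 1 * (u' * p ^+ j * s - f * (u * s * 1)) = - s * (u * f - u' * p ^+ j) by ring.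
exact: idealMl.
Qed.

Let loc_ideal_up N j k : loc_ideal I Q N -> (j <= k)%N -> N (p ^+ j, 1) -> N (p ^+ k, 1).
Proof.
move=> hN jk /(loc_idealM hN (x := (p ^+ (k - j), 1)) nQ1) /=.
by rewrite -exprD subnK // mulr1.
Qed.

Let loc_chain_le k : loc_chain I Q k -> (k <= m)%N.
Proof.
move=> [c [cI clt]].
(* Along the chain each strict inclusion lowers the least exponent of a power of [p] in the ideal by
   at least one, starting from [p ^+ m], which is 0 in the local ring. *)
suff H i : (i <= k)%N -> (i <= m)%N /\ c i (p ^+ (m - i), 1) by case: (H k).
elim: i => [|i IHi] ik.
  split=> //; rewrite subn0; have h0 := cI 0%N ik.
  apply: (loc_ideal_eq h0 (loc_ideal0 h0)) => //=.
  have [u nu Iu] := nilpotent; exists u => //=.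
  by rewrite !mul0r mulr1 sub0r mulrN; apply: idealN.
have [im ci] := IHi (ltnW ik); have hi := cI i (ltnW ik).
have hi1 := cI i.+1 ik; have [sub nsub] := clt i ik.
have [[f s] [c1 nc]] : exists y, c i.+1 y /\ ~ c i y.
  apply: contrapT => h; apply: nsub => y cy; apply: contrapT => ny; apply: h; by exists y.
have ns : ~ Q s := loc_ideal_frac hi1 c1.
have [j [u [u' [nu nu' Iu]]]] := uniformizer f.
move/(loc_ideal_power hi1 ns nu nu' Iu): c1 => c1.
have {nc} nc : ~ c i (p ^+ j, 1) by move=> h; apply: nc; apply/(loc_ideal_power hi ns nu nu' Iu).
have jm : (j < m - i)%N.
  by rewrite ltnNge; apply/negP => h; apply: nc; apply: loc_ideal_up ci.
split; first by rewrite -subn_gt0 (leq_ltn_trans _ jm).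
apply: loc_ideal_up c1 => //.
by rewrite subnS -ltnS (ltn_predK jm).
Qed.

(** By [uniformizer] every element of the local ring is a unit times a power of [p]. So its ideals
    are generated by the powers of [p] with exponent at most [m], and they form a single chain. *)
Lemma loc_lengthE : loc_length I Q = m.
Proof.
have cm : loc_chain I Q m.
  exists (fun i => powers (m - i)); split=> i im; first by apply: powers_ideal; apply: leq_subr.
  have e : (m - i = (m - i.+1).+1)%N by rewrite subnSK.
  by rewrite e; apply: powers_lt; rewrite -e leq_subr.
apply: xget_unique; first by split=> // k; apply: loc_chain_le.
by move=> k [ck mk]; apply/eqP; rewrite eqn_leq loc_chain_le // mk.
Qed.

End LocalLength.

(** * Specialization T = r in K[T][S] *)

Section InnerEvaluation.
Context (K : fieldType).
Implicit Types (r : K) (p : {poly K}) (H : {poly {poly K}}).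

(* In [{poly {poly K}}] the inner variable is T and the outer variable is S.  *)
Definition evalT r : {poly {poly K}} -> {poly K} := map_poly (horner_eval r).
HB.instance Definition _ r := GRing.RMorphism.on (evalT r).

Lemma evalTM r : {morph evalT r : H H' / H * H'}.
Proof. exact: rmorphM. Qed.

Lemma evalTD r : {morph evalT r : H H' / H + H'}.
Proof. exact: rmorphD. Qed.

Lemma evalTB r : {morph evalT r : H H' / H - H'}.
Proof. exact: rmorphB. Qed.

Lemma evalTX r n : {morph evalT r : H / H ^+ n}.
Proof. exact: rmorphXn. Qed.

Lemma evalT0 r : evalT r 0 = 0.
Proof. exact: rmorph0. Qed.

Lemma evalT1 r : evalT r 1 = 1.
Proof. exact: rmorph1. Qed.

Lemma evalT_prod r (T : finType) (F : T -> {poly {poly K}}) :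
  evalT r (\prod_i F i) = \prod_i evalT r (F i).
Proof. exact: rmorph_prod. Qed.

Lemma evalT_X r : evalT r 'X = 'X.
Proof. exact: map_polyX. Qed.

Definition XsubT r : {poly {poly K}} := ('X - r%:P)%:P.

Lemma evalTC r p : evalT r p%:P = (p.[r])%:P.
Proof. exact: map_polyC. Qed.

Lemma evalT_XsubT r : evalT r (XsubT r) = 0.
Proof. by rewrite evalTC !hornerE subrr. Qed.

Lemma evalT_eq0 r H : evalT r H = 0 -> exists H', H = XsubT r * H'.
Proof.
move=> H0; exists (\poly_(i < size H) (H`_i %/ ('X - r%:P))).
apply/polyP=> i; rewrite coefCM coef_poly.
case: ltnP => [_|/leq_sizeP->]; rewrite ?mulr0 // mulrC divpK // dvdp_XsubCl.
by apply/rootP; have /polyP/(_ i) := H0; rewrite coef_map coef0.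
Qed.

Lemma XsubT_neq0 r : XsubT r != 0.
Proof. by rewrite polyC_eq0 polyXsubC_eq0. Qed.

(** Extracting T - r lowers the degree in T of the leading coefficient, so the process stops. *)
Lemma XsubT_valuation r H : H != 0 ->
  exists j H', H = XsubT r ^+ j * H' /\ evalT r H' != 0.
Proof.
have [d] := ubnP (size (lead_coef H)); elim: d H => // d IHd H Hd nzH.
have [/evalT_eq0[H' eH]|nz] := eqVneq (evalT r H) 0; last first.
  by exists 0%N, H; rewrite expr0 mul1r.
have nzH' : H' != 0 by apply: contraNneq nzH => h; rewrite eH h mulr0.
have [|j [H2 [e nz]]] := IHd H' _ nzH'.
  rewrite eH lead_coefM lead_coefC mulrC size_Mmonic ?monicXsubC ?lead_coef_eq0 // size_XsubC addn2 in Hd.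
  exact: Hd.
by exists j.+1, H2; rewrite eH e exprS mulrA.
Qed.

End InnerEvaluation.

(** * Multiplicity of a localization of K[S,T]/(p(T)) *)

Section PrincipalMultiplicity.
Context (K : closedFieldType) (A : comNzRingType).
Context (ev : {rmorphism {poly {poly K}} -> A}) (I : set A).
Context (z zi : A) (E : {poly {poly K}}) (p : {poly K}).
Hypotheses (hI : is_ideal I) (z_unit : z * zi = 1).
Hypothesis reduce : forall f, exists N H, I (z ^+ N * f - ev H).
Hypothesis zE : I (z - ev E).
Hypothesis I_ev : forall H, I (ev H) <-> exists H', H = p%:P * H'.
Hypotheses (p0 : p != 0) (good : forall r, root p r -> evalT r E != 0).

(** The prime of [A] that corresponds to T - r: a numerator of f, after clearing a power of [z],
    vanishes at T = r. By [wd] the choice of the numerator is immaterial. *)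
Let Q r : set A := [set f | exists N H, I (z ^+ N * f - ev H) /\ evalT r H = 0].

Let wd r f N H N' H' : root p r -> I (z ^+ N * f - ev H) ->
  I (z ^+ N' * f - ev H') -> evalT r H = 0 -> evalT r H' = 0.
Proof.
move=> pr IH IH' H0.
have /I_ev[G eG] : I (ev (E ^+ N' * H - E ^+ N * H')).
  rewrite rmorphB !rmorphM /= !rmorphXn.
  have zEN k : I (z ^+ k - ev E ^+ k) by apply: ideal_subX.
  have -> : ev E ^+ N' * ev H - ev E ^+ N * ev H' =
     (z ^+ N * (z ^+ N' * f - ev H') + (z ^+ N - ev E ^+ N) * ev H')
     - (z ^+ N' * (z ^+ N * f - ev H) + (z ^+ N' - ev E ^+ N') * ev H) by ring.
  by apply: idealB => //; apply: idealD => //; [apply: idealMl|apply: idealMr|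
     apply: idealMl|apply: idealMr].
have : evalT r (E ^+ N' * H - E ^+ N * H') = 0.
  by rewrite eG evalTM evalTC (rootP pr) mul0r.
rewrite evalTB !evalTM H0 mulr0 sub0r => /eqP; rewrite oppr_eq0 mulf_eq0.
by rewrite evalTX expf_eq0 (negPf (good pr)) andbF => /eqP.
Qed.

Let QE r f N H : root p r -> I (z ^+ N * f - ev H) -> Q r f <-> evalT r H = 0.
Proof.
move=> pr IH; split; last by move=> h; exists N, H.
by case=> N' [H' [IH' h]]; exact: (wd pr IH' IH h).
Qed.

Let Qev r H : root p r -> Q r (ev H) <-> evalT r H = 0.
Proof. by move=> pr; apply: (QE (N := 0%N)) => //; rewrite mul1r subrr; apply: ideal0. Qed.

Let Q_prime r : root p r -> prime_ideal (Q r).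
Proof.
move=> pr; split; first split.
- exists 0%N, 0; split; last exact: evalT0.
  by rewrite rmorph0 mulr0 subrr; apply: ideal0.
- move=> f g [N [H [IH H0]]] [N' [H' [IH' H0']]].
  exists (N + N')%N, (E ^+ N' * H + E ^+ N * H'); split; last first.
    by rewrite evalTD !evalTM H0 H0' !mulr0 addr0.
  rewrite rmorphD !rmorphM /= !rmorphXn exprD.
  have zEN k : I (z ^+ k - ev E ^+ k) by apply: ideal_subX.
  have -> : z ^+ N * z ^+ N' * (f + g) - (ev E ^+ N' * ev H + ev E ^+ N * ev H') =
     (z ^+ N' * (z ^+ N * f) - ev E ^+ N' * ev H) +
     (z ^+ N * (z ^+ N' * g) - ev E ^+ N * ev H') by ring.
  by apply: idealD => //; apply: ideal_subM.
- move=> a f [N [H [IH H0]]]; have [N' [H' IH']] := reduce a.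
  exists (N' + N)%N, (H' * H); split; last by rewrite evalTM H0 mulr0.
  have -> : z ^+ (N' + N) * (a * f) = (z ^+ N' * a) * (z ^+ N * f) by rewrite exprD; ring.
  by rewrite rmorphM; apply: ideal_subM.
- by rewrite -(rmorph1 ev) => /(Qev _ pr) /eqP; rewrite evalT1 oner_eq0.
- move=> f g; have [N [H IH]] := reduce f; have [N' [H' IH']] := reduce g.
  have IHH : I (z ^+ (N + N') * (f * g) - ev (H * H')).
    have -> : z ^+ (N + N') * (f * g) = (z ^+ N * f) * (z ^+ N' * g) by rewrite exprD; ring.
    by rewrite rmorphM; apply: ideal_subM.
  move/(QE pr IHH)/eqP; rewrite evalTM mulf_eq0 => /orP[] /eqP h; [left|right].
  - by exists N, H.
  - by exists N', H'.
Qed.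

Let I_sub_Q r : root p r -> I `<=` Q r.
Proof.
move=> pr f If; have [N [H IH]] := reduce f; exists N, H; split=> //.
have /I_ev[G ->] : I (ev H).
  rewrite -[ev H](subKr (z ^+ N * f)); apply: idealB => //; exact: idealMl.
by rewrite evalTM evalTC (rootP pr) mul0r.
Qed.

Let Q_sub r P : root p r -> prime_ideal P -> I `<=` P -> P (ev (XsubT r)) -> Q r `<=` P.
Proof.
move=> pr [hP P1 pP] IP PT f [N [H [IH /evalT_eq0[H' eH]]]].
have : P (z ^+ N * f).
  apply: (ideal_congr hP (IP _ IH)).
  by rewrite eH rmorphM; apply: idealMr.
case/pP=> // /(prime_expr (And3 hP P1 pP)) Pz.
by case: P1; rewrite -z_unit; apply: idealMr.
Qed.

Let rs := undup (sval (closed_field_poly_normal p)).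

Let p_prod : p = lead_coef p *: \prod_(r <- sval (closed_field_poly_normal p)) ('X - r%:P).
Proof. exact: (svalP (closed_field_poly_normal p)). Qed.

Let mem_rs r : (r \in rs) = root p r.
Proof.
by rewrite mem_undup [in RHS]p_prod rootZ ?lead_coef_eq0 // root_prod_XsubC.
Qed.

Let prime_root P : prime_ideal P -> I `<=` P -> exists2 r, root p r & P (ev (XsubT r)).
Proof.
move=> [hP P1 pP] IP; have : P (ev p%:P).
  by apply: IP; apply/I_ev; exists 1; rewrite mulr1.
rewrite [in X in P X]p_prod -mul_polyC polyCM rmorphM => /pP[h|].
  case: P1; have -> : 1 = ev ((lead_coef p)^-1)%:P%:P * ev (lead_coef p)%:P%:P.
    by rewrite -rmorphM -!polyCM mulVf ?lead_coef_eq0 // rmorph1.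
  exact: idealMl.
have : {subset sval (closed_field_poly_normal p) <= root p}.
  by move=> r; rewrite -mem_undup -/rs mem_rs.
elim: (sval _) => [|r s IHs] sub.
  by rewrite big_nil rmorph1.
rewrite big_cons polyCM rmorphM => /pP[h|].
  by exists r => //; apply: sub; rewrite inE eqxx.
by apply: IHs => x xs; apply: sub; rewrite inE xs orbT.
Qed.

Let Q_inj : {in rs &, injective Q}.
Proof.
move=> r s; rewrite !mem_rs => pr ps eQ.
have : Q r (ev (XsubT r)) by apply/(Qev _ pr)/evalT_XsubT.
rewrite eQ => /(Qev _ ps); rewrite evalTC !hornerE => /eqP.
by rewrite polyC_eq0 subr_eq0 => /eqP.
Qed.

Let minimal_primesE : minimal_primes I = [set` [seq Q r | r <- rs]].
Proof.
apply/seteqP; split=> P /=.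
  move=> [Pp IP Pmin]; have [r pr PT] := prime_root Pp IP.
  apply/mapP; exists r; first by rewrite mem_rs.
  apply/esym/Pmin => //; [exact: Q_prime|exact: I_sub_Q|exact: Q_sub].
move=> /mapP[r]; rewrite mem_rs => pr ->; split; [exact: Q_prime|exact: I_sub_Q|].
move=> P' Pp IP sub; have [s ps PT] := prime_root Pp IP.
have /(Qev _ pr) := sub _ PT; rewrite evalTC !hornerE => /eqP.
rewrite polyC_eq0 subr_eq0 => /eqP e; apply/seteqP; split=> //.
by apply: Q_sub => //; rewrite e.
Qed.

Let length_Q r : root p r ->
  loc_length I (Q r) = count_mem r (sval (closed_field_poly_normal p)).
Proof.
move=> pr; set m := count_mem _ _.
have [k pk kr] : exists2 k, p = k * ('X - r%:P) ^+ m & k.[r] != 0.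
  exists (lead_coef p *: \prod_(s <- sval (closed_field_poly_normal p) | s != r) ('X - s%:P)).
    rewrite {1}p_prod (bigID (pred1 r)) /= -scalerAl mulrC; congr (_ *: (_ * _)).
    by rewrite (eq_bigr (fun=> 'X - r%:P)) ?big_const_seq ?iter_mulr_1 // => i /eqP->.
  rewrite hornerZ mulf_neq0 ?lead_coef_eq0 // horner_prod prodf_seq_neq0.
  apply/allP => s _; apply/implyP => sr.
  by rewrite !hornerE subr_eq0 eq_sym.
have eqp : p%:P = k%:P * XsubT r ^+ m by rewrite {1}pk polyCM rmorphXn.
have nk : ~ Q r (ev k%:P).
  by move=> /(Qev _ pr); rewrite evalTC => /eqP; rewrite polyC_eq0 (negPf kr).
have nz N : ~ Q r (z ^+ N).
  move=> /(prime_expr (Q_prime pr)) Qz.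
  case: (Q_prime pr) => hQ Q1 _; apply: Q1; rewrite -z_unit; exact: idealMr.
have Ip : I (ev k%:P * ev (XsubT r) ^+ m).
  by rewrite -rmorphXn -rmorphM -eqp; apply/I_ev; exists 1; rewrite mulr1.
apply: (loc_lengthE (p := ev (XsubT r)) hI (Q_prime pr)).
- move=> f; have [N [H IH]] := reduce f.
  have [H0|nzH] := eqVneq H 0.
    exists m, (z ^+ N), (ev k%:P); split=> //.
    by apply: idealB => //; move: IH; rewrite H0 rmorph0 subr0.
  have [j [H' [eH nzH']]] := XsubT_valuation r nzH.
  exists j, (z ^+ N), (ev H'); split=> //; first by move=> /(Qev _ pr) /eqP; rewrite (negPf nzH').
  by rewrite -rmorphXn -rmorphM mulrC mulrC [H' * _]mulrC -eH.
- by exists (ev k%:P).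
- move=> u j nu Iu; have [N [H IH]] := reduce u.
  have nzH : evalT r H != 0 by apply/eqP => /(QE pr IH).
  have /I_ev[G eG] : I (ev (H * XsubT r ^+ j)).
    rewrite rmorphM rmorphXn; apply: (ideal_congr hI (g := z ^+ N * u * ev (XsubT r) ^+ j)).
      rewrite -mulrBl; apply: idealMr => //; rewrite -opprB; exact: idealN.
    by rewrite -mulrA; apply: idealMl.
  rewrite leqNgt; apply/negP => jm; move/negP: nzH; apply.
  have {}eG : H = k%:P * XsubT r ^+ (m - j) * G.
    apply/(mulIf (expf_neq0 j (XsubT_neq0 r))).
    by rewrite eG eqp -{1}(subnK (ltnW jm)) exprD; ring.
  rewrite eG !evalTM evalTX evalT_XsubT expr0n subn_eq0 leqNgt jm.
  by rewrite mulr0 mul0r.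
Qed.

(** The hypotheses identify A/I with K[S,T]/(p) localized at [E]. As [E] survives at every root of
    p, the minimal primes are given by the roots r, and the local ring at r has length the
    multiplicity of r as a root. These add up to deg p. *)
Lemma multiplicity_principal : multiplicity I = (size p).-1%:Z.
Proof.
rewrite /multiplicity minimal_primesE -fsbig_seq; last first.
  by rewrite map_inj_in_uniq ?undup_uniq.
rewrite big_map.
have -> : \sum_(r <- rs) (loc_length I (Q r))%:Z =
   \sum_(r <- rs) (count_mem r (sval (closed_field_poly_normal p)))%:Z.
  rewrite big_seq [RHS]big_seq; apply: eq_bigr => r.
  by rewrite mem_rs => /length_Q ->.
rewrite -(big_morph Posz PoszD (erefl _)); congr (Posz _).
rewrite [in RHS]p_prod size_scale ?lead_coef_eq0 // size_prod_XsubC /=.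
rewrite -(perm_size (perm_count_undup _)) size_flatten /shape -map_comp sumnE big_map.
by apply: eq_bigr => r _; rewrite /= size_nseq.
Qed.

End PrincipalMultiplicity.

Section PolyEvaluation.
Context (P B : comNzRingType) (f : {rmorphism P -> B}) (x : B).

Definition pev : {poly P} -> B := horner_morph (fun a => mulrC x (f a) : GRing.comm x (f a)).
HB.instance Definition _ := GRing.RMorphism.on pev.

Lemma pevC a : pev a%:P = f a.
Proof. exact: horner_morphC. Qed.

Lemma pevX : pev 'X = x.
Proof. exact: horner_morphX. Qed.

Lemma pevM : {morph pev : p q / p * q}.
Proof. exact: rmorphM. Qed.

Lemma pevD : {morph pev : p q / p + q}.
Proof. exact: rmorphD. Qed.

Lemma pevXn i : {morph pev : p / p ^+ i}.
Proof. exact: rmorphXn. Qed.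

Lemma pev_polyXn i : pev 'X^i = x ^+ i.
Proof. by rewrite pevXn pevX. Qed.

Lemma pev_term a i : pev (a%:P * 'X^i) = f a * x ^+ i.
Proof. by rewrite pevM pevC pev_polyXn. Qed.

Lemma pev_sum (T : Type) (s : seq T) (D : pred T) (F : T -> {poly P}) :
  pev (\sum_(i <- s | D i) F i) = \sum_(i <- s | D i) pev (F i).
Proof. exact: rmorph_sum. Qed.

Lemma pevE p : pev p = (map_poly f p).[x].
Proof. by []. Qed.
End PolyEvaluation.

Lemma prod_expr (B : comNzRingType) (T : finType) (F : T -> B) N :
  (\prod_i F i) ^+ N = \prod_i F i ^+ N.
Proof. by elim/big_rec2: _ => [|i x y _ <-]; rewrite ?expr1n // exprMn. Qed.

Lemma tofrac_sum (R0 : idomainType) (T : Type) (s : seq T) (F : T -> R0) :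
  (\sum_(i <- s) F i)%:F = \sum_(i <- s) (F i)%:F.
Proof. exact: rmorph_sum. Qed.

Lemma tofrac_prod (R0 : idomainType) (T : finType) (F : T -> R0) :
  (\prod_i F i)%:F = \prod_i (F i)%:F.
Proof. exact: rmorph_prod. Qed.

(** * Degree 0 Laurent polynomials, clearing of denominators and evaluation in fraction fields *)

Section LaurentMonomials.
Context (K : closedFieldType) (n : nat).
Local Notation S := (laurent K n).
Local Notation A := (laurent0 K n).
Local Notation V := 'rV[int]_n.+1.
Implicit Types (f g : A) (v w : V) (m k : 'I_n.+1).

Lemma degxD v w : degx (v + w) = degx v + degx w.
Proof. by rewrite /degx -big_split; apply: eq_bigr => i _; rewrite mxE. Qed.

Lemma degxZ (c : int) v : degx (c *: v) = c * degx v.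
Proof. by rewrite /degx mulr_sumr; apply: eq_bigr => i _; rewrite mxE. Qed.

Lemma degx_delta k : degx (delta_mx 0 k) = 1.
Proof.
rewrite /degx (bigD1 k) //= mxE !eqxx big1 ?addr0 // => i ik.
by rewrite mxE eqxx (negPf ik).
Qed.

Lemma degx_supp f v : (val f)@_v != 0 -> degx v = 0.
Proof. by case: f => f /= /deg0P; apply. Qed.

Lemma mono_mul v w (a b : K) : (<< a *g v >> : S) * << b *g w >> = << a * b *g (v + w) >>.
Proof. by rewrite galg_mulE galg_mulUU. Qed.

Definition deg0_proj k v : V := v - degx v *: delta_mx 0 k.

Lemma degx_deg0_proj k v : degx (deg0_proj k v) = 0.
Proof. by rewrite /deg0_proj -scaleN1r degxD !degxZ degx_delta mulr1 mulN1r subrr. Qed.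

Lemma deg0_proj_id k v : degx v = 0 -> deg0_proj k v = v.
Proof. by rewrite /deg0_proj => ->; rewrite scale0r subr0. Qed.

Lemma mono_deg0 k v (c : K) : (<< c *g deg0_proj k v >> : S) \in @Defs.deg0 K n.
Proof.
apply/deg0P => w; rewrite mcoeffU.
by have [<-|_] := eqVneq (deg0_proj k v) w; rewrite ?degx_deg0_proj ?eqxx.
Qed.

(* The degree 0 monomial obtained from x^v by setting x_k = 1.                *)
Definition zmon k v : A := Laurent0 (mono_deg0 k v 1).
Definition zvar k m : A := zmon k (delta_mx 0 m).

Lemma zmonD k v w : zmon k (v + w) = zmon k v * zmon k w.
Proof.
apply: val_inj; rewrite rmorphM /= mono_mul mulr1; congr (<< _ *g _ >>).
by rewrite /deg0_proj degxD scalerDl opprD addrACA.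
Qed.

Lemma zmon0 k : zmon k 0 = 1.
Proof.
apply: val_inj; rewrite /= /deg0_proj.
by rewrite (_ : degx 0 = 0) ?scale0r ?subr0 // -(scale0r (0 : V)) degxZ mul0r.
Qed.

Lemma zmonN k v : zmon k v * zmon k (- v) = 1.
Proof. by rewrite -zmonD subrr zmon0. Qed.

Lemma zmonMn k v i : zmon k (v *+ i) = zmon k v ^+ i.
Proof. by elim: i => [|i IHi]; rewrite ?zmon0 // mulrS zmonD IHi exprS. Qed.

Lemma zmon_sum k (T : Type) (s : seq T) (F : T -> V) :
  zmon k (\sum_(i <- s) F i) = \prod_(i <- s) zmon k (F i).
Proof. by rewrite (big_morph _ (zmonD k) (zmon0 k)). Qed.

Lemma zvar_self k : zvar k k = 1.
Proof.
apply: val_inj; rewrite /= /deg0_proj degx_delta scale1r subrr.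
by [].
Qed.

Lemma cst_deg0 (c : K) : (<< c *g 0 >> : S) \in @Defs.deg0 K n.
Proof.
apply/deg0P => w; rewrite mcoeffU; have [<- _|_] := eqVneq 0 w; last by rewrite eqxx.
by rewrite /degx big1 // => i _; rewrite mxE.
Qed.

Definition cst (c : K) : A := Laurent0 (cst_deg0 c).

Lemma cst_is_additive : {morph cst : x y / x - y}.
Proof. by move=> x y; apply: val_inj; rewrite rmorphB /= monalgUB. Qed.

Lemma cst_is_monoid_morphism : monoid_morphism cst.
Proof.
split=> [|x y]; first by apply: val_inj.
by apply: val_inj; rewrite rmorphM /= mono_mul addr0.
Qed.

HB.instance Definition _ := GRing.isZmodMorphism.Build K A cst cst_is_additive.
HB.instance Definition _ := GRing.isMonoidMorphism.Build K A cst cst_is_monoid_morphism.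

Lemma cst_zmon_val k v (c : K) : val (cst c * zmon k v) = << c *g deg0_proj k v >>.
Proof. by rewrite rmorphM /= mono_mul mulr1 add0r. Qed.

Lemma laurent0E k f : f = \sum_(v <- msupp (val f)) cst (val f)@_v * zmon k v.
Proof.
apply: val_inj; rewrite rmorph_sum /= [LHS]monalgE !big_seq; apply: eq_bigr => v.
rewrite -mcoeff_neq0 => /degx_supp dv.
by rewrite mono_mul mulr1 add0r deg0_proj_id.
Qed.

Definition clears (N : nat) f := forall v m, (val f)@_v != 0 -> 0 <= N%:Z + v 0 m.

Lemma clears_exists f : exists N, clears N f.
Proof.
exists (\sum_(v <- msupp (val f)) \sum_m absz (v 0%R m))%N => v m.
rewrite mcoeff_neq0 => sv.
rewrite (big_rem v) //= (bigD1 m) //= -[X in _ + X]opprK subr_ge0.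
by apply: (le_trans (ler_norm _)); rewrite normrN -abszE lez_nat -!addnA leq_addr.
Qed.

Lemma clearsW N N' f : (N <= N')%N -> clears N f -> clears N' f.
Proof. by move=> NN' cf v m /(cf v m) /le_trans; apply; rewrite lerD2r lez_nat. Qed.

Lemma clear_zmon k v N : (forall m, 0 <= N%:Z + v 0 m) ->
  (\prod_m zvar k m) ^+ N * zmon k v = \prod_m zvar k m ^+ absz (N%:Z + v 0 m).
Proof.
move=> cv; have -> : zmon k v = \prod_m zmon k (v 0 m *: delta_mx 0 m).
  by rewrite {1}(row_sum_delta v) zmon_sum.
rewrite prod_expr -big_split; apply: eq_bigr => m _ /=.
rewrite -!zmonMn -zmonD; congr (zmon k _).
rewrite -!scaler_nat -scalerDl; congr (_ *: _).
by rewrite !natz gez0_abs ?cv.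
Qed.

Lemma clearE k f N : clears N f -> (\prod_m zvar k m) ^+ N * f =
  \sum_(v <- msupp (val f)) cst (val f)@_v * \prod_m zvar k m ^+ absz (N%:Z + v 0 m).
Proof.
move=> cf; rewrite {1}(laurent0E k f) mulr_sumr [LHS]big_seq [RHS]big_seq; apply: eq_bigr => v.
rewrite -mcoeff_neq0 => sv.
by rewrite -(clear_zmon k (fun m => cf v m sv)) mulrCA.
Qed.

Section Reduce.
Context (P : comNzRingType) (ev : {rmorphism P -> A}) (iota : {rmorphism K -> P}).
Context (I : set A) (k : 'I_n.+1) (q : 'I_n.+1 -> P).
Hypotheses (hI : is_ideal I) (ev_cst : forall c, ev (iota c) = cst c).
Hypothesis zq : forall m, I (zvar k m - ev (q m)).

Lemma ideal_sub_prod (T : finType) (F G : T -> A) :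
  (forall i, I (F i - G i)) -> I (\prod_i F i - \prod_i G i).
Proof.
move=> FG; elim/big_rec2: _ => [|i x y _ h]; first by rewrite subrr; apply: ideal0.
exact: ideal_subM.
Qed.

(** A power of the product of all variables makes every exponent nonnegative; each variable can then
    be replaced by its polynomial expression [q m] modulo [I]. *)
Lemma laurent0_reduce f : exists N H, I ((\prod_m zvar k m) ^+ N * f - ev H).
Proof.
have [N cf] := clears_exists f; exists N.
exists (\sum_(v <- msupp (val f)) iota (val f)@_v * \prod_m q m ^+ absz (N%:Z + v 0 m)).
rewrite (clearE k cf) rmorph_sum -sumrB; apply: ideal_sum => // v _.
rewrite rmorphM /= ev_cst -mulrBr; apply: idealMl => //.
rewrite rmorph_prod; apply: ideal_sub_prod => m.
by rewrite rmorphXn; apply: ideal_subX.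
Qed.

End Reduce.

Section Lift.
Context (R0 : idomainType) (iota : {rmorphism K -> R0}) (u : 'I_n.+1 -> R0).
Local Notation F := {fraction R0}.

Definition vval (v : V) : F := \prod_m ((u m)%:F ^ (v 0 m)).

(** Carrying [u0] as an argument lets the ring morphism structure, which rests on invertible values,
    be attached to the term itself. *)
Definition laurent_fraceval (u0 : forall m, u m != 0) (f : S) : F :=
  mmap (@FracField.tofrac R0 \o iota) vval f.

Context (u0 : forall m, u m != 0).

Let uF m : (u m)%:F != 0 :> F.
Proof. by rewrite tofrac_eq0. Qed.

Lemma vvalD v w : vval (v + w) = vval v * vval w.
Proof. by rewrite -big_split; apply: eq_bigr => m _; rewrite mxE expfzDr. Qed.

Lemma vval0 : vval 0 = 1.
Proof. by rewrite /vval big1 // => m _; rewrite mxE expr0z. Qed.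

Lemma vval_scale_delta (a : int) m : vval (a *: delta_mx 0 m) = (u m)%:F ^ a.
Proof.
rewrite /vval (bigD1 m) //= !mxE !eqxx mulr1 big1 ?mulr1 // => i im.
by rewrite !mxE eqxx (negPf im) mulr0 expr0z.
Qed.

Lemma vval_delta m : vval (delta_mx 0 m) = (u m)%:F.
Proof. by rewrite -[delta_mx 0 m]scale1r vval_scale_delta expr1z. Qed.

Lemma laurent_fracevalU (c : K) v : laurent_fraceval u0 << c *g v >> = (iota c)%:F * vval v.
Proof. exact: (@mmapU _ _ _ (@FracField.tofrac R0 \o iota)). Qed.

Lemma laurent_fraceval_is_additive : {morph laurent_fraceval u0 : f g / f - g}.
Proof. exact: (raddfB (mmap (@FracField.tofrac R0 \o iota) vval)). Qed.

HB.instance Definition _ := GRing.isZmodMorphism.Build S F (laurent_fraceval u0) laurent_fraceval_is_additive.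

Lemma laurent_fraceval_sum (T : Type) (s : seq T) (F' : T -> S) :
  laurent_fraceval u0 (\sum_(i <- s) F' i) = \sum_(i <- s) laurent_fraceval u0 (F' i).
Proof. exact: raddf_sum. Qed.

Lemma laurent_fraceval_is_monoid_morphism : monoid_morphism (laurent_fraceval u0).
Proof.
split=> [|f g]; first by rewrite laurent_fracevalU !rmorph1 mul1r vval0.
rewrite galg_mulE laurent_fraceval_sum [laurent_fraceval u0 f]mmapE [laurent_fraceval u0 g]mmapE mulr_suml.
apply: eq_bigr => v _; rewrite laurent_fraceval_sum mulr_sumr; apply: eq_bigr => w _.
by rewrite laurent_fracevalU rmorphM tofracM vvalD mulrACA.
Qed.

HB.instance Definition _ := GRing.isMonoidMorphism.Build S F (laurent_fraceval u0) laurent_fraceval_is_monoid_morphism.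

Definition fraceval : A -> F := laurent_fraceval u0 \o val.
HB.instance Definition _ := GRing.RMorphism.on fraceval.

Lemma fraceval_cst c : fraceval (cst c) = (iota c)%:F.
Proof. by rewrite /fraceval /= laurent_fracevalU vval0 mulr1. Qed.

Lemma vval_clear N v : (forall m, 0 <= N%:Z + v 0 m) ->
  (\prod_m u m)%:F ^+ N * vval v = (\prod_m u m ^+ absz (N%:Z + v 0 m))%:F.
Proof.
move=> cv; rewrite -tofracXn prod_expr !tofrac_prod -big_split.
apply: eq_bigr => m _; rewrite /= !tofracXn !exprnP gez0_abs ?expfzDr //.
Qed.

Lemma fraceval_clear N f (s : seq V) (D : pred V) (c : V -> K) :
  val f = \sum_(v <- s | D v) << c v *g v >> ->
  (forall v, D v -> forall m, 0 <= N%:Z + v 0 m) ->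
  (\prod_m u m)%:F ^+ N * fraceval f =
  (\sum_(v <- s | D v) iota (c v) * \prod_m u m ^+ absz (N%:Z + v 0 m))%:F.
Proof.
move=> ef cD.
have -> : fraceval f = laurent_fraceval u0 (\sum_(v <- [seq v <- s | D v]) << c v *g v >>).
  by rewrite big_filter -ef.
rewrite laurent_fraceval_sum mulr_sumr.
rewrite -[in RHS]big_filter tofrac_sum [LHS]big_seq [RHS]big_seq; apply: eq_bigr => v.
by rewrite mem_filter => /andP[/cD cv _]; rewrite laurent_fracevalU mulrCA vval_clear // tofracM.
Qed.

Context (k : 'I_n.+1) (uk : u k = 1).

Lemma vval_deg0_proj v : vval (deg0_proj k v) = vval v.
Proof.
rewrite vvalD [X in _ * X]/vval big1 ?mulr1 // => m _; rewrite !mxE eqxx /=.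
by have [->|_] := eqVneq m k; rewrite ?uk ?tofrac1 ?exp1rz // mulr0 oppr0 expr0z.
Qed.

Lemma fraceval_zmon v : fraceval (zmon k v) = vval v.
Proof. by rewrite /fraceval /= laurent_fracevalU rmorph1 tofrac1 mul1r vval_deg0_proj. Qed.

Lemma fraceval_zvar m : fraceval (zvar k m) = (u m)%:F.
Proof. by rewrite fraceval_zmon vval_delta. Qed.

End Lift.
End LaurentMonomials.

(** * Lowest terms of polynomials in S *)

Section LowestTerm.
Context (B : idomainType).
Implicit Types (H : {poly B}) (c : B) (d : nat).

(** The coefficient [c] may be 0, so that sums stay in this form even when their lowest terms
    cancel. *)
Definition lowest H d c := exists H', H = 'X^d * (c%:P + 'X * H').

Lemma lowestM H H' d d' c c' : lowest H d c -> lowest H' d' c' ->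
  lowest (H * H') (d + d') (c * c').
Proof.
move=> [G ->] [G' ->]; exists (c%:P * G' + c'%:P * G + 'X * G * G').
by rewrite exprD polyCM; ring.
Qed.

Lemma lowest1 : lowest 1 0 1.
Proof. by exists 0; rewrite expr0 mul1r mulr0 addr0. Qed.

Lemma lowest_const c : lowest c%:P 0 c.
Proof. by exists 0; rewrite expr0 mul1r mulr0 addr0. Qed.

Lemma lowestX H d c m : lowest H d c -> lowest (H ^+ m) (m * d) (c ^+ m).
Proof.
move=> lH; elim: m => [|m IHm]; first by rewrite !expr0; apply: lowest1.
by rewrite !exprS mulSn; apply: lowestM.
Qed.

Lemma lowest_prod (T : finType) (F : T -> {poly B}) (d : T -> nat) (c : T -> B) :
  (forall i, lowest (F i) (d i) (c i)) ->
  lowest (\prod_i F i) (\sum_i d i)%N (\prod_i c i).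
Proof.
by move=> lF; elim/big_rec3: _ => [|i x y z _ h]; [exact: lowest1|exact: lowestM].
Qed.

Lemma lowestD H H' d c c' : lowest H d c -> lowest H' d c' ->
  lowest (H + H') d (c + c').
Proof. by move=> [G ->] [G' ->]; exists (G + G'); rewrite polyCD; ring. Qed.

Lemma lowest_lt H d d' c : (d < d')%N -> lowest H d' c -> lowest H d 0.
Proof.
move=> dd [G ->]; exists ('X^(d' - d.+1) * (c%:P + 'X * G)).
by rewrite polyC0 add0r -(subnKC dd) exprD exprS addKn; ring.
Qed.

Lemma lowest_gtD H H' d d' c c' : (d < d')%N -> lowest H d c -> lowest H' d' c' ->
  lowest (H + H') d c.
Proof. by move=> dd lH lH'; rewrite -[c]addr0; apply: lowestD => //; apply: lowest_lt lH'. Qed.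

Lemma lowestN H d c : lowest H d c -> lowest (- H) d (- c).
Proof. by move=> [G ->]; exists (- G); rewrite polyCN; ring. Qed.

Lemma lowest_coef H d c : lowest H d c -> H`_d = c.
Proof.
by move=> [G ->]; rewrite coefXnM ltnn subnn coefD coefC mulrC coefMX addr0.
Qed.

Lemma lowest_coef_lt H d c i : lowest H d c -> (i < d)%N -> H`_i = 0.
Proof. by move=> [G ->] id; rewrite coefXnM id. Qed.

Lemma lowest_exists H : H != 0 -> exists d c, c != 0 /\ lowest H d c.
Proof.
elim/poly_ind: H => [|H c IHH nz]; first by rewrite eqxx.
have [c0|nzc] := eqVneq c 0; last first.
  by exists 0%N, c; split=> //; exists H; rewrite expr0 mul1r addrC mulrC.
move: nz; rewrite c0 addr0 mulf_eq0 polyX_eq0 orbF => /IHH[d [c' [nzc' [G eG]]]].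
by exists d.+1, c'; split=> //; exists G; rewrite eG exprS; ring.
Qed.

(** Over a domain lowest coefficients multiply. This is the reason why initial forms in a principal
    ideal are multiples of the initial form of the generator; [E] takes care of denominators. *)
Lemma lowest_dvd F E G H d e g cf ce cg :
  F * E = G * H -> lowest F d cf -> lowest E e ce -> lowest G g cg -> cg != 0 ->
  exists q, ce * cf = cg * q.
Proof.
move=> eFG lF lE lG nz.
have [H0|/lowest_exists[h [c [nzc lH]]]] := eqVneq H 0.
  have := lowest_coef (lowestM lF lE); rewrite eFG H0 mulr0 coef0 => c0.
  by exists 0; rewrite mulr0 mulrC.
have l1 := lowestM lF lE; have l2 := lowestM lG lH.
rewrite eFG in l1; case: (ltngtP (d + e) (g + h)) => cmp.
- by exists 0; rewrite mulr0 mulrC -(lowest_coef l1) (lowest_coef_lt l2 cmp).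
- have := lowest_coef l2; rewrite (lowest_coef_lt l1 cmp) => /esym/eqP.
  by rewrite mulf_eq0 (negPf nz) (negPf nzc).
- by exists c; rewrite mulrC -(lowest_coef l1) cmp (lowest_coef l2).
Qed.

End LowestTerm.

(** * Weights and initial forms *)

Section InitialForms.
Context (K : closedFieldType) (n : nat) (R : realType).
Local Notation S := (laurent K n).
Local Notation A := (laurent0 K n).
Local Notation V := 'rV[int]_n.+1.
Context (w : 'rV[R]_n.+1) (om : 'I_n.+1 -> nat) (c0 : R).
Hypothesis w_om : forall m, w 0 m = c0 + (om m)%:R.
Implicit Types (f g : A) (v : V).

Definition wt v : int := \sum_m (om m)%:Z * v 0 m.

Lemma wtD v v' : wt (v + v') = wt v + wt v'.
Proof. by rewrite -big_split; apply: eq_bigr => m _; rewrite mxE mulrDr. Qed.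

Lemma wtZ (a : int) v : wt (a *: v) = a * wt v.
Proof. by rewrite /wt mulr_sumr; apply: eq_bigr => m _; rewrite mxE mulrCA. Qed.

Lemma wt0 : wt 0 = 0.
Proof. by rewrite /wt big1 // => m _; rewrite mxE mulr0. Qed.

Lemma wt_delta m : wt (delta_mx 0 m) = (om m)%:Z.
Proof.
rewrite /wt (bigD1 m) //= mxE !eqxx mulr1 big1 ?addr0 // => i im.
by rewrite mxE eqxx (negPf im) mulr0.
Qed.

Lemma weight_wt v : degx v = 0 -> weight w v = (wt v)%:~R.
Proof.
move=> dv; rewrite /weight /wt rmorph_sum /=.
under eq_bigr do rewrite w_om mulrDl.
rewrite big_split /= -mulr_sumr -rmorph_sum /= -[\sum_i v 0 i]/(degx v) dv mulr0 add0r.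
by apply: eq_bigr => m _; rewrite rmorphM.
Qed.

Definition wt_is (d : int) f := forall v, (val f)@_v != 0 -> wt v = d.
Definition wt_ge (d : int) f := forall v, (val f)@_v != 0 -> d <= wt v.

Lemma supp_mul f g v : (val (f * g))@_v != 0 ->
  exists a b, [/\ (val f)@_a != 0, (val g)@_b != 0 & v = a + b].
Proof.
apply: contra_neqP => h.
have -> : val (f * g) = galg_mul (val f) (val g) by [].
rewrite raddf_sum /= big_seq big1 // => a fa.
rewrite raddf_sum /= big_seq big1 // => b gb; rewrite mcoeffU.
have [ab|//] := eqVneq (a + b) v; case: h; exists a, b.
by rewrite !mcoeff_neq0.
Qed.

Lemma supp_add f g v : (val (f + g))@_v != 0 -> (val f)@_v != 0 \/ (val g)@_v != 0.
Proof.
have -> : val (f + g) = val f + val g :> S by [].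
rewrite mcoeffD => nz.
have [f0|] := eqVneq (val f)@_v 0; last by left.
by right; rewrite f0 add0r in nz.
Qed.

Lemma wt_geM d d' f g : wt_ge d f -> wt_ge d' g -> wt_ge (d + d') (f * g).
Proof. by move=> wf wg v /supp_mul[a [b [fa gb ->]]]; rewrite wtD lerD ?wf ?wg. Qed.

Lemma wt_isM d d' f g : wt_is d f -> wt_is d' g -> wt_is (d + d') (f * g).
Proof. by move=> wf wg v /supp_mul[a [b [fa gb ->]]]; rewrite wtD wf ?wg. Qed.

Lemma wt_geD d f g : wt_ge d f -> wt_ge d g -> wt_ge d (f + g).
Proof. by move=> wf wg v /supp_add[/wf|/wg]. Qed.

Lemma wt_isD d f g : wt_is d f -> wt_is d g -> wt_is d (f + g).
Proof. by move=> wf wg v /supp_add[/wf|/wg]. Qed.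

Lemma wt_isN d f : wt_is d f -> wt_is d (- f).
Proof.
move=> wf v; have -> : val (- f) = - val f :> S by [].
by rewrite mcoeffN oppr_eq0 => /wf.
Qed.

Lemma wt_geN d f : wt_ge d f -> wt_ge d (- f).
Proof.
move=> wf v; have -> : val (- f) = - val f :> S by [].
by rewrite mcoeffN oppr_eq0 => /wf.
Qed.

Lemma wt_ge_is d f : wt_is d f -> wt_ge d f.
Proof. by move=> wf v /wf ->. Qed.

Lemma wt_is0 d : wt_is d 0.
Proof. by move=> v; rewrite mcoeff0 eqxx. Qed.

Lemma wt_is_cst c : wt_is 0 (cst n c).
Proof.
move=> v; rewrite mcoeffU; have [<-|_] := eqVneq 0 v; last by rewrite eqxx.
by rewrite wt0.
Qed.

Lemma wt_is1 : wt_is 0 1.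
Proof. by rewrite -(rmorph1 (cst n)); apply: wt_is_cst. Qed.

Lemma wt_isX d f i : wt_is d f -> wt_is (d *+ i) (f ^+ i).
Proof.
move=> wf; elim: i => [|i IHi]; first exact: wt_is1.
by rewrite mulrS exprS; apply: wt_isM.
Qed.

Lemma wt_is_zmon k v : om k = 0%N -> wt_is (wt v) (zmon K k v).
Proof.
move=> ok v'; rewrite mcoeffU; have [<- _|_] := eqVneq (deg0_proj k v) v'; last by rewrite eqxx.
by rewrite /deg0_proj -scaleN1r !wtD !wtZ wt_delta ok !mulr0 addr0.
Qed.

Lemma init_form0_low d f0 f1 : f0 <> 0 -> wt_is d f0 -> wt_ge (d + 1) f1 ->
  init_form0 w (f0 + f1) = f0.
Proof.
move=> nz0 w0 w1; apply: val_inj => /=; apply/malgP => v.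
set f := f0 + f1; have fE v' : (val f)@_v' = (val f0)@_v' + (val f1)@_v'.
  by rewrite -mcoeffD.
have wd v' : v' \in msupp (val f) -> d <= wt v'.
  rewrite -mcoeff_neq0 => /supp_add[/w0->//|/w1]; apply: le_trans.
  by rewrite lerDl.
have dsupp v' : v' \in msupp (val f) -> degx v' = 0.
  by rewrite -mcoeff_neq0 => /degx_supp.
rewrite /init_form raddf_sum /= (eq_bigr (fun v' => (val f)@_v' *+ (v' == v))); last first.
  by move=> v' _; rewrite mcoeffU.
have [e0|nz] := eqVneq (val f0)@_v 0.
  rewrite e0 big_seq_cond big1 // => v' /andP[sv' /allP hv'].
  have [ev|//] := eqVneq v' v; rewrite {v'}ev in sv' hv' *.
  have w1v : d + 1 <= wt v.
    by apply: w1; move: sv'; rewrite -mcoeff_neq0 fE e0 add0r.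
  have [v0 nz0v] : exists v0, (val f0)@_v0 != 0.
    apply: contrapT => h; apply: nz0; apply: val_inj; apply/malgP => v0 /=.
    by rewrite mcoeff0; apply/eqP; apply: contrapT => h0; apply: h; exists v0; apply/negP.
  have sv0 : v0 \in msupp (val f).
    rewrite -mcoeff_neq0 fE; have [->|/w1] := eqVneq (val f1)@_v0 0; first by rewrite addr0.
    by rewrite (w0 _ nz0v) gerDl.
  have := hv' _ sv0; rewrite !weight_wt ?dsupp // ler_int (w0 _ nz0v).
  by move/(le_trans w1v); rewrite gerDl.
have f1v : (val f1)@_v = 0.
  by apply/eqP; apply: contraT => /w1; rewrite (w0 _ nz) gerDl.
have fv : (val f)@_v = (val f0)@_v by rewrite fE f1v addr0.
have sv : v \in msupp (val f) by rewrite -mcoeff_neq0 fv.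
rewrite (big_rem v) //=.
have -> : all (fun v' => weight w v <= weight w v') (msupp (val f)).
  by apply/allP => v' sv'; rewrite !weight_wt ?dsupp // ler_int (w0 _ nz) wd.
rewrite eqxx mulr1n fv big_seq_cond big1 ?addr0 // => v' /andP[+ _].
by rewrite mem_rem_uniq ?fset_uniq // inE => /andP[/negPf-> _].
Qed.

Lemma init_ideal_low d (I : set A) f0 f1 :
  I (f0 + f1) -> wt_is d f0 -> wt_ge (d + 1) f1 -> init_ideal w I f0.
Proof.
move=> If w0 w1; have [->|nz] := pselect (f0 = 0).
  by apply: ideal0; apply: ideal_gen_ideal.
apply: sub_ideal_gen; exists (f0 + f1) => //.
exact: init_form0_low w1.
Qed.

Lemma init_ideal_ideal (I : set A) : is_ideal (init_ideal w I).
Proof. exact: ideal_gen_ideal. Qed.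

Lemma init_idealS (I J : set A) : I `<=` J -> init_ideal w I `<=` init_ideal w J.
Proof. by move=> IJ; apply: ideal_genS => _ [f If <-]; exists f => //; apply: IJ. Qed.

End InitialForms.

(** Roots of p are removed one at a time: T - r is prime and divides [H * E] but not [E], hence it
    divides [H]. *)
Lemma polyC_dvd_coprime (K : closedFieldType) (p : {poly K}) (E H H' : {poly {poly K}}) :
  p != 0 -> (forall r, root p r -> evalT r E != 0) -> H * E = p%:P * H' ->
  exists H2, H = p%:P * H2.
Proof.
have [d] := ubnP (size p); elim: d p H H' => // d IHd p H H' pd p0 good eH.
have [s1|s1] := eqVneq (size p) 1%N.
  have [c c0 ep] := size_poly1P _ (introT eqP s1).
  exists ((c^-1)%:P%:P * H); rewrite ep mulrA -!polyCM mulfV //.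
  by rewrite mul1r.
have [r pr] := closed_rootP p s1; have /factor_theorem[q eq] := pr.
have /eqP : evalT r (H * E) = 0 by rewrite eH evalTM evalTC (rootP pr) mul0r.
rewrite evalTM mulf_eq0 (negPf (good _ pr)) orbF => /eqP/evalT_eq0[H1 eH1].
have q0 : q != 0 by apply: contraNneq p0 => q0; rewrite eq q0 mul0r.
have [||r' qr'||H2 eH2] := IHd q H1 H'.
- by rewrite eq size_Mmonic ?monicXsubC // size_XsubC addn2 in pd.
- exact: q0.
- by apply: good; rewrite eq rootM qr'.
- apply: (mulfI (XsubT_neq0 r)); rewrite mulrA -eH1 eH eq polyCM /XsubT; ring.
by exists H2; rewrite eH1 eH2 eq polyCM /XsubT; ring.
Qed.

Lemma lowest_sum (B : idomainType) (T : choiceType) (s : seq T) (F : T -> {poly B})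
  (e : T -> nat) (c : T -> B) D :
  (forall i, i \in s -> lowest (F i) (e i) (c i)) -> (forall i, i \in s -> D <= e i)%N ->
  lowest (\sum_(i <- s) F i) D (\sum_(i <- s | e i == D) c i).
Proof.
elim: s => [|i s IHs] lF De.
  by rewrite !big_nil; exists 0; rewrite mulr0 addr0 mulr0.
have {IHs}IHs : lowest (\sum_(i <- s) F i) D (\sum_(i <- s | e i == D) c i).
  by apply: IHs => x xs; [apply: lF|apply: De]; rewrite inE xs orbT.
have lFi := lF i (mem_head _ _); rewrite !big_cons.
have [ei|nei] := eqVneq (e i) D; first by apply: lowestD => //; rewrite ei in lFi.
rewrite addrC; apply: lowest_gtD lFi => //.
by rewrite ltn_neqAle eq_sym nei De ?mem_head.
Qed.

(** * Substitution of monomials adapted to a weight vector *)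

Section Degeneration.
Context (K : closedFieldType) (n : nat) (R : realType).
Local Notation A := (laurent0 K n).
Local Notation V := 'rV[int]_n.+1.
Local Notation B := {poly {poly K}}.
Context (w : 'rV[R]_n.+1) (om : 'I_n.+1 -> nat) (c0 : R).
Hypothesis w_om : forall m, w 0 m = c0 + (om m)%:R.
Context (k : 'I_n.+1) (om_k : om k = 0%N) (s t : V).
Hypotheses (wt_s : wt om s = 1) (wt_t : wt om t = 0).

(** S goes to a monomial of weight 1 and T to a monomial of weight 0, so that the weight filtration
    becomes the S-adic one. *)
Definition degen_ev : B -> A := pev (pev (cst n) (zmon K k t)) (zmon K k s).
HB.instance Definition _ := GRing.RMorphism.on degen_ev.
Local Notation ev := degen_ev.

Definition polyCC : K -> B := polyC \o polyC.
HB.instance Definition _ := GRing.RMorphism.on polyCC.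

Lemma degen_evC p : ev p%:P = pev (cst n) (zmon K k t) p.
Proof. exact: pevC. Qed.

Lemma degen_evCC c : ev (polyCC c) = cst n c.
Proof. by rewrite degen_evC pevC. Qed.

Lemma degen_evX : ev 'X = zmon K k s.
Proof. exact: pevX. Qed.

Lemma degen_evT : ev 'X%:P = zmon K k t.
Proof. by rewrite degen_evC pevX. Qed.

Lemma degen_evM : {morph ev : x y / x * y}.
Proof. exact: rmorphM. Qed.

Lemma degen_evD : {morph ev : x y / x + y}.
Proof. exact: rmorphD. Qed.

Lemma degen_evXn i : {morph ev : x / x ^+ i}.
Proof. exact: rmorphXn. Qed.

Lemma wt_is_evC p : wt_is om 0 (ev p%:P).
Proof.
elim/poly_ind: p => [|p c IHp]; first by rewrite polyC0 rmorph0; apply: wt_is0.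
rewrite polyCD polyCM degen_evD degen_evM degen_evT; apply: wt_isD.
  by rewrite -[0]addr0; apply: wt_isM => //; rewrite -wt_t; apply: wt_is_zmon.
by rewrite (degen_evCC c); apply: wt_is_cst.
Qed.

Lemma wt_ge_ev H : wt_ge om 0 (ev H).
Proof.
elim/poly_ind: H => [|H c IHH]; first by rewrite rmorph0; apply/wt_ge_is/wt_is0.
rewrite degen_evD degen_evM degen_evX; apply: wt_geD; last exact/wt_ge_is/wt_is_evC.
rewrite -[0]addr0; apply: wt_geM => //.
have wz : wt_is om 1 (zmon K k s) by rewrite -wt_s; apply: wt_is_zmon.
by move=> v /wz ->.
Qed.

Lemma wt_is_evXn d : wt_is om d%:Z (ev 'X^d).
Proof.
rewrite degen_evXn degen_evX -natz.
by apply: wt_isX; rewrite -wt_s; apply: wt_is_zmon.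
Qed.

(** All terms of [ev H] after the lowest one have weight at least [d + 1], so the part of [f - ev H]
    of weight [d] is its initial form, or is 0. *)
Lemma init_ideal_degen (I : set A) f d c H : wt_is om d%:Z f ->
  lowest H d c -> I (f - ev H) -> init_ideal w I (f - ev ('X^d * c%:P)).
Proof.
move=> wf [G ->] If.
apply: (init_ideal_low w_om (d := d%:Z) (f1 := - ev ('X^(d.+1) * G))).
- have -> : f - ev ('X^d * c%:P) - ev ('X^(d.+1) * G) = f - ev ('X^d * (c%:P + 'X * G)).
    by rewrite -addrA -opprD -degen_evD exprS; congr (_ - ev _); ring.
  exact: If.
- apply: wt_isD => //; apply: wt_isN; rewrite degen_evM -[d%:Z]addr0.
  by apply: wt_isM; [exact: wt_is_evXn|exact: wt_is_evC].
- apply: wt_geN; rewrite degen_evM -[_ + 1]addr0; apply: wt_geM; last exact: wt_ge_ev.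
  by rewrite -PoszD addn1; apply/wt_ge_is/wt_is_evXn.
Qed.

End Degeneration.

Lemma polyC_sum (B : comNzRingType) (T : Type) (s : seq T) (D : pred T) (F : T -> B) :
  (\sum_(i <- s | D i) F i)%:P = \sum_(i <- s | D i) (F i)%:P.
Proof. exact: rmorph_sum. Qed.

Lemma polyC_prod (B : comNzRingType) (T : finType) (F : T -> B) :
  (\prod_i F i)%:P = \prod_i (F i)%:P.
Proof. exact: rmorph_prod. Qed.

(** * The initial ideal of a hypersurface in the plane *)

Section DegenerationMultiplicity.
Context (K : closedFieldType) (n : nat) (R : realType).
Local Notation A := (laurent0 K n).
Local Notation V := 'rV[int]_n.+1.
Local Notation B := {poly {poly K}}.
Context (w : 'rV[R]_n.+1) (om : 'I_n.+1 -> nat) (c0 : R).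
Hypothesis w_om : forall m, w 0 m = c0 + (om m)%:R.
Context (k : 'I_n.+1) (om_k : om k = 0%N) (s t : V).
Hypotheses (wt_s : wt om s = 1) (wt_t : wt om t = 0).
Context (xi : 'I_n.+1 -> {poly K}) (U : 'I_n.+1 -> B).
Hypothesis U_lowest : forall m, lowest (U m) (om m) (xi m).
Hypothesis xi_neq0 : forall m, xi m != 0.
Local Notation ev := (degen_ev k s t).
Local Notation iota := (@polyCC K).

Let u m : B := 'X^(om m) * (xi m)%:P.

Hypotheses (vval_Us : vval U s = ('X : B)%:F) (vval_Ut : vval U t = ('X%:P : B)%:F).
Hypotheses (vval_us : vval u s = ('X : B)%:F) (vval_ut : vval u t = ('X%:P : B)%:F).
Hypothesis Uk : U k = 1.

Let uk : u k = 1.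
Proof.
have := lowest_coef (U_lowest k); rewrite Uk om_k coef1 eqxx => xk.
by rewrite /u om_k -xk expr0 mul1r.
Qed.

Let U0 m : U m != 0.
Proof.
have := lowest_coef (U_lowest m).
by apply: contra_eq_neq => ->; rewrite coef0 eq_sym.
Qed.

Let u0 m : u m != 0.
Proof. by rewrite mulf_neq0 ?expf_neq0 ?polyX_eq0 ?polyC_eq0. Qed.

Let fraceval_ev (phi : {rmorphism A -> {fraction B}}) H :
  (forall c, phi (cst n c) = (iota c)%:F) -> phi (zmon K k s) = ('X : B)%:F ->
  phi (zmon K k t) = ('X%:P : B)%:F -> phi (ev H) = H%:F.
Proof.
move=> phic phis phit; have phiC p : phi (ev p%:P) = (p%:P)%:F.
  elim/poly_ind: p => [|p c IHp]; first by rewrite polyC0 !rmorph0.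
  rewrite polyCD polyCM degen_evD degen_evM degen_evT (degen_evCC k s t c).
  by rewrite tofracD tofracM -IHp -phit -phic -rmorphM -rmorphD.
elim/poly_ind: H => [|H c IHH]; first by rewrite !rmorph0.
rewrite degen_evD degen_evM degen_evX tofracD tofracM -IHH -phiC -phis.
by rewrite -rmorphM -rmorphD.
Qed.

Let LU : {rmorphism A -> {fraction B}} := @fraceval K n B iota U U0.
Let Lu : {rmorphism A -> {fraction B}} := @fraceval K n B iota u u0.

Let LU_zmon v : LU (zmon K k v) = vval U v.
Proof. exact: (@fraceval_zmon _ _ _ _ _ U0 k Uk). Qed.

Let Lu_zmon v : Lu (zmon K k v) = vval u v.
Proof. exact: (@fraceval_zmon _ _ _ _ _ u0 k uk). Qed.

Let LU_clear N (f : A) (s' : seq V) (D : pred V) (c : V -> K) :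
  val f = \sum_(v <- s' | D v) << c v *g v >> ->
  (forall v, D v -> forall m, 0 <= N%:Z + v 0 m) ->
  (\prod_m U m)%:F ^+ N * LU f =
  (\sum_(v <- s' | D v) iota (c v) * \prod_m U m ^+ absz (N%:Z + v 0 m) : B)%:F.
Proof. exact: (@fraceval_clear K n B iota U U0). Qed.

Let Lu_clear N (f : A) (s' : seq V) (D : pred V) (c : V -> K) :
  val f = \sum_(v <- s' | D v) << c v *g v >> ->
  (forall v, D v -> forall m, 0 <= N%:Z + v 0 m) ->
  (\prod_m u m)%:F ^+ N * Lu f =
  (\sum_(v <- s' | D v) iota (c v) * \prod_m u m ^+ absz (N%:Z + v 0 m) : B)%:F.
Proof. exact: (@fraceval_clear K n B iota u u0). Qed.

Let LU_ev H : LU (ev H) = H%:F.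
Proof.
apply: fraceval_ev => [c||]; first exact: (@fraceval_cst _ _ _ _ _ U0).
- by rewrite LU_zmon.
- by rewrite LU_zmon.
Qed.

Let Lu_ev H : Lu (ev H) = H%:F.
Proof.
apply: fraceval_ev => [c||]; first exact: (@fraceval_cst _ _ _ _ _ u0).
- by rewrite Lu_zmon.
- by rewrite Lu_zmon.
Qed.

Context (L0 P : set A) (G : B) (nu e : nat) (p : {poly K}).
Hypotheses (hL0 : is_ideal L0) (hP : is_ideal P) (L0P : L0 `<=` P).
Hypothesis zU : forall m, L0 (zvar K k m - ev (U m)).
Hypothesis L0_fraceval : forall (V0 : forall m, U m != 0) f, L0 f -> @fraceval K n B iota U V0 f = 0.
Hypotheses (P_G : P (ev G)) (P_div : forall f, P f -> exists h, L0 (f - ev G * h)).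
Hypotheses (G_lowest : lowest G nu ('X^e * p)) (p0 : p != 0).
Hypothesis good : forall r, root p r -> forall m, (xi m).[r] != 0.

Local Notation I := (init_ideal w P).
Let z : A := \prod_m zvar K k m.
Let E : B := \prod_m u m.

Let hI : is_ideal I.
Proof. exact: init_ideal_ideal. Qed.

Let zu m : I (zvar K k m - ev (u m)).
Proof.
apply: (init_ideal_degen w_om om_k wt_s wt_t _ (U_lowest m)); last exact: L0P.
by rewrite -(wt_delta om m); apply: wt_is_zmon.
Qed.

Let zE : I (z - ev E).
Proof. by rewrite /E rmorph_prod; apply: ideal_sub_prod. Qed.

Let z_unit : exists zi, z * zi = 1.
Proof.
exists (zmon K k (- \sum_m delta_mx 0 m)).
by rewrite -(zmonN K k (\sum_m delta_mx 0 m)) zmon_sum.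
Qed.

Let evalT_E r : root p r -> evalT r E != 0.
Proof.
move=> pr; rewrite /E evalT_prod; apply/prodf_neq0 => m _.
by rewrite evalTM evalTX evalT_X evalTC mulf_neq0 ?expf_neq0 ?polyX_eq0 ?polyC_eq0 ?good.
Qed.

Let E0 : E%:F != 0 :> {fraction B}.
Proof. by rewrite tofrac_eq0; apply/prodf_neq0. Qed.

Let fraceval_poly f : exists N H, E%:F ^+ N * Lu f = (H : B)%:F.
Proof.
have [N cf] := clears_exists f; exists N.
have ef : val f = \sum_(v <- msupp (val f) | v \in msupp (val f)) << (val f)@_v *g v >>.
  by rewrite -big_seq -monalgE.
eexists; apply: (Lu_clear ef) => v.
by rewrite -mcoeff_neq0 => sv m; apply: cf.
Qed.

(** An upper bound for the initial ideal: the elements whose value at the initial point [u], cleared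
    of the denominator [E], is divisible by p. Being an ideal, it contains [I] as soon as it
    contains the initial forms. *)
Let J : set A := [set f | exists N H, E%:F ^+ N * Lu f = (p%:P * H : B)%:F].

Let J_ideal : is_ideal J.
Proof.
split=> [|f g [N [H eH]] [N' [H' eH']]|a f [N [H eH]]].
- by exists 0%N, 0; rewrite rmorph0 !mulr0 tofrac0.
- exists (N + N')%N, (E ^+ N' * H + E ^+ N * H').
  rewrite rmorphD [in RHS]mulrDr [p%:P * (_ * H)]mulrCA [p%:P * (_ * H')]mulrCA.
  rewrite tofracD (tofracM (E ^+ N')) (tofracM (E ^+ N)) -eH -eH' !tofracXn exprD; ring.
- have [N' [H' eH']] := fraceval_poly a; exists (N' + N)%N, (H' * H).
  rewrite rmorphM [p%:P * _]mulrCA [RHS]tofracM -eH -eH' exprD; ring.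
Qed.

(** Since L0 vanishes at the point [U], there f = G h. Passing to lowest coefficients in S turns f
    into its initial form evaluated at [u], and [lowest_dvd] makes this value, up to factors from
    [E], a multiple of the lowest coefficient of [G]. *)
Let init_form_J f : P f -> J (init_form0 w f).
Proof.
move=> Pf; have [h /(L0_fraceval U0)] := P_div Pf; rewrite -[fraceval _ _ _]/(LU _) rmorphB rmorphM LU_ev.
move=> /eqP; rewrite subr_eq0 => /eqP LUf.
pose s' := msupp (val f).
pose ex N (v : V) := (\sum_m (om m * absz (N%:Z + v 0 m)%R))%N.
have [N cf] := clears_exists f; have [N' ch] := clears_exists h.
have efs : val f = \sum_(v <- s' | v \in s') << (val f)@_v *g v >>.
  by rewrite -big_seq -monalgE.
have ehs : val h = \sum_(v <- msupp (val h) | v \in msupp (val h)) << (val h)@_v *g v >>.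
  by rewrite -big_seq -monalgE.
have cfs v : v \in s' -> forall m, 0 <= N%:Z + v 0 m.
  by rewrite -mcoeff_neq0 => sv m; apply: cf.
have chs v : v \in msupp (val h) -> forall m, 0 <= N'%:Z + v 0 m.
  by rewrite -mcoeff_neq0 => sv m; apply: ch.
have := @LU_clear _ _ _ _ _ efs cfs.
set F := \sum_(v <- s' | v \in s') _ => eF.
have := @LU_clear _ _ _ _ _ ehs chs.
set H := \sum_(v <- _ | _) _ => eH.
set PU := \prod_m U m in eF eH.
have eq1 : F * PU ^+ N' = G * (PU ^+ N * H).
  apply/eqP; rewrite -tofrac_eq; apply/eqP; rewrite !tofracM !tofracXn -eF -eH.
  rewrite LUf; ring.
(* exponent of S in the clearing of denominators of x^v *)
have ex_wt v v' : v \in s' -> v' \in s' -> (ex N v <= ex N v')%N = (weight w v <= weight w v').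
  move=> sv sv'; have dv : degx v = 0 by move: sv; rewrite -mcoeff_neq0 => /degx_supp.
  have dv' : degx v' = 0 by move: sv'; rewrite -mcoeff_neq0 => /degx_supp.
  rewrite !(weight_wt w_om) // ler_int -lez_nat.
  have exE y : y \in s' -> (ex N y)%:Z = \sum_m (om m)%:Z * N%:Z + wt om y.
    move=> sy; rewrite /ex (big_morph Posz PoszD (erefl _)) -big_split /=.
    by apply: eq_bigr => m _; rewrite PoszM gez0_abs ?cfs // mulrDr.
  by rewrite !exE // lerD2l.
have [f0|[v0 sv0]] : f = 0 \/ exists v0, v0 \in s'.
  have [->|nz] := eqVneq f 0; [by left|right].
  apply: contrapT => hn; move/eqP: nz; apply; apply: val_inj; apply/malgP => v /=.
  rewrite mcoeff0; apply/eqP; apply: contrapT => /negP nz; apply: hn.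
  by exists v; rewrite -mcoeff_neq0.
  rewrite f0 (_ : init_form0 w 0 = 0); first exact: ideal0.
  by apply: val_inj => /=; rewrite /init_form msupp0 big_seq_fset0.
have [D [vm svm eD] Dmin] : exists2 D, (exists2 v, v \in s' & ex N v = D) &
    forall v, v \in s' -> (D <= ex N v)%N.
  have /ex_minnP[D /existsP[[v sv] /= /eqP eD] Dmin] :
    exists D, [exists v : s', ex N (val v) == D].
    by exists (ex N v0); apply/existsP; exists [` sv0]%fset.
  exists D; first by exists v.
  by move=> v' sv'; apply: Dmin; apply/existsP; exists [` sv']%fset.
(* The least order D is attained exactly by the monomials of the initial form. Their sum may still
   vanish, which [lowest] allows. *)
have lF : lowest F D (\sum_(v <- s' | ex N v == D)
    ((val f)@_v)%:P * \prod_m xi m ^+ absz (N%:Z + v 0 m)).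
  rewrite /F -big_seq; apply: (lowest_sum (e := ex N)) => // v sv.
  apply: (@lowestM _ _ _ 0); first exact: lowest_const.
  apply: lowest_prod => m; rewrite [X in lowest _ X]mulnC; exact: lowestX.
have lPU : lowest (PU ^+ N') (N' * \sum_m om m) ((\prod_m xi m) ^+ N').
  by apply: lowestX; apply: lowest_prod.
move: lF; set c := \sum_(v <- s' | _) _ => lF.
have [|q eq2] := lowest_dvd eq1 lF lPU G_lowest.
  by rewrite mulf_neq0 ?expf_neq0 ?polyX_eq0.
have eE : E = 'X^(\sum_m om m) * (\prod_m xi m)%:P.
  by rewrite /E /u big_split /= polyC_prod -expr_sum.
have ein : val (init_form0 w f) = \sum_(v <- s' | (v \in s') && (ex N v == D)) << (val f)@_v *g v >>.
  rewrite /= /init_form -/s' big_seq_cond; apply: eq_bigl => v.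
  have [sv|//] := boolP (v \in s'); rewrite !andTb; apply/allP/eqP => [hm|eD' v' sv'].
    apply/eqP; rewrite eqn_leq Dmin // andbT -eD ex_wt //; exact: hm.
  by rewrite -ex_wt // eD' Dmin.
have cin v : (v \in s') && (ex N v == D) -> forall m, 0 <= N%:Z + v 0 m.
  by case/andP => /cfs.
have := @Lu_clear _ _ _ _ _ ein cin.
rewrite -[\prod_m u m]/E => e3.
exists (N' + N)%N, ('X^D * ('X^(\sum_m om m)) ^+ N' * ('X^e * q)%:P).
rewrite exprD -mulrA e3 -tofracXn -tofracM; congr (_%:F).
have -> : \sum_(v <- s' | (v \in s') && (ex N v == D)) iota (val f)@_v *
     \prod_m u m ^+ absz (N%:Z + v 0 m) = 'X^D * c%:P.
  rewrite -big_seq_cond /c polyC_sum mulr_sumr; apply: eq_bigr => v /eqP <-.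
  rewrite polyCM mulrCA; congr (_ * _).
  rewrite polyC_prod /ex expr_sum -big_split; apply: eq_bigr => m _.
  by rewrite /u exprMn -exprM -polyC_exp.
have eq3 : ((\prod_m xi m)%:P ^+ N') * c%:P = p%:P * ('X^e * q)%:P.
  by rewrite -polyC_exp -!polyCM eq2 -mulrA mulrCA.
rewrite eE exprMn; transitivity ('X^D * 'X^(\sum_m om m) ^+ N' *
    (((\prod_m xi m)%:P ^+ N') * c%:P)); first by ring.
by rewrite eq3; ring.
Qed.

Let I_ev H : I (ev H) <-> exists H', H = p%:P * H'.
Proof.
split=> [IH|[H' ->]].
  have IJ : I `<=` J by apply: (ideal_gen_sub J_ideal) => _ [f Pf <-]; apply: init_form_J.
  have [N [H' eH']] := IJ _ IH; rewrite Lu_ev -tofracXn -tofracM in eH'.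
  have {}eH' : H * E ^+ N = p%:P * H'.
    by apply/eqP; rewrite -tofrac_eq -eH' mulrC.
  apply: polyC_dvd_coprime eH' => // r pr.
  by rewrite evalTX expf_neq0 ?evalT_E.
rewrite degen_evM; apply: (idealMr _ hI).
(* Conversely the lowest term of [G] lies in the initial ideal, and its factors S and T can be
   cancelled because they go to monomials, which are units. *)
have /(idealN hI) : I (0 - ev ('X^nu * ('X^e * p)%:P)).
  apply: (init_ideal_degen w_om om_k wt_s wt_t _ G_lowest); first exact: wt_is0.
  by rewrite sub0r; apply: idealN.
rewrite sub0r opprK polyCM 2!degen_evM !degen_evXn degen_evX polyC_exp degen_evXn degen_evT.
rewrite -!zmonMn mulrA -zmonD; exact: (ideal_unit hI (zmonN _ _ _)).
Qed.

(** Modulo the initial ideal each variable is its lowest term [u m], and by [I_ev] the relations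
    among S and T are the multiples of p; [multiplicity_principal] applies. *)
Lemma multiplicity_degeneration : multiplicity (init_ideal w P) = (size p).-1%:Z.
Proof.
have [zi ezi] := z_unit.
apply: (multiplicity_principal (ev := ev) hI ezi _ zE I_ev p0 evalT_E).
exact: (@laurent0_reduce K n B ev iota I k u hI (degen_evCC k s t) zu).
Qed.

End DegenerationMultiplicity.

Lemma malgZU (B : nzRingType) (V : choiceType) (c x : B) (v : V) :
  c *: << x *g v >> = << c * x *g v >> :> {malg B[V]}.
Proof. by apply/malgP => v'; rewrite mcoeffZ !mcoeffU mulrnAr. Qed.

(** * Linear coordinates and frames on the plane *)

Section Plane.
Context (K : closedFieldType) (n d : nat) (M : 'M[K]_(d, n.+1)).
Local Notation S := (laurent K n).
Local Notation A := (laurent0 K n).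
Local Notation L := (linear_ideal M).
Local Notation L0 := (deg0_part L).

Lemma deg0_part_ideal : is_ideal L0.
Proof.
have hL : is_ideal L := ideal_gen_ideal _.
split=> [|f g Lf Lg|a f Lf]; rewrite /deg0_part /=.
- exact: ideal0.
- exact: (idealD hL).
- exact: (idealMl _ hL).
Qed.

Lemma scale_mono (c x : K) (v : 'rV[int]_n.+1) :
  c *: (<< x *g v >> : S) = << c * x *g v >>.
Proof. exact: malgZU. Qed.

Lemma linear_formE (a : 'rV[K]_n.+1) :
  linear_form a = \sum_m (<< a 0 m *g delta_mx 0 m >> : S).
Proof. by apply: eq_bigr => m _; rewrite scale_mono mulr1. Qed.

(* coordinates on the kernel of [M]: its row [m] is the linear form x_m *)
Definition coordinates (C : 'M[K]_(n.+1, 3)) :=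
  forall a : 'rV[K]_n.+1, (a <= M)%MS = (a *m C == 0).

Lemma coordinates_exist : (\rank M + 3 = n.+1)%N -> exists C, coordinates C.
Proof.
move=> rkM.
have rk : \rank (cokermx M) = 3.
  by apply/eqP; rewrite mxrank_coker -(eqn_add2l (\rank M)) subnKC ?rank_leq_col // rkM.
have : exists C : 'M[K]_(n.+1, \rank (cokermx M)),
    forall a : 'rV[K]_n.+1, (a <= M)%MS = (a *m C == 0).
  exists (col_base (cokermx M)) => a; rewrite submxE -{1}(mulmx_base (cokermx M)) mulmxA.
  apply/eqP/eqP => [e|->]; last by rewrite mul0mx.
  apply: (row_free_inj (row_base_free (cokermx M))); by rewrite e mul0mx.
by rewrite rk.
Qed.

Context (C : 'M[K]_(n.+1, 3)) (hC : coordinates C).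

Lemma mem_linear_form a : a *m C = 0 -> L (linear_form a).
Proof.
move/eqP; rewrite -hC => /submxP[D ->].
have hL : is_ideal L := ideal_gen_ideal _.
have -> : linear_form (D *m M) = \sum_j (<< D 0 j *g 0 >> : S) * linear_form (row j M).
  rewrite linear_formE.
  transitivity (\sum_m \sum_j (<< D 0 j * M j m *g delta_mx 0 m >> : S)).
    apply: eq_bigr => m _; rewrite mxE.
    exact: (raddf_sum (mkmalgU (delta_mx 0 m))).
  rewrite exchange_big; apply: eq_bigr => j _; rewrite linear_formE mulr_sumr.
  by apply: eq_bigr => m _; rewrite mono_mul add0r mxE.
have h j : L ((<< D 0 j *g 0 >> : S) * linear_form (row j M)).
  by apply: (idealMl _ hL); apply: sub_ideal_gen; exists j.
exact: (@ideal_sum _ _ _ (index_enum _) xpredT _ hL (fun j _ => h j)).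
Qed.

Definition zlin k (b : 'rV[K]_n.+1) : A := \sum_m cst n (b 0 m) * zvar K k m.

Lemma zlin_val k b : val (zlin k b) = (<< - delta_mx 0 k >> : S) * linear_form b.
Proof.
rewrite linear_formE mulr_sumr.
transitivity (\sum_m val (cst n (b 0 m) * zvar K k m)); first exact: rmorph_sum.
apply: eq_bigr => m _; rewrite cst_zmon_val mono_mul mul1r /deg0_proj degx_delta scale1r.
by rewrite addrC.
Qed.

Lemma mem_zlin k b : b *m C = 0 -> L0 (zlin k b).
Proof.
move=> bC; rewrite /deg0_part /= zlin_val; have hL : is_ideal L := ideal_gen_ideal _.
exact: (idealMl _ hL (mem_linear_form bC)).
Qed.

Lemma zlinB k : {morph zlin k : b b' / b - b'}.
Proof.
move=> b b'; rewrite /zlin -sumrB; apply: eq_bigr => m _.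
by rewrite !mxE rmorphB mulrBl.
Qed.

Lemma zlin_sum k (T : finType) (F : T -> 'rV[K]_n.+1) :
  zlin k (\sum_i F i) = \sum_i zlin k (F i).
Proof.
rewrite /zlin exchange_big; apply: eq_bigr => m _.
by rewrite summxE rmorph_sum mulr_suml.
Qed.

Lemma zlin_delta k m c : zlin k (c *: delta_mx 0 m) = cst n c * zvar K k m.
Proof.
rewrite /zlin (bigD1 m) //= !mxE !eqxx mulr1 big1 ?addr0 // => i im.
by rewrite !mxE eqxx (negPf im) mulr0 rmorph0 mul0r.
Qed.

Definition frame (f : 'I_3 -> 'I_n.+1) := rowsub f C = 1%:M.

Lemma frameE f l h : frame f -> C (f l) h = (l == h)%:R.
Proof. by move=> /matrixP/(_ l h); rewrite !mxE. Qed.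

Lemma mem_zvar_frame f k m : frame f ->
  L0 (zvar K k m - \sum_l cst n (C m l) * zvar K k (f l)).
Proof.
move=> hf; pose b : 'rV[K]_n.+1 := 1 *: delta_mx 0 m - \sum_l C m l *: delta_mx 0 (f l).
have -> : zvar K k m - \sum_l cst n (C m l) * zvar K k (f l) = zlin k b.
  rewrite zlinB zlin_sum zlin_delta rmorph1 mul1r; congr (_ - _).
  by apply: eq_bigr => l _; rewrite zlin_delta.
apply: mem_zlin; rewrite mulmxBl scale1r -rowE mulmx_suml; apply/eqP.
rewrite subr_eq0; apply/eqP/rowP => h; rewrite summxE mxE.
under eq_bigr => l _ do rewrite -scalemxAl -rowE !mxE (frameE _ _ hf).
by rewrite (bigD1 h) //= eqxx mulr1 big1 ?addr0 // => l lh; rewrite (negPf lh) mulr0.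
Qed.

(** A zero row would place the variable x_m, a unit, in L. *)
Lemma row_coordinates_neq0 m : L <> setT -> exists l, C m l != 0.
Proof.
move=> nL; apply: contrapT => h; apply: nL.
have hL : is_ideal L := ideal_gen_ideal _.
have Lm : L (linear_form (delta_mx 0 m)).
  apply: mem_linear_form; rewrite -rowE; apply/rowP => l; rewrite !mxE.
  by apply/eqP; apply: contrapT => /negP nz; apply: h; exists l.
have L1 : L 1.
  have -> : (1 : S) = (<< - delta_mx 0 m >> : S) * linear_form (delta_mx 0 m).
    rewrite linear_formE (bigD1 m) //= mxE !eqxx big1 ?addr0; last first.
      by move=> i im; rewrite mxE eqxx (negPf im) monalgU0.
    by rewrite mono_mul mulr1 addNr.
  exact: (idealMl _ hL).
apply/seteqP; split=> // f _; rewrite -[f]mulr1; exact: (idealMl _ hL).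
Qed.

Section Points.
Context (R0 : idomainType) (iota : {rmorphism K -> R0}).

Definition ptv (c : 'I_3 -> R0) (m : 'I_n.+1) : R0 := \sum_l iota (C m l) * c l.

Lemma ptv_frame f c l : frame f -> ptv c (f l) = c l.
Proof.
move=> hf; rewrite /ptv (bigD1 l) //= (frameE _ _ hf) eqxx rmorph1 mul1r.
rewrite big1 ?addr0 // => h hl.
by rewrite (frameE _ _ hf) eq_sym (negPf hl) rmorph0 mul0r.
Qed.

Lemma coordinates_row j l : \sum_m M j m * C m l = 0.
Proof.
have /eqP/rowP/(_ l) : row j M *m C == 0 by rewrite -hC row_sub.
by rewrite !mxE; under eq_bigr do rewrite mxE.
Qed.

Lemma fraceval_linear_ideal c (u0 : forall m, ptv c m != 0) f :
  L0 f -> @fraceval K n R0 iota (ptv c) u0 f = 0.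
Proof.
rewrite /deg0_part /= => Lf.
suff : L `<=` [set x | laurent_fraceval iota u0 x = 0] by apply.
apply: ideal_gen_sub; first exact: kernel_ideal.
move=> _ [j _ <-]; rewrite /= linear_formE laurent_fraceval_sum.
transitivity ((\sum_m iota (M j m) * ptv c m)%:F : {fraction R0}).
  rewrite tofrac_sum; apply: eq_bigr => m _.
  by rewrite laurent_fracevalU vval_delta mxE tofracM.
have -> : \sum_m iota (M j m) * ptv c m = 0; last exact: tofrac0.
transitivity (\sum_l iota (\sum_m M j m * C m l) * c l); last first.
  by rewrite big1 // => l _; rewrite coordinates_row rmorph0 mul0r.
rewrite /ptv; under eq_bigr do rewrite mulr_sumr.
rewrite exchange_big; apply: eq_bigr => l _; rewrite rmorph_sum mulr_suml.
by apply: eq_bigr => m _; rewrite rmorphM mulrA.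
Qed.

End Points.
End Plane.

Section ChangeOfFrame.
Context (K : closedFieldType) (n d : nat) (M : 'M[K]_(d, n.+1)).
Implicit Types (C : 'M[K]_(n.+1, 3)) (f : 'I_3 -> 'I_n.+1).

Lemma frame_exists C f : coordinates M C -> rowsub f C \in unitmx ->
  exists C', coordinates M C' /\ frame C' f.
Proof.
move=> hC fu; exists (C *m invmx (rowsub f C)); split.
  move=> a; rewrite hC mulmxA; apply/eqP/eqP => [->|e]; first by rewrite mul0mx.
  by rewrite -[a *m C](mulmxKV fu) e mul0mx.
by rewrite /frame -mul_rowsub_mx mulmxV.
Qed.

Lemma frame_rel C C' f : coordinates M C -> coordinates M C' -> frame C' f ->
  forall m h, C m h = \sum_l C' m l * C (f l) h.
Proof.
move=> hC hC' hf m h.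
pose b : 'rV[K]_n.+1 := delta_mx 0 m - \sum_l C' m l *: delta_mx 0 (f l).
have : b *m C' == 0.
  rewrite mulmxBl -rowE mulmx_suml subr_eq0; apply/eqP/rowP => l; rewrite summxE mxE.
  under eq_bigr => l' _ do rewrite -scalemxAl -rowE !mxE (frameE _ _ hf).
  by rewrite (bigD1 l) //= eqxx mulr1 big1 ?addr0 // => l' /negPf->; rewrite mulr0.
rewrite -hC' hC mulmxBl -rowE mulmx_suml subr_eq0 => /eqP/rowP/(_ h).
rewrite mxE => ->; rewrite summxE; apply: eq_bigr => l _.
by rewrite -scalemxAl -rowE !mxE.
Qed.

Lemma ptv_rel (R0 : idomainType) (iota : {rmorphism K -> R0}) C C' f c m :
  coordinates M C -> coordinates M C' -> frame C f ->
  ptv C' iota c m = ptv C iota (fun l => ptv C' iota c (f l)) m.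
Proof.
move=> hC hC' hf; rewrite /ptv; under eq_bigr do rewrite (frame_rel hC' hC hf) rmorph_sum mulr_suml.
rewrite exchange_big; apply: eq_bigr => l _; rewrite mulr_sumr.
by apply: eq_bigr => h _; rewrite rmorphM mulrA.
Qed.

End ChangeOfFrame.

Definition o0 : 'I_3 := ord0.
Definition o1 : 'I_3 := Ordinal (isT : (1 < 3)%N).
Definition o2 : 'I_3 := ord_max.

Lemma I3P (P : 'I_3 -> Prop) : P o0 -> P o1 -> P o2 -> forall h, P h.
Proof.
move=> P0 P1 P2; case=> -[|[|[|//]]] lt; [move: P0|move: P1|move: P2];
  by congr P; apply: val_inj.
Qed.

Lemma sum_I3 (V : nmodType) (F : 'I_3 -> V) : \sum_h F h = F o0 + F o1 + F o2.
Proof.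
rewrite !big_ord_recl big_ord0 addr0 addrA; congr (_ + F _ + F _); exact: val_inj.
Qed.

(** The exponent matrix has determinant 1, and the exponents on the left are the entries of its
    inverse. *)
Lemma unimodular_monomials (F : fieldType) (x y : F) (e0 t0 e1 t1 : nat) :
  x != 0 -> y != 0 -> (e0 * t1 = (e1 * t0).+1)%N ->
  (x ^+ e0 * y ^+ t0) ^ t1%:Z * (x ^+ e1 * y ^+ t1) ^ (- t0%:Z) = x /\
  (x ^+ e0 * y ^+ t0) ^ (- e1%:Z) * (x ^+ e1 * y ^+ t1) ^ e0%:Z = y.
Proof.
move=> x0 y0 det; have nz i j : x ^+ i * y ^+ j != 0 by rewrite mulf_neq0 ?expf_neq0.
rewrite -!exprnN -!exprnP; split.
  apply: (mulIf (expf_neq0 t0 (nz e1 t1))); rewrite mulfVK ?expf_neq0 //.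
  by rewrite !exprMn -!exprM det exprS [(t0 * _)%N]mulnC; ring.
apply: (mulIf (expf_neq0 e1 (nz e0 t0))); rewrite mulrAC mulVf ?expf_neq0 // mul1r.
rewrite !exprMn -!exprM [(t1 * _)%N]mulnC det exprS [(t0 * _)%N]mulnC.
by rewrite [(e1 * e0)%N]mulnC; ring.
Qed.

Section CurveForm.
Context (K : fieldType) (a b : nat) (la ka : K).

Definition curve_form (B : comNzRingType) (io : K -> B) (x y z : B) : B :=
  x ^+ b * z ^+ a - io ka * (y - io la * x) ^+ (a + b).

Lemma curve_form_morph (B B' : comNzRingType) (phi : {rmorphism B -> B'})
  (io : K -> B) (io' : K -> B') (x y z : B) : (forall c, phi (io c) = io' c) ->
  phi (curve_form io x y z) = curve_form io' (phi x) (phi y) (phi z).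
Proof.
move=> ph; rewrite /curve_form rmorphB rmorphM !rmorphXn rmorphM ph rmorphXn rmorphB.
by rewrite rmorphM ph.
Qed.

Lemma curve_form_congr (B : comNzRingType) (I : set B) (io : K -> B) (x y z x' y' z' : B) :
  is_ideal I -> I (x - x') -> I (y - y') -> I (z - z') ->
  I (curve_form io x y z - curve_form io x' y' z').
Proof.
move=> hI hx hy hz; rewrite /curve_form.
rewrite (_ : _ - _ = (x ^+ b * z ^+ a - x' ^+ b * z' ^+ a) -
  io ka * ((y - io la * x) ^+ (a + b) - (y' - io la * x') ^+ (a + b))); last by ring.
apply: (idealB hI); first by apply: (ideal_subM hI); apply: (ideal_subX _ hI).
apply: (idealMl _ hI); apply: (ideal_subX _ hI).
rewrite (_ : _ - _ = (y - y') - io la * (x - x')); last by ring.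
by apply: (idealB hI) => //; apply: (idealMl _ hI).
Qed.

End CurveForm.

(** * Degeneration of the plane along a flag *)

Section FrameDegeneration.
Context (K : closedFieldType) (n d : nat) (M : 'M[K]_(d, n.+1)) (R : realType).
Local Notation A := (laurent0 K n).
Local Notation V := 'rV[int]_n.+1.
Local Notation B := {poly {poly K}}.
Local Notation L0 := (deg0_part (linear_ideal M)).
Context (C : 'M[K]_(n.+1, 3)) (hC : coordinates M C) (f : 'I_3 -> 'I_n.+1) (hf : frame C f).
Context (e tau : 'I_3 -> nat) (e2 : e o2 = 0%N) (tau2 : tau o2 = 0%N).
Hypothesis det : (e o0 * tau o1 = (e o1 * tau o0).+1)%N.
Context (w : 'rV[R]_n.+1) (om : 'I_n.+1 -> nat) (c0 : R).
Hypothesis w_om : forall m, w 0 m = c0 + (om m)%:R.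

(** The valuation of linear forms that is [e h] on the frame and the minimum of the occurring terms
    on all other coordinates. *)
Definition flag_weights (om' : 'I_n.+1 -> nat) := forall m,
  (forall h, C m h != 0 -> (om' m <= e h)%N) /\ (exists2 h, C m h != 0 & e h = om' m).

Hypothesis flag_om : flag_weights om.
Local Notation iota := (@polyCC K).

(** Both parameters are free, so this is a generic point of the plane. By [det], S and T are in turn
    the Laurent monomials with exponents [s] and [t] in the frame coordinates. *)
Definition degen_point (h : 'I_3) : B := 'X^(e h) * ('X^(tau h))%:P.
Definition degen_coord : 'I_n.+1 -> B := ptv C iota degen_point.
Definition degen_lead m : {poly K} :=
  \sum_h (if e h == om m then (C m h)%:P * 'X^(tau h) else 0).

Local Notation k := (f o2).
Let s : V := (tau o1)%:Z *: delta_mx 0 (f o0) - (tau o0)%:Z *: delta_mx 0 (f o1).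
Let t : V := (e o0)%:Z *: delta_mx 0 (f o1) - (e o1)%:Z *: delta_mx 0 (f o0).

Let om_f h : om (f h) = e h.
Proof.
have [_ [l + <-]] := flag_om (f h).
by rewrite (frameE _ _ hf); have [->|_] := eqVneq h l; rewrite ?eqxx.
Qed.

Let detz : (e o0)%:Z * (tau o1)%:Z = (e o1)%:Z * (tau o0)%:Z + 1.
Proof. by rewrite -!PoszM det -addn1 PoszD. Qed.

Let wt_s : wt om s = 1.
Proof.
rewrite /s -scaleN1r !(wtD, wtZ) !wt_delta !om_f mulrC detz; ring.
Qed.

Let wt_t : wt om t = 0.
Proof. by rewrite /t -scaleN1r !(wtD, wtZ) !wt_delta !om_f; ring. Qed.

Let zmon_point h : degen_ev k s t (degen_point h) = zvar K k (f h).
Proof.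
rewrite /degen_point degen_evM polyC_exp !degen_evXn degen_evX degen_evT -!zmonMn -zmonD.
elim/I3P: h.
- congr (zmon K k _); apply/rowP => q; rewrite -!scaler_nat !mxE !natz.
  by apply/eqP; rewrite -subr_eq0; apply/eqP; ring: detz.
- congr (zmon K k _); apply/rowP => q; rewrite -!scaler_nat !mxE !natz.
  by apply/eqP; rewrite -subr_eq0; apply/eqP; ring: detz.
- by rewrite e2 tau2 !mulr0n addr0 zmon0 zvar_self.
Qed.

Lemma degen_coord_lowest_ge m D : (forall h, C m h != 0 -> (D <= e h)%N) ->
  lowest (degen_coord m) D
    (\sum_h (if e h == D then (C m h)%:P * 'X^(tau h) else 0)).
Proof.
move=> le_D; rewrite /degen_coord /ptv.
elim/big_ind2: _ => [|c x c' x'|h _]; first by exists 0; rewrite mulr0 addr0 mulr0.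
  exact: lowestD.
have lt' : lowest (iota (C m h) * degen_point h) (e h) ((C m h)%:P * 'X^(tau h)).
  apply: (@lowestM _ _ _ 0); first exact: lowest_const.
  by exists 0; rewrite mulr0 addr0.
have [<-//|ne] := eqVneq (e h) D.
have [z|nz] := eqVneq (C m h) 0.
  by rewrite z rmorph0 mul0r; exists 0; rewrite mulr0 addr0 mulr0.
by apply: lowest_lt lt'; rewrite ltn_neqAle eq_sym ne le_D.
Qed.

Lemma degen_coord_lowest m : lowest (degen_coord m) (om m) (degen_lead m).
Proof. by have [le_om _] := flag_om m; apply: degen_coord_lowest_ge. Qed.

Let point_inj h h' : e h = e h' -> tau h = tau h' -> h = h'.
Proof.
have n01 : ~ (e o0 = e o1 /\ tau o0 = tau o1) by case=> a b; move: det; rewrite a b; lia.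
have n02 : ~ (e o0 = e o2 /\ tau o0 = tau o2) by case=> a b; move: det; rewrite a b e2 tau2; lia.
have n12 : ~ (e o1 = e o2 /\ tau o1 = tau o2) by case=> a b; move: det; rewrite a b e2 tau2; lia.
elim/I3P: h; elim/I3P: h' => // a b; exfalso; [apply: n01|apply: n02|apply: n01|apply: n12|
  apply: n02|apply: n12]; by split.
Qed.

(** By [det] the exponent pairs of the three frame coordinates are distinct, so no cancellation
    occurs. *)
Lemma degen_lead_neq0 m : degen_lead m != 0.
Proof.
have [_ [h nz eh]] := flag_om m.
apply/eqP => /(congr1 (fun q : {poly K} => q`_(tau h))).
rewrite /degen_lead coef_sum coef0 (bigD1 h) //= eh eqxx coefCM coefXn eqxx mulr1.
rewrite big1 ?addr0; first exact/eqP.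
move=> h' hh'; case: eqVneq => [eh'|_]; last by rewrite coef0.
rewrite coefCM coefXn; case: eqVneq => [et|_]; last by rewrite mulr0.
by case/negP: hh'; apply/eqP/point_inj; rewrite ?eh ?eh'.
Qed.

Let X0 : ('X : B)%:F != 0 :> {fraction B}.
Proof. by rewrite tofrac_eq0 polyX_eq0. Qed.

Let T0 : ('X%:P : B)%:F != 0 :> {fraction B}.
Proof. by rewrite tofrac_eq0 polyC_eq0 polyX_eq0. Qed.

Let pointE h : (degen_point h)%:F = ('X : B)%:F ^+ e h * ('X%:P : B)%:F ^+ tau h.
Proof. by rewrite /degen_point polyC_exp tofracM !tofracXn. Qed.

Let vval_st (u : 'I_n.+1 -> B) (u0 : forall m, u m != 0) :
  u (f o0) = degen_point o0 -> u (f o1) = degen_point o1 ->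
  vval u s = ('X : B)%:F /\ vval u t = ('X%:P : B)%:F.
Proof.
move=> ui uj; rewrite /s /t -!scaleNr !(vvalD u0) !vval_scale_delta ui uj !pointE.
have [es et] := unimodular_monomials X0 T0 det.
by split; [exact: es|rewrite mulrC; exact: et].
Qed.

Lemma degen_coord_neq0 m : degen_coord m != 0.
Proof.
have := lowest_coef (degen_coord_lowest m).
by apply: contra_eq_neq => ->; rewrite coef0 eq_sym degen_lead_neq0.
Qed.

Let lead_f h : 'X^(om (f h)) * (degen_lead (f h))%:P = degen_point h.
Proof.
rewrite /degen_lead (bigD1 h) //= om_f eqxx (frameE _ _ hf) eqxx mul1r.
rewrite big1 ?addr0 // => l lh.
by rewrite (frameE _ _ hf) [h == l]eq_sym (negPf lh) mul0r if_same.
Qed.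

Let zU m : L0 (zvar K k m - degen_ev k s t (degen_coord m)).
Proof.
have hL0 := deg0_part_ideal M; apply: (ideal_sub_trans hL0 (mem_zvar_frame hC k m hf)).
rewrite (_ : _ - _ = 0); first exact: ideal0.
apply/eqP; rewrite subr_eq0 eq_sym; apply/eqP.
transitivity (\sum_l degen_ev k s t (iota (C m l) * degen_point l)); first exact: rmorph_sum.
by apply: eq_bigr => l _; rewrite degen_evM (degen_evCC _ _ _ (C m l)) zmon_point.
Qed.

Context (P : set A) (hP : is_ideal P) (L0P : L0 `<=` P).
Context (i j l : 'I_n.+1) (a b : nat) (la ka : K).
Let g : A := curve_form a b la ka (cst n) (zvar K k i) (zvar K k j) (zvar K k l).
Hypotheses (Pg : P g) (P_div : forall x, P x -> exists h, L0 (x - g * h)).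
Let G : B := curve_form a b la ka iota (degen_coord i) (degen_coord j) (degen_coord l).
Context (nu q : nat) (p : {poly K}) (G_lowest : lowest G nu ('X^q * p)) (p0 : p != 0).
Hypothesis good : forall r, root p r -> forall m, (degen_lead m).[r] != 0.

Let gG : L0 (g - degen_ev k s t G).
Proof.
have eG := @curve_form_morph K a b la ka B A (degen_ev k s t) iota (cst n)
  (degen_coord i) (degen_coord j) (degen_coord l) (degen_evCC k s t).
rewrite /G eG.
exact: (curve_form_congr _ _ _ _ _ (deg0_part_ideal M) (zU i) (zU j) (zU l)).
Qed.

(** Reduces the multiplicity of a ray to reading off the lowest coefficient in S of the equation [G]
    of the curve; the monomial factor in T does not count. *)
Lemma frame_multiplicity : multiplicity (init_ideal w P) = (size p).-1%:Z.
Proof.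
have hL0 := deg0_part_ideal M.
have uk : degen_coord k = 1.
  by rewrite /degen_coord ptv_frame // /degen_point e2 tau2 !expr0 mulr1.
have ui h : degen_coord (f h) = degen_point h by rewrite /degen_coord ptv_frame.
have [Us Ut] := vval_st degen_coord_neq0 (ui o0) (ui o1).
have u0 m : 'X^(om m) * (degen_lead m)%:P != 0 :> B.
  by rewrite mulf_neq0 ?expf_neq0 ?polyX_eq0 ?polyC_eq0 ?degen_lead_neq0.
have [us ut] := vval_st u0 (lead_f o0) (lead_f o1).
have omk : om k = 0%N by rewrite om_f.
have L0_fraceval (V0 : forall m, degen_coord m != 0) x : L0 x -> @fraceval K n B iota degen_coord V0 x = 0.
  exact: (fraceval_linear_ideal hC).
have PG : P (degen_ev k s t G) by apply: (ideal_congr hP _ Pg); apply: L0P; rewrite -opprB; apply: (idealN hL0).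
have PD x : P x -> exists h, L0 (x - degen_ev k s t G * h).
  by move=> /P_div[h Lh]; exists h; apply: (ideal_sub_multiple hL0 Lh gG).
exact: (@multiplicity_degeneration K n R w om c0 w_om k omk s t wt_s wt_t degen_lead degen_coord
    degen_coord_lowest degen_lead_neq0 Us Ut us ut uk L0 P G nu q p hP L0P zU L0_fraceval PG PD
    G_lowest p0 good).
Qed.

End FrameDegeneration.

(** * Algebraically closed fields and algebraic dependence *)

Lemma closed_nonroot (K : closedFieldType) (p : {poly K}) : p != 0 -> exists x, p.[x] != 0.
Proof.
move=> p0; have sXp : (1 < size ('X * p)%R)%N.
  by rewrite mulrC size_mulX // ltnS size_poly_gt0.
(* At a root x of X p - 1 the value of p cannot be 0. *)
have /closed_rootP[x] : size ('X * p - 1) != 1%N.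
  by rewrite size_polyDl ?size_polyN ?size_poly1 // neq_ltn sXp orbT.
rewrite rootE !hornerE subr_eq0 => /eqP e; exists x.
by apply: contra_eq_neq e => ->; rewrite mulr0 eq_sym oner_neq0.
Qed.

Lemma closed_avoid (K : closedFieldType) (s : seq K) : exists x, x \notin s.
Proof.
have [|x] := @closed_nonroot K (\prod_(y <- s) ('X - y%:P)).
  by apply: monic_neq0; apply: monic_prod_XsubC.
by rewrite -rootE root_prod_XsubC => ?; exists x.
Qed.

Lemma linear_dependence (K : fieldType) (T : finType) (m : nat) (F : T -> 'rV[K]_m) :
  (m < #|T|)%N -> exists c : T -> K, (exists x, c x != 0) /\ \sum_x c x *: F x = 0.
Proof.
move=> mT; pose X : 'M[K]_(#|T|, m) := \matrix_(r < #|T|) F (enum_val r).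
have nz : kermx X != 0.
  rewrite -mxrank_eq0 mxrank_ker subn_eq0 -ltnNge.
  exact: leq_ltn_trans (rank_leq_col X) mT.
have /rowV0Pn[v vker vnz] := nz.
exists (fun x => v 0 (enum_rank x)); split.
  have /rV0Pn[r vr] := vnz; exists (enum_val r).
  by rewrite enum_valK.
have /sub_kermxP vX := vker.
transitivity (v *m X); last exact: vX.
rewrite mulmx_sum_row (reindex _ (onW_bij _ (enum_rank_bij T))) /=.
by apply: eq_big => // x _; rewrite rowK enum_rankK.
Qed.

Lemma pev_monomial (P B : comNzRingType) (io : {rmorphism P -> B}) (x y : B) c i j :
  pev (pev io x) y ((c%:P * 'X^i)%:P * 'X^j) = io c * x ^+ i * y ^+ j.
Proof. by apply: etrans (pev_term _ _ _ _) _; congr (_ * _); apply: pev_term. Qed.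

(** K(t) has transcendence degree one, by a count of dimensions: the (N+1)^2 products p^i q^j
    s^(2N-i-j) with i, j at most N lie in a space of dimension 2ND+1, which is smaller for N =
    2D. *)
Lemma algebraic_dependence (K : fieldType) (F : fieldType) (io : {rmorphism {poly K} -> F})
  (x y : F) (p q s : {poly K}) : io s != 0 -> io s * x = io p -> io s * y = io q ->
  exists H : {poly {poly K}}, H != 0 /\ pev (pev (io \o polyC) x) y H = 0.
Proof.
move=> s0 ex ey; pose D := (size p + size q + size s).+1; pose N := (2 * D)%N.
pose Fm (ij : 'I_N.+1 * 'I_N.+1) := p ^+ ij.1 * q ^+ ij.2 * s ^+ (2 * N - ij.1 - ij.2).
have szF ij : (size (Fm ij) <= (2 * N * D).+1)%N.
  have szX (r : {poly K}) m : (size r <= D)%N -> (size (r ^+ m)%R <= (m * D).+1)%N.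
    move=> rD; apply: leq_trans (size_poly_exp_leq _ _) _; rewrite ltnS mulnC leq_mul2l.
    by apply/orP; right; apply: leq_trans (leq_pred _) rD.
  have szM (r1 r2 : {poly K}) m1 m2 : (size r1 <= (m1 * D).+1)%N -> (size r2 <= (m2 * D).+1)%N ->
      (size (r1 * r2)%R <= ((m1 + m2) * D).+1)%N.
    move=> h1 h2; apply: leq_trans (size_polyMleq _ _) _.
    by rewrite mulnDl; lia.
  have -> : (2 * N = ij.1 + ij.2 + (2 * N - ij.1 - ij.2))%N.
    by have := ltn_ord ij.1; have := ltn_ord ij.2; lia.
  by apply: (szM); [apply: (szM)|]; apply: (szX); rewrite /D; lia.
have [|c [[ij0 c0] eqc]] := linear_dependence (fun ij => @poly_rV K (2 * N * D).+1 (Fm ij)).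
  by rewrite card_prod !card_ord /N; nia.
exists (\sum_ij (((c ij)%:P * 'X^(ij.1) : {poly K})%:P * 'X^(ij.2) : {poly {poly K}})); split.
  apply: contraNneq c0 => /(congr1 (fun H : {poly {poly K}} => H`_ij0.2`_ij0.1)).
  rewrite !coef0 coef_sum (eq_bigr (fun ij => if ij.2 == ij0.2 then (c ij)%:P * 'X^(ij.1) else 0)); last first.
    by move=> ij _; rewrite coefCM coefXn eq_sym -val_eqE; case: eqP; rewrite ?mulr1 ?mulr0.
  rewrite coef_sum (bigD1 ij0) //= eqxx coefCM coefXn eqxx mulr1 big1 ?addr0 => [->//|ij ne].
  case: eqVneq => [e2|]; last by rewrite coef0.
  rewrite coefCM coefXn; case: eqVneq => [e1|]; last by rewrite mulr0.
  case/eqP: ne; rewrite [ij]surjective_pairing [ij0]surjective_pairing e2.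
  by congr (_, _); apply: val_inj; rewrite /= e1.
apply: (mulfI (expf_neq0 (2 * N) s0)); rewrite mulr0.
have : io (\sum_ij c ij *: Fm ij) = 0.
  have -> : \sum_ij c ij *: Fm ij = rVpoly (\sum_ij c ij *: @poly_rV K (2 * N * D).+1 (Fm ij)).
    rewrite linear_sum; apply: eq_bigr => ij _.
    by rewrite linearZ /= poly_rV_K.
  by rewrite eqc linear0 rmorph0.
rewrite rmorph_sum => <-; rewrite pev_sum mulr_sumr; apply: eq_bigr => ij _.
transitivity (io s ^+ (2 * N) * (io (c ij)%:P * x ^+ ij.1 * y ^+ ij.2)).
  by congr (_ * _); exact: (@pev_monomial K F (io \o polyC)).
rewrite -mul_polyC !rmorphM !rmorphXn -ex -ey !exprMn.
have -> : io s ^+ (2 * N) = io s ^+ ij.1 * io s ^+ ij.2 * io s ^+ (2 * N - ij.1 - ij.2).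
  rewrite -!exprD; congr (_ ^+ _).
  by have := ltn_ord ij.1; have := ltn_ord ij.2; lia.
by rewrite /=; ring.
Qed.

Lemma pev2_morph (K B B' : comNzRingType) (phi : {rmorphism B -> B'})
  (io : {rmorphism K -> B}) (io' : {rmorphism K -> B'}) (x y : B) H :
  (forall c, phi (io c) = io' c) ->
  phi (pev (pev io x) y H) = pev (pev io' (phi x)) (phi y) H.
Proof.
move=> phio.
have h p : phi (pev io x p) = pev io' (phi x) p.
  elim/poly_ind: p => [|p c IHp]; first by rewrite !rmorph0.
  by rewrite !pevD !pevM !pevC !pevX rmorphD rmorphM phio IHp.
elim/poly_ind: H => [|H c IHH]; first by rewrite !rmorph0.
by rewrite !pevD !pevM !pevC !pevX rmorphD rmorphM h IHH.
Qed.

Lemma prime_pev_root (K : closedFieldType) (A : comNzRingType) (io : {rmorphism K -> A})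
  (Q : set A) (x : A) (p : {poly K}) : prime_ideal Q -> p != 0 -> Q (pev io x p) ->
  exists c, Q (x - io c).
Proof.
move=> [hQ Q1 pQ]; have [d] := ubnP (size p); elim: d p => // d IHd p pd p0 Qp.
have [s1|s1] := eqVneq (size p) 1%N.
  have [c c0 ep] := size_poly1P _ (introT eqP s1); case: Q1.
  move: Qp; rewrite ep pevC => /(idealMl (io c^-1) hQ).
  by rewrite -rmorphM mulVf // rmorph1.
have /closed_rootP[r pr] := s1; have /factor_theorem[q eq] := pr.
have q0 : q != 0 by apply: contraNneq p0 => q0; rewrite eq q0 mul0r.
move: Qp; rewrite eq pevM => /pQ[Qq|].
  by apply: (IHd q) => //; rewrite eq size_Mmonic ?monicXsubC // size_XsubC addn2 in pd.
rewrite -[- r%:P]polyCN pevD pevX pevC rmorphN; by exists r.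
Qed.

(** * The ideal of a rational curve has dimension 1 *)

Section KernelDimension.
Context (K : closedFieldType) (n : nat).
Local Notation A := (laurent0 K n).
Context (u : 'I_n.+1 -> {poly K}) (u0 : forall m, u m != 0).
Context (k m0 : 'I_n.+1) (uk : u k = 1) (u_nonconst : (1 < size (u m0))%N).

Let rho : {rmorphism A -> {fraction {poly K}}} := @fraceval K n {poly K} polyC u u0.

Definition curve_ideal : set A := [set x | rho x = 0].

Lemma curve_ideal_prime : prime_ideal curve_ideal.
Proof. exact: kernel_prime. Qed.

Let E0 : \prod_m u m != 0.
Proof. exact/prodf_neq0. Qed.

Let rho_clear N (x : A) : clears N x -> (\prod_m u m)%:F ^+ N * rho x =
  (\sum_(v <- msupp (val x) | v \in msupp (val x)) ((val x)@_v)%:P *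
    \prod_m u m ^+ absz (N%:Z + v 0 m))%:F.
Proof.
move=> cx; apply: (@fraceval_clear K n {poly K} polyC u u0); first by rewrite -big_seq -monalgE.
by move=> v; rewrite -mcoeff_neq0 => sv m; apply: cx.
Qed.

Let rho_frac (x y : A) : exists s p q : {poly K}, [/\ s%:F != 0 :> {fraction {poly K}},
  s%:F * rho x = p%:F & s%:F * rho y = q%:F].
Proof.
have [N cx] := clears_exists x; have [N' cy] := clears_exists y.
have := rho_clear (clearsW (leq_addr N' N) cx); have := rho_clear (clearsW (leq_addl N N') cy).
set q := \sum_(_ <- _ | _) _ => eq; set p := \sum_(_ <- _ | _) _ => ep.
exists ((\prod_m u m) ^+ (N + N')), p, q; rewrite tofracXn; split=> //.
by rewrite expf_neq0 // tofrac_eq0.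
Qed.

(** Take f in Q outside the curve ideal. Some polynomial relation between x and f holds on the
    curve; after cancelling powers of f, its term free of f is a nonzero polynomial in x that lies
    in Q. One of its linear factors lies in Q, so A/Q = K. *)
Lemma curve_ideal_maximal Q : prime_ideal Q -> curve_ideal `<` Q ->
  forall x, exists c, Q (x - cst n c).
Proof.
move=> pQ [PQ /existsNP[f /not_implyP[Qf nPf]]] x.
have [s [p [q [s0 ep eq]]]] := rho_frac x f.
have [H [H0 eH]] := algebraic_dependence (io := @FracField.tofrac {poly K}) s0 ep eq.
have [d [c [c0 [H' eH']]]] := lowest_exists H0.
pose evA : {rmorphism {poly {poly K}} -> A} := pev (pev (cst n) x) f.
have evA_rho G : rho (evA G) = pev (pev (@FracField.tofrac {poly K} \o polyC) (rho x)) (rho f) G.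
  by apply: pev2_morph => c'; apply: (@fraceval_cst K n {poly K} polyC u u0).
have Pe : curve_ideal (evA (c%:P + 'X * H')).
  have : rho (evA H) = 0 by rewrite evA_rho.
  rewrite eH' rmorphM rmorphXn /= [evA 'X]pevX => /eqP.
  by rewrite rmorphM rmorphXn mulf_eq0 expf_eq0 => /orP[/andP[_ /eqP/nPf]|/eqP].
case: (pQ) => hQ _ _; apply: (prime_pev_root pQ c0).
have : Q (evA (c%:P + 'X * H')) by apply: PQ.
rewrite rmorphD rmorphM /= [evA 'X]pevX [evA c%:P]pevC => Qe.
have -> : pev (cst n) x c = pev (cst n) x c + f * evA H' - f * evA H' by rewrite addrK.
by apply: (idealB hQ) => //; apply: (idealMr _ hQ).
Qed.

(** The chain joins the generic point of the curve to the closed point at a parameter [t0] where no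
    coordinate vanishes; a nonconstant coordinate makes it strict. It cannot be longer, since by
    [curve_ideal_maximal] the primes strictly above are maximal. *)
Lemma curve_ideal_dim : dim_quot curve_ideal 1.
Proof.
have [t0 ut0] := closed_nonroot E0.
have v0 m : (u m).[t0] != 0.
  by apply: contraNneq ut0 => e; rewrite (bigD1 m) //= hornerM e mul0r.
pose phi : {rmorphism A -> {fraction K}} := @fraceval K n K idfun (fun m => (u m).[t0]) v0.
pose Q : set A := [set x | phi x = 0].
have phi_zvar m : phi (zvar K k m) = ((u m).[t0])%:F.
  by apply: (@fraceval_zvar K n K idfun _ v0 k); rewrite uk hornerC.
have rho_zvar m : rho (zvar K k m) = (u m)%:F.
  exact: (@fraceval_zvar K n {poly K} polyC u u0 k uk).
have PQ : curve_ideal `<=` Q.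
  move=> x rx; change (rho x = 0) in rx; change (phi x = 0).
  have [N cx] := clears_exists x; have := rho_clear cx.
  rewrite rx mulr0 => /esym/eqP; rewrite tofrac_eq0 => /eqP/(congr1 (fun p => p.[t0])).
  rewrite horner0 horner_sum => ex.
  have exs : val x = \sum_(v <- msupp (val x) | v \in msupp (val x)) << (val x)@_v *g v >>.
    by rewrite -big_seq -monalgE.
  have cxs v : v \in msupp (val x) -> forall m, 0 <= N%:Z + v 0 m.
    by rewrite -mcoeff_neq0 => sv m; apply: cx.
  have := @fraceval_clear K n K idfun _ v0 N x _ _ _ exs cxs.
  rewrite -[fraceval _ _ _]/(phi x).
  have -> : \sum_(v <- msupp (val x) | v \in msupp (val x)) idfun (val x)@_v *
      \prod_m (u m).[t0] ^+ absz (N%:Z + v 0 m) = 0.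
    rewrite -[RHS]ex; apply: eq_bigr => v _; rewrite hornerM hornerC horner_prod.
    by congr (_ * _); apply: eq_bigr => m _; rewrite horner_exp.
  have vE0 : (\prod_m (u m).[t0])%:F ^+ N != 0 :> {fraction K}.
    by rewrite expf_neq0 // tofrac_eq0; apply/prodf_neq0.
  by move/eqP; rewrite tofrac0 mulf_eq0 (negPf vE0) => /eqP.
split.
  exists (fun i => if i == 0%N then curve_ideal else Q); split.
    move=> [|i] _ /=; first by split; [exact: curve_ideal_prime|].
    by split; [exact: kernel_prime|].
  case=> // _ /=; split=> // QP.
  have : curve_ideal (zvar K k m0 - cst n (u m0).[t0]).
    apply: QP; rewrite /Q /= rmorphB phi_zvar [phi _](@fraceval_cst K n K idfun _ v0).
    by rewrite subrr.
  rewrite /curve_ideal /= rmorphB rho_zvar [rho (cst _ _)](@fraceval_cst K n {poly K} polyC u u0).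
  rewrite -tofracB => /eqP; rewrite tofrac_eq0 subr_eq0 => /eqP e.
  by move: u_nonconst; rewrite e size_polyC; case: (_ == _).
move=> j [c [cp lt]]; rewrite leqNgt; apply/negP => j1.
have [p0 P0] := cp 0%N isT; have [p1 P1] := cp 1%N (ltnW j1).
have [p2 P2] := cp 2%N j1; have l0 := lt 0%N (ltnW j1); have l1 := lt 1%N j1.
have Pc1 : curve_ideal `<` c 1%N.
  split=> // c1P; case: l0 => _; apply; exact: subset_trans c1P P0.
case: l1 => s12 /existsNP[x /not_implyP[c2x nc1x]].
have [a c1a] := curve_ideal_maximal p1 Pc1 x.
case: p2 => h2 n1 _; apply: n1.
have a0 : a != 0 by apply: contra_notN nc1x => /eqP a0; rewrite a0 rmorph0 subr0 in c1a.
have c2a : c 2%N (cst n a).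
  by rewrite -[cst n a](subKr x); apply: (idealB h2) => //; apply: s12.
have -> : 1 = cst n a^-1 * cst n a by rewrite -rmorphM mulVf // rmorph1.
exact: (idealMl _ h2).
Qed.

End KernelDimension.

Lemma coprime_mod_inj (b d e i l q : nat) : coprime b d -> (e < d)%N -> (i < d)%N ->
  (b * e + d * l = q * d + b * i)%N -> e = i.
Proof.
move=> bd ed id eq.
have h : (b * e = b * i %[mod d])%N.
  by rewrite -[RHS](modnMDl q) -eq addnC [(d * l)%N]mulnC modnMDl.
wlog ie : e i ed id h {eq} / (i <= e)%N.
  by move=> W; case: (leqP i e) => [|/ltnW] c; [apply: W|apply/esym/W].
move/eqP: h; rewrite eqn_mod_dvd ?leq_mul2l ?ie ?orbT // -mulnBr Gauss_dvdr ?(coprime_sym d) //.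
by move=> /dvdnP[m em]; move: em; case: m => [|m]; lia.
Qed.

(** * The parametrization t -> (t^d, ga t^b) *)

Section PolySubstitution.
Context (K : fieldType) (b d : nat) (ga : K) (d0 : (0 < d)%N) (bd : coprime b d).

(* The substitution Y = t^d, Z = ga t^b, with Y the inner variable.           *)
Definition cusp : {poly {poly K}} -> {poly K} :=
  pev (comp_poly 'X^d) (ga%:P * 'X^b).
HB.instance Definition _ := GRing.RMorphism.on cusp.

Lemma cuspC p : cusp p%:P = p \Po 'X^d.
Proof. exact: pevC. Qed.

Lemma cuspX : cusp 'X = ga%:P * 'X^b.
Proof. exact: pevX. Qed.

(** The monomial Y^l Z^e goes to a multiple of t^(d l + b e), and for e < d these exponents are
    distinct because b is invertible modulo d. *)
Lemma cusp_kernel_small (H : {poly {poly K}}) : ga != 0 ->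
  (size H <= d)%N -> cusp H = 0 -> H = 0.
Proof.
move=> ga0 sH H0; apply/polyP => e; rewrite coef0; apply/polyP => l; rewrite coef0.
have [de|ed] := leqP d e.
  have -> : H`_e = 0 by apply: nth_default; apply: leq_trans sH de.
  by rewrite coef0.
move/(congr1 (fun p : {poly K} => p`_(b * e + d * l))): H0.
rewrite /cusp pevE coef0 (horner_coef_wide _ (leq_trans (size_poly _ _) sH)).
rewrite coef_sum (bigD1 (Ordinal ed)) //= coef_map /= exprMn -exprM mulrA mulrC coefXnM.
rewrite ltnNge leq_addr /= addKn -polyC_exp mulrC coefCM coef_comp_poly_Xn //.
rewrite dvdn_mulr // mulKn // big1 ?addr0.
  by move=> /eqP; rewrite mulf_eq0 expf_eq0 (negPf ga0) andbF => /eqP.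
move=> i ie; rewrite coef_map /= exprMn -exprM mulrA mulrC coefXnM.
case: ltnP => // bi; rewrite -polyC_exp mulrC coefCM coef_comp_poly_Xn //.
case: ifP => [/dvdnP[q eq]|_]; last by rewrite mulr0.
case/eqP: ie; apply: val_inj => /=.
by apply/esym/(@coprime_mod_inj b d e i l q) => //; rewrite -eq subnK.
Qed.

End PolySubstitution.

Lemma pev2_ext (K F : comNzRingType) (phi psi : {rmorphism {poly {poly K}} -> F}) :
  (forall c, phi c%:P%:P = psi c%:P%:P) -> phi 'X%:P = psi 'X%:P -> phi 'X = psi 'X ->
  forall H, phi H = psi H.
Proof.
move=> hc hT hX; have hp p : phi p%:P = psi p%:P.
  elim/poly_ind: p => [|p c IHp]; first by rewrite polyC0 !rmorph0.
  by rewrite polyCD polyCM !rmorphD !rmorphM IHp hT hc.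
elim/poly_ind => [|H c IHH]; first by rewrite !rmorph0.
by rewrite !rmorphD !rmorphM IHH hX hp.
Qed.

Lemma rmorph_affine (B B' : comNzRingType) (phi : {rmorphism B -> B'}) (x y z l s t : B) :
  phi (x * t + y * (s + l * t) + z) =
  phi x * phi t + phi y * (phi s + phi l * phi t) + phi z.
Proof. by rewrite !rmorphD !rmorphM rmorphD rmorphM. Qed.

Lemma affine_shift (B : comNzRingType) (x y z l s t : B) :
  x * t + y * (s - l * t + l * t) + z = x * t + y * s + z.
Proof. by rewrite subrK. Qed.

Lemma clear_unit_identity (B : comNzRingType) (x g q c s y yi : B) : y * yi = 1 ->
  x - g * (yi * q * c * s) = yi * (y * x - q * (c * (g * s))).
Proof. by move=> yy; rewrite mulrBr [yi * (y * x)]mulrA [yi * y]mulrC yy mul1r; congr (_ - _); ring. Qed.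

Lemma rmorph_binomial (K B : comNzRingType) (phi : {rmorphism {poly {poly K}} -> B}) d b g :
  phi ('X^d - (g%:P * 'X^b)%:P) = phi 'X ^+ d - phi g%:P%:P * phi 'X%:P ^+ b.
Proof. by rewrite rmorphB rmorphXn polyCM rmorphM polyC_exp rmorphXn. Qed.

(** * The rational curve and its equation *)

Section PlaneCurve.
Context (K : closedFieldType) (n dm : nat) (M : 'M[K]_(dm, n.+1)).
Local Notation A := (laurent0 K n).
Local Notation L0 := (deg0_part (linear_ideal M)).
Context (C : 'M[K]_(n.+1, 3)) (hC : coordinates M C) (f : 'I_3 -> 'I_n.+1) (hf : frame C f).
Context (a b : nat) (la ka ga : K).
Local Notation d := (a + b)%N.
Hypotheses (d0 : (0 < d)%N) (bd : coprime b d) (kaga : ka * ga ^+ d = 1).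

(** The relation [kaga] puts this point on x_i^b x_k^a = ka (x_j - la x_i)^d. For a, b > 0 the
    coordinates x_i and x_j have orders d and b at t = 0, which are the weights of the ray to be
    realized. *)
Definition curve_point (h : 'I_3) : {poly K} :=
  if h == o0 then 'X^d else if h == o1 then la%:P * 'X^d + ga%:P * 'X^b else 1.
Definition curve_coord := ptv C polyC curve_point.

Context (u0 : forall m, curve_coord m != 0).
Local Notation k := (f o2).
Local Notation P := (curve_ideal u0).

Definition curve_eq k' : A :=
  curve_form a b la ka (cst n) (zvar K k' (f o0)) (zvar K k' (f o1)) (zvar K k' (f o2)).

Lemma zvar_change (k1 k2 m : 'I_n.+1) : zvar K k2 m = zvar K k1 m * zmon K k1 (- delta_mx 0 k2).
Proof.
rewrite -zmonD; apply: val_inj; rewrite /= [in RHS]deg0_proj_id.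
  by rewrite /deg0_proj degx_delta scale1r.
by rewrite degxD -scaleN1r degxZ !degx_delta mulr1 subrr.
Qed.

Lemma curve_form_scale (B : comNzRingType) (io : K -> B) (x y z e : B) :
  curve_form a b la ka io (x * e) (y * e) (z * e) = curve_form a b la ka io x y z * e ^+ d.
Proof.
rewrite /curve_form mulrA -mulrBl !exprMn mulrBl -!mulrA; congr (_ - _).
by rewrite exprD; ring.
Qed.

Lemma curve_eq_change k1 k2 : curve_eq k2 = curve_eq k1 * zmon K k1 (- delta_mx 0 k2) ^+ d.
Proof.
by rewrite /curve_eq !(zvar_change k1 k2) curve_form_scale.
Qed.

Lemma L0_curve : L0 `<=` P.
Proof. by move=> x Lx; apply: (fraceval_linear_ideal hC u0 Lx). Qed.

Let rho : {rmorphism A -> {fraction {poly K}}} := @fraceval K n {poly K} polyC curve_coord u0.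

Let uk : curve_coord k = 1.
Proof. by rewrite /curve_coord ptv_frame. Qed.

Let rho_zvar h : rho (zvar K k (f h)) = (curve_point h)%:F.
Proof.
have -> : curve_point h = curve_coord (f h) by rewrite /curve_coord ptv_frame.
exact: (@fraceval_zvar K n {poly K} polyC curve_coord u0 k uk).
Qed.

Let rho_cst c : rho (cst n c) = (c%:P)%:F.
Proof. exact: (@fraceval_cst K n {poly K} polyC curve_coord u0). Qed.

Let ev : {rmorphism {poly {poly K}} -> A} :=
  pev (pev (cst n) (zvar K k (f o0))) (zvar K k (f o1) - cst n la * zvar K k (f o0)).

Let evCC c : ev c%:P%:P = cst n c.
Proof. exact: etrans (pevC _ _ _) (pevC _ _ _). Qed.

Let evT : ev 'X%:P = zvar K k (f o0).
Proof. exact: etrans (pevC _ _ _) (pevX _ _). Qed.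

Let evX : ev 'X = zvar K k (f o1) - cst n la * zvar K k (f o0).
Proof. exact: pevX. Qed.

Let rho_ev H : rho (ev H) = (cusp b d ga H)%:F.
Proof.
apply: (pev2_ext (phi := rho \o ev) (psi := @FracField.tofrac {poly K} \o cusp b d ga)) => [c||] /=.
- by rewrite [ev _]evCC [rho _]rho_cst cuspC comp_polyC.
- by rewrite [ev _]evT [rho _]rho_zvar cuspC comp_polyX.
- rewrite [ev _]evX cuspX; apply: etrans (rmorphB rho _ _) _.
  rewrite rmorphM [rho (cst _ _)]rho_cst !rho_zvar /curve_point /=.
  by rewrite -tofracM -tofracB [la%:P * _ + _]addrC addrK.
Qed.

Let zq m : L0 (zvar K k m - ev ((C m o0)%:P%:P * 'X%:P +
  (C m o1)%:P%:P * ('X + la%:P%:P * 'X%:P) + (C m o2)%:P%:P)).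
Proof.
have eq := rmorph_affine ev (C m o0)%:P%:P (C m o1)%:P%:P (C m o2)%:P%:P la%:P%:P 'X 'X%:P.
rewrite (evCC (C m o0)) (evCC (C m o1)) (evCC (C m o2)) (evCC la) evT evX in eq.
rewrite eq affine_shift.
by have := mem_zvar_frame hC k m hf; rewrite sum_I3 zvar_self mulr1.
Qed.

Let ka0 : ka != 0.
Proof. by apply: contra_eq_neq kaga => ->; rewrite mul0r eq_sym oner_neq0. Qed.

Let ga0 : ga != 0.
Proof. by apply: contra_eq_neq kaga => ->; rewrite expr0n (gtn_eqF d0) mulr0 eq_sym oner_neq0. Qed.

Let Dv : {poly {poly K}} := 'X^d - ((ga ^+ d)%:P * 'X^b)%:P.

Let ev_Dv : ev Dv = - cst n (ga ^+ d) * curve_eq k.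
Proof.
rewrite /Dv rmorph_binomial evX evCC evT /curve_eq /curve_form zvar_self expr1n mulr1 mulrBr mulNr mulrA mulNr -rmorphM.
by rewrite [_ * ka]mulrC kaga rmorph1 mulN1r opprK addrC.
Qed.

Let curve_eq_k : P (curve_eq k).
Proof.
have : P (ev Dv).
  change (rho (ev Dv) = 0); rewrite rho_ev /Dv rmorph_binomial /= cuspX !cuspC.
  rewrite comp_polyC comp_polyX exprMn -!exprM polyC_exp [(d * b)%N]mulnC subrr.
  exact: tofrac0.
have [hP _ _] := curve_ideal_prime u0.
rewrite ev_Dv => /(idealMl (- cst n (ga ^- d)) hP); rewrite mulrA mulrNN -rmorphM.
by rewrite mulVf ?expf_neq0 // rmorph1 mul1r.
Qed.

Lemma curve_mem k' : P (curve_eq k').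
Proof.
have [hP _ _] := curve_ideal_prime u0.
by rewrite (curve_eq_change k k'); apply: (idealMr _ hP).
Qed.

(** Modulo L0 and after clearing denominators, x is a polynomial in x_i and x_j - la x_i. Division
    by [Dv], which is monic and equals the curve equation up to a unit, leaves a remainder of degree
    less than d that vanishes on the curve, so it is 0 by [cusp_kernel_small]. *)
Lemma curve_div k' x : P x -> exists h, L0 (x - curve_eq k' * h).
Proof.
move=> Px; have hL0 := deg0_part_ideal M; have [hP _ _] := curve_ideal_prime u0.
have evC c : ev (polyCC c) = cst n c by apply: evCC.
have [N [H LH]] := @laurent0_reduce K n _ ev (@polyCC K) L0 k _ hL0 evC zq x.
set z := \prod_m _ in LH.
have PH : rho (ev H) = 0.
  have : P (ev H).
    rewrite -[ev H](subKr (z ^+ N * x)); apply: (idealB hP); first exact: (idealMl _ hP).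
    exact: L0_curve.
  by [].
have sD : size Dv = d.+1.
  rewrite size_polyDl size_polyXn // size_polyN.
  by apply: leq_ltn_trans (size_polyC_leq1 _) _; rewrite ltnS.
have monD : Dv \is monic.
  rewrite monicE lead_coefDl ?lead_coefXn // size_polyN size_polyXn.
  by apply: leq_ltn_trans (size_polyC_leq1 _) _; rewrite ltnS.
have DvE := Pdiv.RingMonic.rdivp_eq monD H.
have sR : (size (Pdiv.Ring.rmodp H Dv) <= d)%N.
  by have := Pdiv.Ring.ltn_rmodp H Dv; rewrite monic_neq0 // sD.
have R0 : Pdiv.Ring.rmodp H Dv = 0.
  apply: (cusp_kernel_small d0 bd ga0 sR).
  have PDv : rho (ev Dv) = 0 by have := idealMl (- cst n (ga ^+ d)) hP curve_eq_k; rewrite -ev_Dv.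
  apply/eqP; rewrite -tofrac_eq0 -rho_ev; apply/eqP.
  by move: PH; rewrite {1}DvE rmorphD rmorphM rmorphD rmorphM PDv mulr0 add0r.
rewrite R0 addr0 in DvE.
pose e := zmon K k (- \sum_m delta_mx 0 m).
have ze : z * e = 1 by rewrite -(zmonN K k (\sum_m delta_mx 0 m)) zmon_sum.
have zeN : z ^+ N * e ^+ N = 1 by rewrite -exprMn ze expr1n.
exists (e ^+ N * ev (Pdiv.Ring.rdivp H Dv) * (- cst n (ga ^+ d)) *
  zmon K k' (- delta_mx 0 k) ^+ d).
rewrite (clear_unit_identity _ _ _ _ _ zeN) -curve_eq_change -ev_Dv -rmorphM -DvE.
exact: (idealMl _ hL0).
Qed.

End PlaneCurve.

(** * Generic choice of the parameters of the curve *)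

Section Generic.
Context (K : closedFieldType) (n : nat).
Implicit Types (C : 'M[K]_(n.+1, 3)) (m : 'I_n.+1) (q : 'I_3 -> K).

Definition parallel C m m' := forall l h, C m l * C m' h = C m h * C m' l.

Lemma parallel_change C C' (Q : 'I_3 -> 'I_3 -> K) m m' :
  (forall m h, C m h = \sum_l C' m l * Q l h) -> parallel C' m m' -> parallel C m m'.
Proof.
move=> CQ par l h; rewrite !CQ !big_distrlr /= [RHS]exchange_big.
apply: eq_bigr => x _; apply: eq_bigr => y _; rewrite [LHS]mulrACA [RHS]mulrACA par.
by congr (_ * _); rewrite mulrC.
Qed.

(* The curve avoids the points where two lines of the arrangement meet, with  *)
(* the exception of its singular point, and it is not tangent to a line       *)
(* through that point.                                                        *)
Definition generic C a b la ka :=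
  [/\ ka != 0,
      forall m m' q, ~ parallel C m m' -> ptv C idfun q m = 0 -> ptv C idfun q m' = 0 ->
        (exists l, q l != 0) -> [\/ q o0 != 0, q o1 != 0 | b = 0%N] ->
        curve_form a b la ka idfun (q o0) (q o1) (q o2) != 0 &
      forall m, C m o1 != 0 -> C m o0 + la * C m o1 != 0 /\
        C m o1 ^+ (a + b) != ka * (- C m o0 - la * C m o1) ^+ (a + b)].

(** The cross product of two rows: homogeneous coordinates of the intersection of the two lines. *)
Definition cross_minor C m m' (l : 'I_3) : K :=
  if l == o0 then C m o1 * C m' o2 - C m o2 * C m' o1
  else if l == o1 then C m o2 * C m' o0 - C m o0 * C m' o2
  else C m o0 * C m' o1 - C m o1 * C m' o0.

Lemma cross_minor_neq0 C m m' : ~ parallel C m m' -> exists l, cross_minor C m m' l != 0.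
Proof.
move=> npar; apply: contrapT => h.
have {}h l : cross_minor C m m' l = 0.
  by apply/eqP; apply: contrapT => /negP nz; apply: h; exists l.
have /eqP := h o0; have /eqP := h o1; have /eqP := h o2; rewrite /cross_minor /= !subr_eq0.
move=> /eqP e2 /eqP e1 /eqP e0.
by apply: npar; elim/I3P; elim/I3P.
Qed.

Lemma common_zero C m m' q : ~ parallel C m m' ->
  ptv C idfun q m = 0 -> ptv C idfun q m' = 0 ->
  exists s, forall l, q l = cross_minor C m m' l * s.
Proof.
move=> /cross_minor_neq0[l nz]; rewrite /ptv !sum_I3 /= => e e'.
have h x y : q x * cross_minor C m m' y = q y * cross_minor C m m' x.
  have he (c c' u : K) : u = c * (C m' o0 * q o0 + C m' o1 * q o1 + C m' o2 * q o2) -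
      c' * (C m o0 * q o0 + C m o1 * q o1 + C m o2 * q o2) -> u = 0.
    by rewrite e e' !mulr0 subrr.
  apply/eqP; rewrite -subr_eq0; apply/eqP.
  elim/I3P: x; elim/I3P: y; rewrite /cross_minor /= ?subrr //.
  - by apply: (he (C m o2) (C m' o2)); ring.
  - by apply: (he (- C m o1) (- C m' o1)); ring.
  - by apply: (he (- C m o2) (- C m' o2)); ring.
  - by apply: (he (C m o0) (C m' o0)); ring.
  - by apply: (he (C m o1) (C m' o1)); ring.
  - by apply: (he (- C m o0) (- C m' o0)); ring.
exists (q l / cross_minor C m m' l) => x.
by rewrite mulrA [_ * q l]mulrC -h mulfK.
Qed.

(** Finitely many points are to be avoided. First [la] keeps y - la x nonzero at each of them other
    than x = y = 0, then [ka] avoids the finitely many values that put one of them on the curve. *)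
Lemma generic_exists C a b : (0 < a + b)%N -> exists la ka, generic C a b la ka.
Proof.
move=> d0.
(* The second list encodes the condition on lines through the singular point: with x = z = C m o1
   and y = - C m o0 the curve form becomes x^d - ka (y - la x)^d. *)
pose T := [seq (cross_minor C mm.1 mm.2 o0, cross_minor C mm.1 mm.2 o1,
   cross_minor C mm.1 mm.2 o2) | mm : 'I_n.+1 * 'I_n.+1] ++
  [seq (C m o1, - C m o0, C m o1) | m : 'I_n.+1].
have [la laP] := closed_avoid [seq t.1.2 / t.1.1 | t <- T].
have [ka kaP] := closed_avoid (0 ::
  [seq t.1.1 ^+ b * t.2 ^+ a / (t.1.2 - la * t.1.1) ^+ (a + b) | t <- T]).
have hT y z w : (y, z, w) \in T -> (y != 0) || (z != 0) -> z - la * y != 0 /\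
    curve_form a b la ka idfun y z w != 0.
  move=> tT yz; have zl : z - la * y != 0.
    have [y0|y0] := eqVneq y 0; first by move: yz; rewrite y0 eqxx mulr0 subr0.
    apply: contra laP; rewrite subr_eq0 => /eqP ez; apply/mapP; exists (y, z, w) => //=.
    by rewrite ez mulfK.
  split=> //; apply: contra kaP; rewrite /curve_form subr_eq0 => /eqP e.
  rewrite inE; apply/orP; right; apply/mapP; exists (y, z, w) => //=.
  by rewrite e mulfK // expf_neq0.
have ka0 : ka != 0 by apply: contra kaP => /eqP->; rewrite mem_head.
exists la, ka; split=> // [m m' q npar qm qm' [l ql] qb|m m1].
  have [s qs] := common_zero npar qm qm'.
  have s0 : s != 0 by apply: contraNneq ql => s0; rewrite qs s0 mulr0.
  have [z01|] := boolP ((q o0 == 0) && (q o1 == 0)).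
    case/andP: z01 => /eqP q0 /eqP q1; have b0 : b = 0%N by case: qb; rewrite ?q0 ?q1 ?eqxx.
    have q2 : q o2 != 0 by move: l ql; apply: I3P; rewrite ?q0 ?q1 ?eqxx.
    rewrite /curve_form q0 q1 b0 expr0 mul1r mulr0 subr0 expr0n addn0.
    by rewrite b0 addn0 in d0; rewrite (gtn_eqF d0) mulr0 subr0 expf_neq0.
  rewrite negb_and => q01; rewrite !qs curve_form_scale mulf_neq0 ?expf_neq0 //.
  apply: (hT _ _ _ _ _).2.
    rewrite mem_cat; apply/orP; left; apply/mapP; exists (m, m') => //; exact: mem_enum.
  by move: q01; rewrite !qs !mulf_eq0 (negPf s0) !orbF.
have [||h1 h2] := hT (C m o1) (- C m o0) (C m o1).
- by rewrite mem_cat; apply/orP; right; apply/mapP; exists m => //; exact: mem_enum.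
- by rewrite m1.
split; first by move: h1; rewrite -opprD oppr_eq0.
move: h2; rewrite /curve_form -exprD addnC subr_eq0 /=.
by [].
Qed.

End Generic.

Definition tri (T : Type) (x y z : T) (h : 'I_3) : T :=
  if h == o0 then x else if h == o1 then y else z.

Lemma bezout_exists (x y : nat) : (0 < x)%N -> coprime x y ->
  exists s t, (x * t = (y * s).+1)%N.
Proof.
move=> x0 /eqP xy; have [km kn e _] := egcdnP y x0.
by exists kn, km; rewrite mulnC e xy addn1 mulnC.
Qed.

Lemma not_root_const (K : fieldType) (c r : K) : c != 0 -> ~ root c%:P r.
Proof. by move=> c0; rewrite rootC (negPf c0). Qed.

Lemma size_const_neq0 (K : fieldType) (c : K) : c != 0 -> (size c%:P).-1 = 0%N.
Proof. by move=> c0; rewrite size_polyC c0. Qed.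

(** * Top coefficients with a prescribed degree bound *)

Section TopCoefficient.
Context (K : fieldType).
Implicit Types (p : {poly K}) (c : K).

(** The coefficient [c] may be 0, so sums need no discussion of cancellation. *)
Definition top_coef p m c := exists2 p' : {poly K}, (size p' <= m)%N & p = c%:P * 'X^m + p'.

Lemma top_coefM p q m l c e : top_coef p m c -> top_coef q l e ->
  top_coef (p * q) (m + l) (c * e).
Proof.
move=> [p' sp ->] [q' sq ->].
have sX (x : K) i : (size (x%:P * 'X^i)%R <= i.+1)%N.
  by rewrite mul_polyC (leq_trans (size_scale_leq _ _)) // size_polyXn.
exists (c%:P * 'X^m * q' + p' * (e%:P * 'X^l) + p' * q').
  have sM (x y : {poly K}) i1 i2 N : (size x <= i1)%N -> (size y <= i2)%N ->
      ((i1 + i2).-1 <= N)%N -> (size (x * y)%R <= N)%N.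
    by move=> h1 h2 h3; apply: leq_trans (size_polyMleq _ _) _; lia.
  have sD (x y : {poly K}) N : (size x <= N)%N -> (size y <= N)%N -> (size (x + y)%R <= N)%N.
    by move=> h1 h2; rewrite (leq_trans (size_polyD _ _)) // geq_max h1.
  apply: (sD); [apply: (sD)|].
  - by apply: (sM _ _ m.+1 l) => //; lia.
  - by apply: (sM _ _ m l.+1) => //; lia.
  - by apply: (sM _ _ m l) => //; lia.
by rewrite exprD polyCM; ring.
Qed.

Lemma top_coefX p m c i : top_coef p m c -> top_coef (p ^+ i) (i * m) (c ^+ i).
Proof.
move=> tp; elim: i => [|i IHi]; last by rewrite !exprS mulSn; apply: top_coefM.
by exists 0; rewrite ?size_poly0 // !expr0 mulr1 addr0.
Qed.

Lemma top_coefD p q m c e : top_coef p m c -> top_coef q m e -> top_coef (p + q) m (c + e).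
Proof.
move=> [p' sp ->] [q' sq ->]; exists (p' + q'); last by rewrite polyCD; ring.
by rewrite (leq_trans (size_polyD _ _)) // geq_max sp.
Qed.

Lemma top_coefZ p m c e : top_coef p m c -> top_coef (e%:P * p) m (e * c).
Proof.
move=> [p' sp ->]; exists (e%:P * p'); last by rewrite polyCM; ring.
by rewrite mul_polyC (leq_trans (size_scale_leq _ _)).
Qed.

Lemma top_coefN p m c : top_coef p m c -> top_coef (- p) m (- c).
Proof.
by move=> tp; rewrite -mulN1r -[- c]mulN1r -polyCN; apply: top_coefZ.
Qed.

Lemma top_coef_linear c e : top_coef (c%:P * 'X + e%:P) 1 c.
Proof. by exists e%:P; rewrite // size_polyC leq_b1. Qed.

Lemma top_coef_size p m c : top_coef p m c -> c != 0 -> size p = m.+1.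
Proof.
move=> [p' sp ->] cn0; rewrite size_polyDl; last by rewrite mul_polyC size_scale ?size_polyXn.
by rewrite mul_polyC size_scale // size_polyXn.
Qed.

End TopCoefficient.

(** * Lowest term of the curve form, by comparing the orders of its two terms *)

Section LowestCurveForm.
Context (K : closedFieldType) (a b : nat) (la ka : K).
Local Notation B := {poly {poly K}}.
Local Notation io := (@polyCC K).
Context (x y z : B) (ex ez ey : nat) (lx ly lz : {poly K}).
Hypotheses (hx : lowest x ex lx) (hz : lowest z ez lz) (hy : lowest (y - io la * x) ey ly).
Local Notation F := (curve_form a b la ka io x y z).

Let h1 : lowest (x ^+ b * z ^+ a) (b * ex + a * ez) (lx ^+ b * lz ^+ a).
Proof. by apply: lowestM; apply: lowestX. Qed.

Let h2 : lowest (- (io ka * (y - io la * x) ^+ (a + b))) ((a + b) * ey) (- (ka%:P * ly ^+ (a + b))).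
Proof.
apply: lowestN; rewrite -[X in lowest _ X]add0n; apply: lowestM; last exact: lowestX.
exact: lowest_const.
Qed.

Lemma lowest_curve_form_lt : (b * ex + a * ez < (a + b) * ey)%N ->
  lowest F (b * ex + a * ez) (lx ^+ b * lz ^+ a).
Proof. by move=> lt; apply: lowest_gtD h1 h2. Qed.

Lemma lowest_curve_form_gt : ((a + b) * ey < b * ex + a * ez)%N ->
  lowest F ((a + b) * ey) (- (ka%:P * ly ^+ (a + b))).
Proof. by move=> lt; rewrite /curve_form addrC; apply: lowest_gtD h2 h1. Qed.

Lemma lowest_curve_form_eq : (b * ex + a * ez = (a + b) * ey)%N ->
  lowest F (b * ex + a * ez) (lx ^+ b * lz ^+ a - ka%:P * ly ^+ (a + b)).
Proof. by move=> eq; apply: lowestD; [exact: h1|rewrite eq; exact: h2]. Qed.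

End LowestCurveForm.

(** * Multiplicities of the tropicalized curve, ray by ray *)

Section CurveMultiplicity.
Context (K : closedFieldType) (n dm : nat) (M : 'M[K]_(dm, n.+1)) (R : realType).
Context (C : 'M[K]_(n.+1, 3)) (hC : coordinates M C) (f : 'I_3 -> 'I_n.+1) (hf : frame C f).
Hypothesis C_row : forall m, exists l, C m l != 0.
Context (a b : nat) (la ka ga : K).
Local Notation d := (a + b)%N.
Hypotheses (d0 : (0 < d)%N) (bd : coprime b d) (kaga : ka * ga ^+ d = 1).
Hypothesis gen : generic C a b la ka.

(** On the curve x_m is a combination of t^d, t^b and 1. If it vanished, the coefficient of t^d
    would contradict [generic], or the row of x_m would be 0. *)
Lemma curve_coord_neq0 m : curve_coord C a b la ga m != 0.
Proof.
have [ka0 _ gen2] := gen; rewrite /curve_coord /ptv sum_I3 /curve_point /= mulr1.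
apply/eqP => z; set F := _ + _ in z.
have e0 i : F`_i = C m o0 * (i == d)%:R + C m o1 * (la * (i == d)%:R + ga * (i == b)%:R) +
    (if i == 0%N then C m o2 else 0).
  by rewrite /F !(coefD, coefCM, coefXn, coefC).
have {}e0 i : C m o0 * (i == d)%:R + C m o1 * (la * (i == d)%:R + ga * (i == b)%:R) +
    (if i == 0%N then C m o2 else 0) = 0 by rewrite -e0 z coef0.
have [c1|c1] := eqVneq (C m o1) 0.
  have [l nz] := C_row m; case/eqP: nz; move: l.
  have := e0 d; have := e0 0%N; rewrite c1 !mul0r !addr0 eqxx [0%N == d]eq_sym (gtn_eqF d0).
  rewrite eqxx mulr0 add0r mulr1 addr0 => c2 c0.
  exact: I3P.
have [g1 g2] := gen2 _ c1; have := e0 d; rewrite eqxx (gtn_eqF d0) !mulr1 addr0.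
have [ab|nab] := eqVneq d b.
  rewrite mulr1 => e; case/negP: g2; apply/eqP.
  have -> : - C m o0 - la * C m o1 = C m o1 * ga.
    by apply/eqP; rewrite -subr_eq0 -oppr_eq0 -[X in _ == X]e; apply/eqP; ring.
  by rewrite exprMn mulrCA kaga mulr1.
by rewrite mulr0 addr0 => e; case/eqP: g1; rewrite -[RHS]e [C m o1 * _]mulrC.
Qed.

Local Notation P := (curve_ideal curve_coord_neq0).

Lemma curve_mult C' f' (hC' : coordinates M C') (hf' : frame C' f') (e tau : 'I_3 -> nat)
  (w : 'rV[R]_n.+1) (om : 'I_n.+1 -> nat) (c0 : R) (nu q : nat) (p : {poly K}) :
  e o2 = 0%N -> tau o2 = 0%N -> (e o0 * tau o1 = (e o1 * tau o0).+1)%N ->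
  (forall m, w 0 m = c0 + (om m)%:R) -> flag_weights C' e om ->
  lowest (curve_form a b la ka (@polyCC K) (degen_coord C' e tau (f o0))
    (degen_coord C' e tau (f o1)) (degen_coord C' e tau (f o2))) nu ('X^q * p) ->
  p != 0 -> (forall r, root p r -> forall m, (degen_lead C' e tau om m).[r] != 0) ->
  multiplicity (init_ideal w P) = (size p).-1%:Z.
Proof.
move=> e2 tau2 det w_om flag low p0 good; have [hP _ _] := curve_ideal_prime curve_coord_neq0.
exact: (@frame_multiplicity K n dm M R C' hC' f' hf' e tau e2 tau2 det w om c0 w_om flag P hP
  (L0_curve hC curve_coord_neq0) (f o0) (f o1) (f o2) a b la ka
  (curve_mem hf d0 kaga curve_coord_neq0 (f' o2))
  (curve_div hC hf d0 bd kaga (f' o2)) nu q p low p0 good).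
Qed.

Context (w : 'rV[R]_n.+1) (om : 'I_n.+1 -> nat) (c0 : R).
Hypothesis w_om : forall m, w 0 m = c0 + (om m)%:R.
Local Notation mult := (multiplicity (init_ideal w P)).
Local Notation i := (f o0).
Local Notation j := (f o1).
Local Notation k := (f o2).

Let ka0 : ka != 0. Proof. by case: gen. Qed.

Section Frame.
Context (C' : 'M[K]_(n.+1, 3)) (f' : 'I_3 -> 'I_n.+1) (hC' : coordinates M C') (hf' : frame C' f').

Lemma coord_frame e tau h : degen_coord C' e tau (f' h) = degen_point K e tau h.
Proof. by rewrite /degen_coord ptv_frame. Qed.

Lemma point_lowest e tau h : lowest (degen_point K e tau h) (e h) 'X^(tau h).
Proof. by exists 0; rewrite mulr0 addr0. Qed.

Definition curve_value (c : 'I_3 -> K) : K :=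
  curve_form a b la ka idfun (ptv C' idfun c i) (ptv C' idfun c j) (ptv C' idfun c k).

(** The avoidance condition of [generic], carried from the frame of the curve to another frame. *)
Lemma curve_value_neq0 m m' c : ~ parallel C' m m' ->
  ptv C' idfun c m = 0 -> ptv C' idfun c m' = 0 -> (exists l, c l != 0) ->
  [\/ ptv C' idfun c i != 0, ptv C' idfun c j != 0 | b = 0%N] -> curve_value c != 0.
Proof.
move=> npar cm cm' [l cl] cb; have [_ gen1 _] := gen.
pose q h := ptv C' idfun c (f h).
have qE m1 : ptv C idfun q m1 = ptv C' idfun c m1 by rewrite -(ptv_rel _ _ _ hC hC' hf).
apply: (gen1 m m' q); rewrite ?qE //.
  by move=> par; apply: npar; apply: (parallel_change _ par) => m1 h; apply: frame_rel hC' hC hf m1 h.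
apply: contrapT => h; case/eqP: cl; have -> : c l = ptv C' idfun c (f' l) by rewrite ptv_frame.
rewrite -qE /ptv big1 // => h' _; have -> : q h' = 0; last by rewrite mulr0.
by apply/eqP; apply: contrapT => /negP nz; apply: h; exists h'.
Qed.

(* the rays in the interior of a cone over a point other than the singular one *)
Lemma mult_other_point e0 e1 : (0 < e1)%N -> (e1 <= e0)%N -> coprime e0 e1 ->
  flag_weights C' (tri e0 e1 0%N) om ->
  [\/ C' i o2 != 0, C' j o2 != 0 | b = 0%N] -> mult = 0.
Proof.
move=> e1_gt0 e10 cop flag nz; have e0_gt0 := leq_trans e1_gt0 e10.
have [t0 [t1 det]] := bezout_exists e0_gt0 cop.
pose e : 'I_3 -> nat := tri e0 e1 0%N; pose tau : 'I_3 -> nat := tri t0 t1 0%N.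
(* Since both weights are positive, S = 0 is the point of the flag. The curve misses it, so p is a
   nonzero constant. *)
have low m : lowest (degen_coord C' e tau m) 0 (C' m o2)%:P.
  have := @degen_coord_lowest_ge K n C' e tau m 0%N (fun _ _ => isT).
  by rewrite sum_I3 /= (gtn_eqF e0_gt0) (gtn_eqF e1_gt0) !add0r mulr1.
pose c : 'I_3 -> K := tri 0 0 1.
have ptvc m : ptv C' idfun c m = C' m o2 by rewrite /ptv sum_I3 /= !mulr0 !add0r mulr1.
have cv : curve_value c != 0.
  apply: (curve_value_neq0 (m := f' o0) (m' := f' o1)); rewrite ?ptvc ?(frameE _ _ hf') //.
    move=> /(_ o0 o1); rewrite !(frameE _ _ hf') /= mulr1 mulr0 => /eqP.
    by rewrite oner_eq0.
  by exists o2; rewrite /= oner_neq0.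
rewrite (@curve_mult C' f' hC' hf' e tau w om c0 0 0 (curve_value c)%:P erefl erefl det w_om flag).
- by rewrite size_const_neq0.
- have low' : lowest (degen_coord C' e tau j - polyCC la * degen_coord C' e tau i) 0
      (C' j o2 - la * C' i o2)%:P.
    rewrite polyCB polyCM; apply: lowestD => //; apply: lowestN.
    by apply: (@lowestM _ _ _ 0 0) => //; apply: lowest_const.
  rewrite expr0 mul1r /curve_value !ptvc /curve_form polyCB !polyCM !polyC_exp.
  have := @lowest_curve_form_eq K a b la ka _ _ _ _ _ _ _ _ _ (low i) (low k) low'.
  by rewrite !muln0 addn0; apply.
- by rewrite polyC_eq0.
- by move=> r /(not_root_const cv).
Qed.

(** For the ray of a line, T = r is a point of that line. If it lies on the curve and the lead of
    x_m vanished there, a second line would pass through it, against genericity. *)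
Lemma rank1_lead_neq0 r m : flag_weights C' (tri 1 0 0)%N om ->
  [\/ ptv C' idfun (tri 0 r 1) i != 0, ptv C' idfun (tri 0 r 1) j != 0 | b = 0%N] ->
  curve_value (tri 0 r 1) = 0 -> (degen_lead C' (tri 1 0 0)%N (tri 0 1 0)%N om m).[r] != 0.
Proof.
move=> flag cond cv; have [le_om [h nz eh]] := flag m.
have om01 : om m = 1%N \/ om m = 0%N by rewrite -eh; move: (h); elim/I3P; [left|right|right].
rewrite /degen_lead sum_I3 /=; case: om01 => omm.
  rewrite omm /= !addr0 mulr1 hornerC; apply: contraTneq isT => c00.
  have := le_om h nz; rewrite omm => {}le_om; move: nz eh le_om.
  by move: (h); elim/I3P => //=; rewrite c00 eqxx.
rewrite omm /= add0r mulr1 !hornerE; apply/negP => /eqP z.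
have := curve_value_neq0 (m := f' o0) (m' := m) _ _ _ _ cond; rewrite cv eqxx => H.
apply: notF; apply: H.
- move=> par; have := par o0 o1; have := par o0 o2; rewrite !(frameE _ _ hf') /= !mul1r !mul0r => c2 c1.
  move: nz eh; rewrite omm; move: (h); elim/I3P => //=; rewrite ?c1 ?c2 eqxx //.
- by rewrite /ptv sum_I3 !(frameE _ _ hf') /= !mul0r mulr0 !addr0.
- by rewrite /ptv sum_I3 /= mulr0 add0r mulr1.
- by exists o2; rewrite /= oner_neq0.
Qed.

(** Bezout for a line that misses the singular point: p is the restriction of the curve form to the
    line. *)
Lemma mult_line_outside : C (f' o0) o2 != 0 -> flag_weights C' (tri 1 0 0)%N om -> mult = d%:Z.
Proof.
move=> out flag; pose e : 'I_3 -> nat := tri 1 0 0%N; pose tau : 'I_3 -> nat := tri 0 1 0%N.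
have cond c : c o0 = 0 -> (exists l, c l != 0) ->
    [\/ ptv C' idfun c i != 0, ptv C' idfun c j != 0 | b = 0%N].
  move=> c0' [l cl]; have [qi|] := eqVneq (ptv C' idfun c i) 0; last by constructor 1.
  have [qj|] := eqVneq (ptv C' idfun c j) 0; last by constructor 2.
  have qE m : ptv C' idfun c m = C m o2 * ptv C' idfun c k.
    by rewrite (ptv_rel _ _ _ hC hC' hf) /ptv sum_I3 -!/(ptv _ _ _ _) qi qj !mulr0 !add0r.
  have := qE (f' o0); rewrite ptv_frame // c0' => /esym/eqP.
  rewrite mulf_eq0 (negPf out) => /eqP qk; case/eqP: cl.
  by rewrite -(ptv_frame idfun c l hf') qE qk mulr0.
have low m : lowest (degen_coord C' e tau m) 0 ((C' m o1)%:P * 'X + (C' m o2)%:P).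
  have := @degen_coord_lowest_ge K n C' e tau m 0%N (fun _ _ => isT).
  by rewrite sum_I3 /= add0r mulr1.
have low' : lowest (degen_coord C' e tau j - polyCC la * degen_coord C' e tau i) 0
    ((C' j o1)%:P * 'X + (C' j o2)%:P - la%:P * ((C' i o1)%:P * 'X + (C' i o2)%:P)).
  apply: lowestD => //; apply: lowestN.
  by apply: (@lowestM _ _ _ 0 0) => //; apply: lowest_const.
have := @lowest_curve_form_eq K a b la ka _ _ _ _ _ _ _ _ _ (low i) (low k) low'.
rewrite !muln0 addn0; set p := _ - _ => /(_ erefl) lowp.
have pv r : p.[r] = curve_value (tri 0 r 1).
  rewrite /p /curve_value /curve_form /ptv !sum_I3 /= !mulr0 !add0r !mulr1.
  by rewrite !(hornerE, horner_exp).
(* The coefficient of T^d is the value at the point T = infinity, where the line meets that of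
   [f' o2]; the curve avoids it, so deg p = d. *)
have tp : top_coef p d (curve_value (tri 0 1 0)).
  rewrite /p /curve_value /curve_form /ptv !sum_I3 /= !mulr0 !add0r !addr0 !mulr1.
  have t1 := top_coefM (top_coefX b (top_coef_linear (C' i o1) (C' i o2)))
    (top_coefX a (top_coef_linear (C' k o1) (C' k o2))).
  have t2 := top_coefX d (top_coefD (top_coef_linear (C' j o1) (C' j o2))
    (top_coefN (top_coefZ la (top_coef_linear (C' i o1) (C' i o2))))).
  rewrite !muln1 addnC in t1; rewrite muln1 in t2.
  exact: (top_coefD t1 (top_coefN (top_coefZ ka t2))).
have cv : curve_value (tri 0 1 0) != 0.
  apply: (curve_value_neq0 (m := f' o0) (m' := f' o2)); rewrite ?(ptv_frame _ _ _ hf') //.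
  - by move=> /(_ o0 o2)/eqP; rewrite !(frameE _ _ hf') /= mulr1 mulr0 oner_eq0.
  - by exists o1; rewrite /= oner_neq0.
  - by apply: (cond (tri 0 1 0)); [|exists o1; rewrite /= oner_neq0].
have sp := top_coef_size tp cv.
rewrite (@curve_mult C' f' hC' hf' e tau w om c0 0 0 p erefl erefl erefl w_om flag).
- by rewrite sp.
- by rewrite expr0 mul1r.
- by rewrite -size_poly_gt0 sp.
- move=> r /rootP; rewrite pv => cr m; apply: rank1_lead_neq0 => //.
  by apply: cond => //; exists o2; rewrite /= oner_neq0.
Qed.

End Frame.
Lemma binomial_size (c e : K) : c != 0 -> size (c%:P * 'X + e%:P) = 2.
Proof. by move=> cn0; rewrite size_MXaddC polyC_eq0 (negPf cn0) size_polyC cn0. Qed.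

Lemma binomial_neq0 (c e : K) : c != 0 -> c%:P * 'X + e%:P != 0.
Proof. by move=> cn0; rewrite -size_poly_gt0 binomial_size. Qed.

Lemma injective_lead_neq0 (C' : 'M[K]_(n.+1, 3)) (e tau : 'I_3 -> nat) r m : flag_weights C' e om ->
  (forall h h', e h = e h' -> h = h') -> r != 0 -> (degen_lead C' e tau om m).[r] != 0.
Proof.
move=> flag inj r0; have [_ [h nz eh]] := flag m.
rewrite /degen_lead (bigD1 h) //= eh eqxx big1 ?addr0.
  by rewrite !(hornerE, horner_exp) mulf_neq0 ?expf_neq0.
by move=> h' hh'; case: eqVneq => // /esym; rewrite -eh => /inj/esym/eqP; rewrite (negPf hh').
Qed.

Lemma tri_inj (x y : nat) : (0 < y)%N -> (y < x)%N ->
  forall h h', tri x y 0%N h = tri x y 0%N h' -> h = h'.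
Proof.
move=> y0 yx h h'; elim/I3P: h; elim/I3P: h'; rewrite /tri //= => e; exfalso; move: e; lia.
Qed.

Let y_low e tau D : (D <= e o0)%N -> (D <= e o1)%N ->
  lowest (degen_coord C e tau j - polyCC la * degen_coord C e tau i) D
    ((if e o1 == D then 'X^(tau o1) else 0) - la%:P * (if e o0 == D then 'X^(tau o0) else 0)).
Proof.
move=> D0 D1; have pl h : (D <= e h)%N -> lowest (degen_point K e tau h) D
    (if e h == D then 'X^(tau h) else 0).
  move=> De; have lp := @point_lowest e tau h; have [<-//|ne] := eqVneq (e h) D.
  by apply: lowest_lt lp; rewrite ltn_neqAle eq_sym ne.
rewrite !(coord_frame hf); apply: lowestD; first exact: pl.
by apply: lowestN; rewrite -[D]add0n; apply: lowestM; [exact: lowest_const|exact: pl].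
Qed.

Let i_low e tau : lowest (degen_coord C e tau i) (e o0) 'X^(tau o0).
Proof. by rewrite (coord_frame hf); apply: point_lowest. Qed.

Let k_low e tau : e o2 = 0%N -> tau o2 = 0%N -> lowest (degen_coord C e tau k) 0 1.
Proof. by move=> e2 t2; rewrite (coord_frame hf); have := @point_lowest e tau o2; rewrite e2 t2. Qed.

(** For these weights the two terms of the equation have the same order in S, and up to a monomial
    the lowest coefficient is linear in T: there is a single branch. *)
Lemma mult_singular_branch : (0 < b)%N -> flag_weights C (tri d b 0)%N om -> mult = 1.
Proof.
move=> b0 flag; have [a0|a0] := posnP a.
  (* Here d = b = 1: the curve is a line through the point, x_i and x_j have equal weights, and the
     leads are no longer monomials. The last condition of [generic] keeps the curve apart from the
     other lines. *)
  have b1 : b = 1%N by move: bd; rewrite a0 add0n /coprime gcdnn => /eqP.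
  have flag1 : flag_weights C (tri 1 1 0)%N om by move: flag; rewrite a0 b1.
  pose e : 'I_3 -> nat := tri 1 1 0%N; pose tau : 'I_3 -> nat := tri 0 1 0%N.
  have low' := @y_low e tau 1 isT isT.
  have lowi := @i_low e tau; have lowk := @k_low e tau erefl erefl.
  have := @lowest_curve_form_eq K a b la ka _ _ _ _ _ _ _ _ _ lowi lowk low'.
  have eb : (b * e o0 + a * 0 = d * 1)%N by rewrite a0 b1.
  move=> /(_ eb); set p := _ - _ => low.
  have ep : p = (- ka)%:P * 'X + (1 + ka * la)%:P.
    by rewrite /p a0 b1 /= expr0 !expr1 mulr1 polyCN polyCD polyCM polyC1; ring.
  rewrite (@curve_mult C f hC hf e tau w om c0 (b * e o0 + a * 0) 0 p erefl erefl erefl w_om flag1).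
  - by rewrite ep binomial_size ?oppr_eq0.
  - by rewrite expr0 mul1r; exact: low.
  - by rewrite ep binomial_neq0 ?oppr_eq0.
  - move=> r /rootP; rewrite ep hornerD hornerCM hornerX hornerC => root m.
    have [le_om [h nz eh]] := flag1 m; rewrite /degen_lead sum_I3 /=.
    have om01 : om m = 1%N \/ om m = 0%N by rewrite -eh; move: (h); elim/I3P; [left|left|right].
    case: om01 => omm; rewrite omm /=.
      rewrite addr0 mulr1 !hornerE; apply/negP => /eqP z.
      have c1 : C m o1 != 0.
        apply/eqP => c1; move: z; rewrite c1 mul0r addr0 => c00; move: nz eh; rewrite omm.
        by move: (h); elim/I3P; rewrite ?c00 ?c1 ?eqxx.
      have [_ _ /(_ _ c1)[_]] := gen; rewrite a0 b1 !expr1 => /negP; apply; apply/eqP.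
      have -> : - C m o0 = C m o1 * r by rewrite -[LHS]addr0 -z; ring.
      have -> : ka * (C m o1 * r - la * C m o1) = C m o1 - C m o1 * (- ka * r + (1 + ka * la)) by ring.
      by rewrite root mulr0 subr0.
    rewrite !add0r mulr1 hornerC; move: nz eh; rewrite omm.
    by move: (h); elim/I3P.
have db : coprime d b by rewrite coprime_sym.
have [t0 [t1 det]] := bezout_exists d0 db.
pose e : 'I_3 -> nat := tri d b 0%N; pose tau : 'I_3 -> nat := tri t0 t1 0%N.
have bd' : (b < d)%N by rewrite -{1}[b]add0n ltn_add2r.
have low' := @y_low e tau b (ltnW bd') (leqnn b).
rewrite /e /= eqxx (gtn_eqF bd') mulr0 subr0 in low'.
have lowi := @i_low e tau; have lowk := @k_low e tau erefl erefl.
have := @lowest_curve_form_eq K a b la ka _ _ _ _ _ _ _ _ _ lowi lowk low'.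
have eb : (b * e o0 + a * 0 = d * b)%N by rewrite muln0 addn0 mulnC.
(* By [det] the second term has T-exponent d t1 = b t0 + 1, one more than the first. *)
move=> /(_ eb); rewrite /= expr1n mulr1 -!exprM [(t1 * _)%N]mulnC det [(tau o0 * b)%N]mulnC => low.
have r0 : (- ka)%:P * 'X + 1%:P != 0 by rewrite binomial_neq0 ?oppr_eq0.
rewrite (@curve_mult C f hC hf e tau w om c0 (b * e o0 + a * 0) (b * t0) ((- ka)%:P * 'X + 1%:P) erefl erefl det w_om flag) //.
- by rewrite binomial_size ?oppr_eq0.
- by move: low; congr lowest; rewrite exprS polyCN polyC1; ring.
- move=> r /rootP; rewrite hornerD hornerCM hornerX hornerC => rr m; apply: injective_lead_neq0 => //.
    exact: tri_inj.
  by apply: contra_eqN rr => /eqP->; rewrite mulr0 add0r oner_eq0.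
Qed.

(** The orders b e0 and d e1 of the two terms agree only for (d, b), by coprimality. Otherwise one
    term dominates, the lowest coefficient is a monomial, and p is constant. *)
Lemma mult_other_branch e0 e1 : (0 < b)%N -> (0 < e1)%N -> (e1 <= e0)%N -> coprime e0 e1 ->
  ~ (e0 = d /\ e1 = b) -> flag_weights C (tri e0 e1 0%N) om -> mult = 0.
Proof.
move=> b0 e1_gt0 e10 cop ne flag; have e0_gt0 := leq_trans e1_gt0 e10.
have [t0 [t1 det]] := bezout_exists e0_gt0 cop.
pose e : 'I_3 -> nat := tri e0 e1 0%N; pose tau : 'I_3 -> nat := tri t0 t1 0%N.
have low' := @y_low e tau e1 e10 (leqnn e1).
have lowi := @i_low e tau; have lowk := @k_low e tau erefl erefl.
have [lt|gt|eq] := ltngtP (b * e0) (d * e1).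
- have lt' : (b * e o0 + a * 0 < d * e1)%N by rewrite muln0 addn0.
  have := @lowest_curve_form_lt K a b la ka _ _ _ _ _ _ _ _ _ lowi lowk low' lt'.
  rewrite /= expr1n mulr1 -exprM => low.
  rewrite (@curve_mult C f hC hf e tau w om c0 (b * e o0 + a * 0) (t0 * b) 1 erefl erefl det w_om flag).
  + by rewrite size_poly1.
  + by rewrite mulr1.
  + exact: oner_neq0.
  + by move=> r; rewrite (negPf (root1 _)).
- have gt' : (d * e1 < b * e o0 + a * 0)%N by rewrite muln0 addn0.
  have := @lowest_curve_form_gt K a b la ka _ _ _ _ _ _ _ _ _ lowi lowk low' gt'.
  have /gtn_eqF-> : (e1 < e0)%N.
    rewrite ltn_neqAle e10 andbT; apply: contraTneq gt => ->.
    by rewrite -leqNgt leq_mul2r leq_addl orbT.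
  rewrite /= eqxx mulr0 subr0 -exprM mulrC -mulrN -polyCN => low.
  rewrite (@curve_mult C f hC hf e tau w om c0 (d * e1) (t1 * d) (- ka)%:P erefl erefl det w_om flag).
  + by rewrite size_const_neq0 ?oppr_eq0.
  + exact: low.
  + by rewrite polyC_eq0 oppr_eq0.
  + by move=> r /(not_root_const (_ : - ka != 0)) []; rewrite oppr_eq0.
- case: ne; have hd : (e0 %| d)%N by rewrite -(Gauss_dvdl _ cop) -eq dvdn_mull.
  have hd' : (d %| e0)%N by rewrite -(Gauss_dvdr _ (_ : coprime d b)) 1?coprime_sym // eq dvdn_mulr.
  have de : e0 = d by apply/eqP; rewrite eqn_dvd hd hd'.
  by split=> //; move: eq; rewrite de mulnC => /eqP; rewrite eqn_pmul2l // => /eqP.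
Qed.

(** For b > 0 the curve meets x_i = 0 only where x_j = 0 as well, that is at the singular point; for
    b = 0 it is a general line. *)
Lemma mult_first_line : flag_weights C (tri 1 0 0)%N om -> mult = (b == 0%N)%:Z.
Proof.
move=> flag; pose e : 'I_3 -> nat := tri 1 0 0%N; pose tau : 'I_3 -> nat := tri 0 1 0%N.
have low' := @y_low e tau 0 isT isT; rewrite /= mulr0 subr0 expr1 in low'.
have lowi := @i_low e tau; have lowk := @k_low e tau erefl erefl.
have [b0|b0] := posnP b.
  have a1 : a = 1%N by move: bd; rewrite b0 addn0 /coprime gcd0n => /eqP.
  have eb : (b * e o0 + a * 0 = d * 0)%N by rewrite b0 !muln0.
  have := @lowest_curve_form_eq K a b la ka _ _ _ _ _ _ _ _ _ lowi lowk low' eb.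
  set p := _ - _ => low; have ep : p = (- ka)%:P * 'X + 1%:P.
    by rewrite /p a1 b0 /= expr0 !expr1 mulr1 polyCN polyC1; ring.
  rewrite (@curve_mult C f hC hf e tau w om c0 (b * e o0 + a * 0) 0 p erefl erefl erefl w_om flag).
  - by rewrite ep binomial_size ?oppr_eq0.
  - by rewrite expr0 mul1r; exact: low.
  - by rewrite ep binomial_neq0 ?oppr_eq0.
  - move=> r /rootP; rewrite ep hornerD hornerCM hornerX hornerC => rr m.
    apply: (rank1_lead_neq0 hC hf) => //; first by constructor 3.
    rewrite /curve_value !(ptv_frame _ _ _ hf) /curve_form /= a1 b0 expr0 !expr1 mulr1 mulr0 subr0.
    by rewrite -rr addrC mulNr.
have gt' : (d * 0 < b * e o0 + a * 0)%N by rewrite !muln0 addn0 muln1.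
have := @lowest_curve_form_gt K a b la ka _ _ _ _ _ _ _ _ _ lowi lowk low' gt'.
rewrite mulrC -mulrN -polyCN => low.
rewrite (@curve_mult C f hC hf e tau w om c0 (d * 0) d (- ka)%:P erefl erefl erefl w_om flag).
- by rewrite size_const_neq0 ?oppr_eq0.
- exact: low.
- by rewrite polyC_eq0 oppr_eq0.
- by move=> r /(not_root_const (_ : - ka != 0)) []; rewrite oppr_eq0.
Qed.

Section LineThroughSingularPoint.
Context (C' : 'M[K]_(n.+1, 3)) (f' : 'I_3 -> 'I_n.+1) (hC' : coordinates M C') (hf' : frame C' f').
Hypotheses (fi : f' o1 = i) (fk : f' o2 = k) (j2 : C' j o2 = 0).
Local Notation be := (C' j o1).

(** On the line of [f' o0], which passes through the singular point, x_j = be x_i. These are the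
    conditions of [generic] on its row, divided by the entry [g1]. *)
Let generic_slope : be - la != 0 /\ 1 != ka * (be - la) ^+ d.
Proof.
have rel := frame_rel hC hC' hf' j; have := rel o1; have := rel o0.
rewrite !sum_I3 fi fk j2 !(frameE _ _ hf) /= !mul0r !addr0 mulr1 mulr0 addr0.
set al := C' j o0; set g0 := C (f' o0) o0; set g1 := C (f' o0) o1 => /esym e0 /esym e1.
have g1n0 : g1 != 0 by apply/eqP => z; move: e1; rewrite z mulr0 => /esym/eqP; rewrite oner_eq0.
have g0E : g0 = - be * g1.
  have -> : g0 = (al * g1) * g0 by rewrite e1 mul1r.
  have -> : al * g1 * g0 = g1 * (al * g0 + be) - be * g1 by ring.
  by rewrite e0 mulr0 sub0r mulNr.
have [_ _ /(_ _ g1n0)[]] := gen; rewrite -/g0 -/g1 g0E => h1 h2; split.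
  by apply: contraNneq h1 => e; apply/eqP; transitivity (- (be - la) * g1); [ring|rewrite e oppr0 mul0r].
apply: contraNneq h2 => e; apply/eqP.
have -> : - (- be * g1) - la * g1 = (be - la) * g1 by ring.
by rewrite exprMn mulrA -e mul1r.
Qed.

Let p_i e tau : degen_coord C' e tau i = degen_point K e tau o1.
Proof. by rewrite -fi coord_frame. Qed.

Let p_k e tau : degen_coord C' e tau k = degen_point K e tau o2.
Proof. by rewrite -fk coord_frame. Qed.

Let low_y e tau : e o2 = 0%N -> (e o1 < e o0)%N ->
  lowest (degen_coord C' e tau j - polyCC la * degen_coord C' e tau i) (e o1)
    ((be - la)%:P * 'X^(tau o1)).
Proof.
move=> e2 e10; rewrite p_i.
have := @degen_coord_lowest_ge K n C' e tau j (e o1) => H.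
have {H} : lowest (degen_coord C' e tau j) (e o1) (be%:P * 'X^(tau o1)).
  have := H; rewrite sum_I3 eqxx (gtn_eqF e10) j2 mul0r if_same add0r addr0; apply.
  by elim/I3P; rewrite ?j2 ?eqxx // => _; apply: ltnW.
move=> lj; rewrite polyCB mulrBl; apply: lowestD => //; apply: lowestN.
by rewrite -[e o1]add0n; apply: lowestM; [exact: lowest_const|exact: point_lowest].
Qed.

(** Along this line x_i and x_j - la x_i have the same order e1, so the term in x_i^b dominates if b
    < d. If b = d = 1, the coefficient 1 - ka (be - la) is nonzero. *)
Lemma mult_sector_above e0 e1 : (0 < e1)%N -> (e1 < e0)%N -> coprime e0 e1 ->
  flag_weights C' (tri e0 e1 0%N) om -> mult = 0.
Proof.
move=> e1_gt0 e10 cop flag; have e0_gt0 := ltn_trans e1_gt0 e10.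
have [t0 [t1 det]] := bezout_exists e0_gt0 cop.
pose e : 'I_3 -> nat := tri e0 e1 0%N; pose tau : 'I_3 -> nat := tri t0 t1 0%N.
have low' := @low_y e tau erefl e10; have [_ g2] := generic_slope.
have lowi := @point_lowest e tau o1; have lowk := @point_lowest e tau o2.
rewrite -p_i in lowi; rewrite -p_k in lowk.
have [c cn0 low] : exists2 c : K, c != 0 & lowest (curve_form a b la ka (@polyCC K)
    (degen_coord C' e tau i) (degen_coord C' e tau j) (degen_coord C' e tau k))
    (b * e o1 + a * e o2) ('X^(t1 * b) * c%:P).
  have [a0|a0] := posnP a.
    have b1 : b = 1%N by move: bd; rewrite a0 add0n /coprime gcdnn => /eqP.
    have eb : (b * e o1 + a * e o2 = d * e o1)%N by rewrite a0 b1 mul0n addn0.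
    have := @lowest_curve_form_eq K a b la ka _ _ _ _ _ _ _ _ _ lowi lowk low' eb => low.
    exists (1 - ka * (be - la) ^+ d); first by rewrite subr_eq0.
    move: low; congr lowest; rewrite a0 b1 expr0 !expr1 mulr1 muln1 [(1 - _)%:P]polyCB polyCM polyC1; ring.
  have lt' : (b * e o1 + a * e o2 < d * e o1)%N by rewrite muln0 addn0 ltn_pmul2r // -{1}[b]add0n ltn_add2r.
  have := @lowest_curve_form_lt K a b la ka _ _ _ _ _ _ _ _ _ lowi lowk low' lt' => low.
  exists 1; first exact: oner_neq0.
  by move: low; congr lowest; rewrite /= expr0 expr1n -exprM polyC1.
rewrite (@curve_mult C' f' hC' hf' e tau w om c0 _ (t1 * b) c%:P erefl erefl det w_om flag low).
- by rewrite size_const_neq0.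
- by rewrite polyC_eq0.
- by move=> r /(not_root_const cn0).
Qed.

(** On x_j = be x_i the equation is x_i^b (x_k^a - ka (be - la)^d x_i^a): the singular point absorbs
    b of the d intersections. *)
Lemma mult_line_through : flag_weights C' (tri 1 0 0)%N om -> mult = a%:Z.
Proof.
move=> flag; pose e : 'I_3 -> nat := tri 1 0 0%N; pose tau : 'I_3 -> nat := tri 0 1 0%N.
have low' := @low_y e tau erefl isT; have [g1 g2] := generic_slope.
have lowi := @point_lowest e tau o1; have lowk := @point_lowest e tau o2.
rewrite -p_i in lowi; rewrite -p_k in lowk.
have eb : (b * e o1 + a * e o2 = d * e o1)%N by rewrite !muln0.
have := @lowest_curve_form_eq K a b la ka _ _ _ _ _ _ _ _ _ lowi lowk low' eb => low.
pose c := - (ka * (be - la) ^+ d); pose p := c%:P * 'X^a + 1%:P : {poly K}.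
have {}low : lowest (curve_form a b la ka (@polyCC K)
    (degen_coord C' e tau i) (degen_coord C' e tau j) (degen_coord C' e tau k))
    (b * e o1 + a * e o2) ('X^b * p).
  move: low; congr lowest.
  rewrite /= expr1 expr0 expr1n mulr1 exprMn ['X^(a + b)]exprD /p /c polyCN polyCM [(_ ^+ d)%:P]polyC_exp polyC1.
  by move: (_ ^+ d) => u; ring.
have cn0 : c != 0 by rewrite oppr_eq0 mulf_neq0 ?expf_neq0.
have sp : size p = a.+1.
  rewrite /p; have [->|a0] := posnP a.
    by rewrite expr0 mulr1 -polyCD size_polyC addrC /c subr_eq0 g2.
  by rewrite size_polyDl ?size_Cmul ?size_polyXn // size_poly1.
rewrite (@curve_mult C' f' hC' hf' e tau w om c0 _ b p erefl erefl erefl w_om flag low).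
- by rewrite sp.
- by rewrite -size_poly_gt0 sp.
- move=> r /rootP rr m; have a0 : (0 < a)%N.
    rewrite lt0n; apply/eqP => a0; move: rr; rewrite /p a0 expr0 mulr1 -polyCD hornerC addrC => /eqP.
    by rewrite /c subr_eq0 (negPf g2).
  move: rr; rewrite /p hornerD hornerCM hornerXn hornerC => rr.
  have pi r' : ptv C' idfun (tri 0 r' 1) i = r' by rewrite -fi (ptv_frame _ _ _ hf').
  apply: (rank1_lead_neq0 hC' hf') => //.
    constructor 1; rewrite pi; apply/eqP => r0; move: rr; rewrite r0 expr0n gtn_eqF //.
    by rewrite mulr0 add0r => /eqP; rewrite oner_eq0.
  rewrite /curve_value pi -fk (ptv_frame _ _ _ hf') /= /ptv sum_I3 /= j2 mulr0 mul0r add0r addr0.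
  rewrite /curve_form expr1n mulr1 -[RHS](mulr0 (r ^+ b)) -rr /c.
  have -> : be * r - la * r = (be - la) * r by ring.
  by rewrite exprMn [r ^+ (a + b)]exprD; move: (_ ^+ d) => u /=; ring.
Qed.

End LineThroughSingularPoint.

End CurveMultiplicity.

(** * Lattice vectors modulo 1 *)

Section ModOneTheory.
Context (n : nat).

Lemma modone_piP (V : nzRingType) (v w : 'rV[V]_n.+1) :
  modone_pi v = modone_pi w <-> exists c, v = w + const_mx c.
Proof.
have -> : (modone_pi v = modone_pi w) <-> v - w \in @span1 V n.
  rewrite Quotient.idealrBE; split=> [e|/eqP//]; exact/eqP.
split=> [/eqP e|[c ->]]; last first.
  by rewrite addrC addKr inE; apply/eqP/rowP => m; rewrite !mxE.
by exists ((v - w) 0 0); rewrite -e addrCA subrr addr0.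
Qed.

Lemma modone_reprK (V : nzRingType) (u : modone V n) : modone_pi (modone_repr u) = u.
Proof. exact: reprK. Qed.

Lemma modone_piMz (v : 'rV[int]_n.+1) (k : int) : modone_pi v *~ k = modone_pi (k *: v).
Proof.
by rewrite /modone_pi -raddfMz -scaler_int intz.
Qed.

Lemma modone_pi0 : modone_pi (0 : 'rV[int]_n.+1) = 0.
Proof. by rewrite /modone_pi raddf0. Qed.

Lemma modone_piD (v w : 'rV[int]_n.+1) : modone_pi v + modone_pi w = modone_pi (v + w).
Proof. by rewrite /modone_pi raddfD. Qed.

Lemma modone_pi_sum (T : Type) (s : seq T) (P : pred T) (F : T -> 'rV[int]_n.+1) :
  \sum_(i <- s | P i) modone_pi (F i) = modone_pi (\sum_(i <- s | P i) F i).
Proof. by rewrite /modone_pi raddf_sum. Qed.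

Definition natrow (g : 'I_n.+1 -> nat) : 'rV[int]_n.+1 := \row_m (g m)%:Z.

(** The representative modulo 1 with minimum 0, which makes all weights natural numbers. *)
Definition height (u : modone int n) (m : 'I_n.+1) : nat :=
  `|(modone_repr u 0 m - modone_repr u 0 [arg min_(i < 0) modone_repr u 0 i]%O)%R|%N.

Lemma height_repr u : exists c : int, forall m, modone_repr u 0 m = c + (height u m)%:Z.
Proof.
rewrite /height; case: arg_minP => // m0 _ le; exists (modone_repr u 0 m0) => m.
by rewrite gez0_abs ?subr_ge0 ?le // addrC subrK.
Qed.

Lemma height_min u : exists m, height u m = 0%N.
Proof. by exists [arg min_(i < 0) modone_repr u 0 i]%O; rewrite /height subrr. Qed.

Lemma modone_pi_height u : modone_pi (natrow (height u)) = u.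
Proof.
rewrite -[RHS]modone_reprK; apply/modone_piP; have [c hc] := height_repr u.
by exists (- c); apply/rowP => m; rewrite !mxE hc addrAC subrr add0r.
Qed.

Lemma height_natrow g : (exists m, g m = 0%N) -> height (modone_pi (natrow g)) =1 g.
Proof.
move=> [m0 g0] m; have /modone_piP[c /rowP hc] := modone_pi_height (modone_pi (natrow g)).
have [m1 h1] := height_min (modone_pi (natrow g)).
have := hc m0; have := hc m1; have := hc m; rewrite !mxE g0 h1; lia.
Qed.

Lemma lattice_vec_height (R : realType) u : exists c : R, forall m, lattice_vec R u 0 m = c + (height u m)%:R.
Proof.
have [c hc] := height_repr u; exists c%:~R => m.
by rewrite mxE hc intrD.
Qed.

Lemma primitive_gcd u g : primitive u -> (forall m, g %| height u m)%N -> g = 1%N.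
Proof.
move=> [_ pr] dv; apply: (pr (modone_pi (natrow (fun m => height u m %/ g)%N))).
rewrite pmulrn modone_piMz -[LHS]modone_pi_height; congr modone_pi.
by apply/rowP => m; rewrite !mxE -PoszM mulnC divnK.
Qed.

End ModOneTheory.

Section InitModOne.
Context (K : closedFieldType) (n : nat) (R : realType).

Lemma init_form_modone (w w' : 'rV[R]_n.+1) (f : laurent0 K n) :
  modone_pi w = modone_pi w' -> init_form0 w f = init_form0 w' f.
Proof.
move=> /modone_piP[c ->]; apply: val_inj; rewrite /= /init_form.
have f0 : forall v, v \in msupp (val f) -> degx v = 0.
  by move=> v; rewrite -mcoeff_neq0; case: f => f /= /deg0P; apply.
have we v : v \in msupp (val f) -> weight (w' + const_mx c) v = weight w' v.
  move=> /f0; rewrite /weight /degx => d0.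
  transitivity (\sum_m w' 0 m * (v 0 m)%:~R + \sum_m c * (v 0 m)%:~R).
    by rewrite -big_split /=; apply: eq_bigr => m _; rewrite !mxE mulrDl.
  by rewrite -mulr_sumr -rmorph_sum d0 mulr0 addr0.
rewrite [LHS]big_seq_cond [RHS]big_seq_cond; apply: eq_bigl => v.
case: (boolP (v \in _)) => //= vf; apply: eq_in_all => v' vf'.
by rewrite !we.
Qed.

Lemma init_ideal_modone (w w' : 'rV[R]_n.+1) (I : set (laurent0 K n)) :
  modone_pi w = modone_pi w' -> init_ideal w I = init_ideal w' I.
Proof.
by move=> e; rewrite /init_ideal; congr ideal_gen; apply: eq_imagel => f _; apply: init_form_modone.
Qed.

Lemma ray_trop_set (I : set (laurent0 K n)) u : ray u `<=` trop_set R I ->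
  init_ideal (lattice_vec R u) I <> setT.
Proof.
move=> sub; have [|w] := sub (modone_pi (1 *: lattice_vec R u)).
  by exists 1 => //=; rewrite ler01.
by rewrite scale1r => nT /init_ideal_modone <-.
Qed.

End InitModOne.

(** * Bases of the matroid and flags *)

Section Frames.
Context (K : closedFieldType) (n dm : nat) (M : 'M[K]_(dm, n.+1)).
Implicit Types (C : 'M[K]_(n.+1, 3)) (f g : 'I_3 -> 'I_n.+1) (om : 'I_n.+1 -> nat).

Lemma coordinates_full C : (\rank M + 3 = n.+1)%N -> coordinates M C -> row_full C.
Proof.
move=> rk hC; rewrite -col_leq_rank.
have : (kermx C <= M)%MS.
  by apply/row_subP => m; rewrite hC; apply/eqP/sub_kermxP; exact: row_sub.
move=> /mxrankS; rewrite mxrank_ker; have := rank_leq_row C; lia.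
Qed.

Lemma rowsub_frame C C' f g : coordinates M C -> coordinates M C' -> frame C f ->
  rowsub g C' = rowsub g C *m rowsub f C'.
Proof.
move=> hC hC' hf; apply/matrixP => l h; rewrite !mxE (frame_rel hC' hC hf).
by apply: eq_bigr => x _; rewrite !mxE.
Qed.

(** Steinitz exchange: x_m can replace any basis element that occurs in its expansion. *)
Lemma exchange_unit C f l m : frame C f -> C m l != 0 ->
  rowsub (fun h => if h == l then m else f h) C \in unitmx.
Proof.
move=> hf nz; rewrite -row_free_unit -kermx_eq0; apply/rowV0P => v /sub_kermxP /rowP e.
have vh h : v 0 h * (h != l)%:R + v 0 l * C m h = 0.
  have := e h; rewrite !mxE (bigD1 l) //= !mxE eqxx => {}e.
  rewrite addrC -[RHS]e; congr (_ + _).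
  have [->|ne] := eqVneq h l.
    rewrite mulr0 big1 // => h' ne; rewrite mxE (negPf ne) (frameE _ _ hf) (negPf ne).
    by rewrite mulr0.
  rewrite (bigD1 h) //= big1 ?addr0; last first.
    by move=> h' /andP[ne' ne2]; rewrite mxE (negPf ne') (frameE _ _ hf) (negPf ne2) mulr0.
  by rewrite mxE (negPf ne) (frameE _ _ hf) eqxx.
have vl : v 0 l = 0.
  by have /eqP := vh l; rewrite eqxx mulr0 add0r mulf_eq0 (negPf nz) orbF => /eqP.
apply/rowP => h; rewrite mxE; have [->//|ne] := eqVneq h l.
by have := vh h; rewrite ne vl mul0r addr0 mulr1.
Qed.

Lemma perm_unit C f (s : 'S_3) : rowsub f C \in unitmx -> rowsub (f \o s) C \in unitmx.
Proof.
have -> : rowsub (f \o s) C = row_perm s (rowsub f C) by apply/matrixP => l h; rewrite !mxE.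
by rewrite row_permE unitmx_mul unitmx_perm.
Qed.

Lemma triangular_unit C f : (forall l h : 'I_3, (l < h)%N -> C (f l) h = 0) ->
  (forall l, C (f l) l != 0) -> rowsub f C \in unitmx.
Proof.
move=> tz nz; rewrite unitmxE unitfE det_trig.
  by apply/prodf_neq0 => l _; rewrite mxE.
by apply/is_trig_mxP => l h lh; rewrite mxE tz.
Qed.

Definition flag_val C (e0 e1 : nat) m : nat :=
  if C m o2 != 0 then 0 else if C m o1 != 0 then e1 else e0.

Lemma flag_weightsP C e0 e1 om : (forall m, exists l, C m l != 0) -> (e1 <= e0)%N ->
  flag_weights C (tri e0 e1 0)%N om <-> om =1 flag_val C e0 e1.
Proof.
move=> C_row e10; rewrite /flag_val; split=> [flag m|e m].
  have [le [h nz eh]] := flag m.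
  have [c2|c2] := eqVneq (C m o2) 0; last first.
    by apply/eqP; rewrite -leqn0; apply: le c2.
  have [c1|c1] := eqVneq (C m o1) 0.
    by move: nz eh; move: (h); elim/I3P; rewrite ?c1 ?c2 ?eqxx.
  apply/eqP; rewrite eqn_leq (le _ c1) -eh /=.
  by move: nz; move: (h); elim/I3P; rewrite ?c2 ?eqxx //= /tri /= ?e10 // leqnn.
rewrite e; have [c2|c2] := eqVneq (C m o2) 0; last by split=> //; exists o2.
have [c1|c1] := eqVneq (C m o1) 0; last first.
  by split; [elim/I3P; rewrite ?c2 ?eqxx|exists o1].
split; first by elim/I3P; rewrite ?c1 ?c2 ?eqxx //= /tri /= leqnn.
have [l] := C_row m; move: (l); elim/I3P; rewrite ?c1 ?c2 ?eqxx // => c0.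
by exists o0.
Qed.

(* Two flags with the same point, and with the same line if the weights        *)
(* distinguish it, induce the same weights.                                    *)
Lemma same_flag C f C' f' e0 e1 om : (forall m, exists l, C m l != 0) ->
  (forall m, exists l, C' m l != 0) -> coordinates M C -> frame C f ->
  coordinates M C' -> frame C' f' -> C' (f o0) o2 = 0 -> C' (f o1) o2 = 0 ->
  (e0 == e1) || (C' (f o0) o1 == 0) -> (e1 <= e0)%N ->
  flag_weights C' (tri e0 e1 0)%N om -> flag_weights C (tri e0 e1 0)%N om.
Proof.
move=> C_row C_row' hC hf hC' hf' i2 j2 ln e10.
have r2 m : C' m o2 = C m o2 * C' (f o2) o2.
  by rewrite (frame_rel hC' hC hf) sum_I3 i2 j2 !mulr0 !add0r.
have k2 : C' (f o2) o2 != 0.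
  apply/eqP => k2; have := r2 (f' o2); rewrite (frameE _ _ hf') k2 mulr0 /= => /eqP.
  by rewrite oner_eq0.
rewrite !flag_weightsP // => e m; rewrite e /flag_val r2 mulf_eq0 (negPf k2) orbF.
have [c2|//] := eqVneq (C m o2) 0; move: ln; have [->|_ /= /eqP i1] := eqVneq e0 e1.
  by rewrite !if_same.
have r1 m' : C m' o2 = 0 -> C' m' o1 = C m' o1 * C' (f o1) o1.
  by move=> z; rewrite (frame_rel hC' hC hf) sum_I3 i1 z mulr0 mul0r add0r addr0.
have j1 : C' (f o1) o1 != 0.
  apply/eqP => j1; have f2 : C (f' o1) o2 = 0.
    have := r2 (f' o1); rewrite (frameE _ _ hf') => /esym/eqP.
    by rewrite mulf_eq0 (negPf k2) orbF => /eqP.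
  by have := r1 _ f2; rewrite (frameE _ _ hf') j1 mulr0 => /eqP; rewrite oner_eq0.
by rewrite r1 // mulf_eq0 (negPf j1) orbF.
Qed.

Lemma parallel_frame C C' m m' : coordinates M C -> coordinates M C' ->
  (exists f, frame C' f) -> parallel C' m m' -> parallel C m m'.
Proof.
move=> hC hC' [f hf]; apply: (parallel_change (Q := fun l h => C (f l) h)) => x h.
exact: frame_rel hC hC' hf x h.
Qed.

Lemma parallelP C f m : frame C f -> parallel C (f o0) m <-> C m o1 = 0 /\ C m o2 = 0.
Proof.
move=> hf; split=> [par|[c1 c2]].
  by have := par o0 o1; have := par o0 o2; rewrite !(frameE _ _ hf) /= !mul1r !mul0r => -> ->.
by elim/I3P; elim/I3P; rewrite // !(frameE _ _ hf) ?c1 ?c2 /= ?mulr0 ?mul0r.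
Qed.

Lemma parallel_refl C m : parallel C m m.
Proof. by move=> l h; rewrite mulrC. Qed.

Lemma parallel_sym C m m' : parallel C m m' -> parallel C m' m.
Proof. by move=> par l h; rewrite [LHS]mulrC par mulrC. Qed.

Lemma parallel_trans C m1 m2 m3 : (exists l, C m2 l != 0) ->
  parallel C m1 m2 -> parallel C m2 m3 -> parallel C m1 m3.
Proof.
move=> [x nz] p12 p23 l h; apply: (mulfI nz).
rewrite mulrA [_ * C m1 l]mulrC p12 -mulrA p23 mulrA (p12 x h).
by rewrite [C m1 h * _]mulrC mulrA.
Qed.

Lemma coordinates_frame_exist : (\rank M + 3 = n.+1)%N ->
  exists C f, coordinates M C /\ frame C f.
Proof.
move=> rkM; have [C0 hC0] := coordinates_exist rkM; have full := coordinates_full rkM hC0.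
have [C [hC hf]] := frame_exists hC0 (fullrowsub_unit full).
by exists C, (fullrankfun full).
Qed.

End Frames.

(** * Lines of the arrangement and rays of trop(E) *)

Section Lines.
Context (K : closedFieldType) (n dm : nat) (M : 'M[K]_(dm, n.+1)).
Context (C0 : 'M[K]_(n.+1, 3)) (f0 : 'I_3 -> 'I_n.+1) (hC0 : coordinates M C0) (hf0 : frame C0 f0).
Hypothesis LT : linear_ideal M <> setT.
Local Notation L0 := (deg0_part (linear_ideal M)).
Implicit Types (C : 'M[K]_(n.+1, 3)) (f g : 'I_3 -> 'I_n.+1) (u v : modone int n).

Lemma coord_row C : coordinates M C -> forall m, exists l, C m l != 0.
Proof. by move=> hC m; apply: row_coordinates_neq0 hC m LT. Qed.

Definition on_line (m m' : 'I_n.+1) : nat := `[< parallel C0 m m' >].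

(** The ray e_l: the sum of the unit vectors over all indices that define the line l of x_m. *)
Definition line_class m : modone int n := modone_pi (natrow (on_line m)).

Lemma on_line_frame C f m : coordinates M C -> frame C f ->
  on_line (f o0) m = (C m o1 == 0) && (C m o2 == 0).
Proof.
move=> hC hf; rewrite /on_line; congr nat_of_bool; apply/asboolP/andP => [par|[/eqP c1 /eqP c2]].
  have f0C : exists f, frame C0 f by exists f0.
  by have /(parallelP m hf)[-> ->] := parallel_frame hC hC0 f0C par.
have fC : exists f, frame C f by exists f.
by apply: (parallel_frame hC0 hC fC); exact/(parallelP m hf).
Qed.

Lemma on_line_flag C f : coordinates M C -> frame C f ->
  flag_weights C (tri 1 0 0)%N (on_line (f o0)).
Proof.
move=> hC hf; apply/flag_weightsP => //; first exact: coord_row.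
by move=> m; rewrite (on_line_frame _ hC hf) /flag_val; case: (C m o1 == 0); case: (C m o2 == 0).
Qed.

Lemma off_line m : exists m', on_line m m' = 0%N.
Proof.
have [l nz] := coord_row hC0 m.
have [h lh] : exists h : 'I_3, h != l by exists (if l == o0 then o1 else o0); move: (l); elim/I3P.
exists (f0 h); rewrite /on_line; case: asboolP => // /(_ l h).
rewrite !(frameE _ _ hf0) eqxx (negPf lh) mulr1 mulr0 => /eqP.
by rewrite (negPf nz).
Qed.

Lemma height_line m : height (line_class m) =1 on_line m.
Proof. by apply: height_natrow; apply: off_line. Qed.

Lemma on_line_refl m : on_line m m = 1%N.
Proof. by rewrite /on_line (asboolT (@parallel_refl _ _ C0 m)). Qed.

Lemma line_class_eq m m' : line_class m = line_class m' <-> parallel C0 m m'.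
Proof.
split=> [e|par].
  have := height_line m m; rewrite e height_line on_line_refl /on_line.
  by case: asboolP => // par _; apply: parallel_sym.
congr modone_pi; apply/rowP => x; rewrite !mxE /on_line; congr (nat_of_bool _)%:Z.
have tr := fun m1 m2 m3 => @parallel_trans _ _ C0 m1 m2 m3 (coord_row hC0 m2).
by apply: asbool_equiv_eq; split=> h; [apply: tr h; apply: parallel_sym|apply: tr h].
Qed.

Lemma line_class_on m m' : (line_class m' == line_class m) = on_line m m' :> nat.
Proof.
rewrite /on_line; congr nat_of_bool; apply/eqP/asboolP => [/esym/line_class_eq//|par].
by apply/esym/line_class_eq.
Qed.

(** The entries at [m] and at an index off its line differ by 1, so a factor k must divide 1. *)
Lemma primitive_line m : primitive (line_class m).
Proof.
have [m' off] := off_line m; have on := on_line_refl m.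
have h v k : line_class m = v *+ k -> k = 1%N.
  rewrite -(modone_reprK v) pmulrn modone_piMz => /modone_piP[c /rowP e].
  have := e m; have := e m'; rewrite !mxE on off => e1 e2.
  have : 1 = k%:Z * (modone_repr v 0 m - modone_repr v 0 m').
    by rewrite mulrBr; move: e1 e2; move: (_ * modone_repr v 0 m) (_ * modone_repr v 0 m'); lia.
  by move=> /esym/eqP; rewrite mulrC intUnitRing.mulzn_eq1 => /andP[_ /eqP].
split=> [z|//]; have := h 0 0%N; rewrite z mulr0n => /(_ erefl); by [].
Qed.

(** The relation that expands x_m in the frame would have initial form x_m, a unit. *)
Lemma unique_lowest_term (R : realType) C f u m : coordinates M C -> frame C f ->
  (forall h, C m h != 0 -> (height u m < height u (f h))%N) ->
  init_ideal (lattice_vec R u) L0 = setT.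
Proof.
move=> hC hf lt; have [c w_om] := lattice_vec_height R u; have [k ok] := height_min u.
have hI : is_ideal (init_ideal (lattice_vec R u) L0) by apply: init_ideal_ideal.
have lowm x : wt_is (height u) (height u x)%:Z (zvar K k x).
  by have := @wt_is_zmon K n (height u) k (delta_mx 0 x) ok; rewrite wt_delta.
have geS d d' (x : laurent0 K n) : d <= d' -> wt_ge (height u) d' x -> wt_ge (height u) d x.
  by move=> dd' wx v /wx; apply: le_trans.
have : init_ideal (lattice_vec R u) L0 (zvar K k m).
  apply: (init_ideal_low w_om (mem_zvar_frame hC k m hf) (lowm m)).
  apply: wt_geN; elim/big_ind: _; [exact: wt_ge_is (wt_is0 _ _)|exact: wt_geD|move=> l _].
  have [->|nz] := eqVneq (C m l) 0.
    by rewrite rmorph0 mul0r; exact: wt_ge_is (wt_is0 _ _).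
  have ge := wt_geM (wt_ge_is (@wt_is_cst K n (height u) (C m l))) (wt_ge_is (lowm (f l))).
  apply: (@geS _ _ _ _ ge).
  by rewrite add0r; have := lt l nz; lia.
rewrite -[zvar _ _ _]mulr1 => h1.
have I1 := ideal_unit hI (zmonN K k (delta_mx 0 m)) h1.
by apply/seteqP; split=> // x _; rewrite -[x]mulr1; exact: (idealMl x hI I1).
Qed.

(* A basis of greatest total weight is adapted to the weights, since any       *)
(* coordinate with a nonzero coefficient can be exchanged into the basis.      *)
Lemma flag_exists (R : realType) u : primitive u -> init_ideal (lattice_vec R u) L0 <> setT ->
  exists C f e0 e1, [/\ coordinates M C, frame C f, (e1 <= e0)%N, coprime e0 e1 &
    flag_weights C (tri e0 e1 0)%N (height u)].
Proof.
move=> pu nT; pose om := height u.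
(* The distinct coefficients 3, 2, 1 make a maximal basis sorted by decreasing weight; their
   positivity is what the exchange argument uses. *)
pose F (g : 'I_3 -> 'I_n.+1) := (3 * om (g o0) + 2 * om (g o1) + om (g o2))%N.
pose P (g : {ffun 'I_3 -> 'I_n.+1}) := rowsub g C0 \in unitmx.
have unit_ext (C : 'M[K]_(n.+1, 3)) g g' : g =1 g' -> rowsub g C = rowsub g' C.
  by move=> e; apply/matrixP => l h; rewrite !mxE e.
have P0 : P [ffun h => f0 h].
  by rewrite /P (unit_ext _ _ f0) ?hf0 ?unitmx1 // => h; rewrite ffunE.
have [f Pf maxf] := @arg_maxnP _ [ffun h => f0 h] P (fun g : {ffun _ -> _} => F g) P0.
have [C [hC hf]] := frame_exists hC0 Pf.
have {}maxf g : rowsub g C \in unitmx -> (F g <= F f)%N.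
  move=> gu; have := maxf [ffun h => g h]; rewrite /F !ffunE; apply.
  rewrite /P (unit_ext _ _ g) ?(rowsub_frame g hC hC0 hf) ?unitmx_mul ?gu //.
  by move=> h; rewrite ffunE.
have exch l m : C m l != 0 -> (om m <= om (f l))%N.
  move=> nz; have := maxf _ (exchange_unit hf nz); rewrite /F.
  by move: (l); elim/I3P => /=; lia.
have fu : rowsub f C \in unitmx by rewrite hf unitmx1.
have sort01 : (om (f o1) <= om (f o0))%N.
  by have := maxf _ (perm_unit (tperm o0 o1) fu); rewrite /F /= tpermL tpermR tpermD //; lia.
have sort12 : (om (f o2) <= om (f o1))%N.
  by have := maxf _ (perm_unit (tperm o1 o2) fu); rewrite /F /= tpermL tpermR tpermD //; lia.
have flag : flag_weights C (fun h => om (f h)) om.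
  move=> m; split=> [h nz|]; first exact: exch.
  apply: contrapT => ne; apply: nT; apply: (unique_lowest_term R (m := m) hC hf) => h nz.
  rewrite ltn_neqAle exch // andbT; apply/eqP => e; apply: ne.
  by exists h.
have f2 : om (f o2) = 0%N.
  have [k ok] := height_min u; have [_ [h _ eh]] := flag k; move: eh; rewrite [om k]ok.
  by move: (h); elim/I3P; lia.
have flag' : flag_weights C (tri (om (f o0)) (om (f o1)) 0)%N om.
  by move: flag; congr flag_weights; apply: funext; elim/I3P; rewrite /tri //= f2.
exists C, f, (om (f o0)), (om (f o1)); split=> //.
apply/eqP; apply: (primitive_gcd pu) => m; have [_ [h _ eh]] := flag' m; rewrite -[height u m]/(om m) -eh.
by move: (h); elim/I3P; rewrite /tri /= ?dvdn_gcdl ?dvdn_gcdr ?dvdn0.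
Qed.

End Lines.

(** * The tropical cycle of one curve *)

Section CurveCycle.
Context (K : closedFieldType) (n dm : nat) (M : 'M[K]_(dm, n.+1)) (R : realType).
Context (C0 : 'M[K]_(n.+1, 3)) (f0 : 'I_3 -> 'I_n.+1) (hC0 : coordinates M C0) (hf0 : frame C0 f0).
Hypothesis LT : linear_ideal M <> setT.
Local Notation L0 := (deg0_part (linear_ideal M)).
Context (C : 'M[K]_(n.+1, 3)) (f : 'I_3 -> 'I_n.+1) (hC : coordinates M C) (hf : frame C f).
Context (a b : nat) (la ka ga : K).
Local Notation d := (a + b)%N.
Hypotheses (d0 : (0 < d)%N) (bd : coprime b d) (kaga : ka * ga ^+ d = 1).
Hypothesis gen : generic C a b la ka.
Let C_row := coord_row LT hC.
Local Notation P := (curve_ideal (curve_coord_neq0 C_row d0 kaga gen)).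
Local Notation mult u := (multiplicity (init_ideal (lattice_vec R u) P)).

Lemma curve_curves : curves L0 P.
Proof.
split; [exact: curve_ideal_prime|exact: (L0_curve hC)|].
have uk : curve_coord C a b la ga (f o2) = 1.
  by rewrite /curve_coord (ptv_frame _ _ _ hf).
apply: (curve_ideal_dim (m0 := f o0) _ uk).
by rewrite /curve_coord (ptv_frame _ _ _ hf) /= size_polyXn.
Qed.

(** Once x is made the first element of a frame, the three cases are lines off the singular point,
    other lines through it, and the line x_i = 0. *)
Lemma curve_mult_line x : mult (line_class C0 x) =
  (if C x o2 != 0 then d else if C x o1 != 0 then a else (b == 0%N))%:Z.
Proof.
have [c0 w_om] := lattice_vec_height R (line_class C0 x).
have flag C' f' : coordinates M C' -> frame C' f' -> f' o0 = x ->
    flag_weights C' (tri 1 0 0)%N (height (line_class C0 x)).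
  move=> hC' hf' <-; have -> : height (line_class C0 (f' o0)) = on_line C0 (f' o0).
    by apply: funext => m; rewrite (height_line hC0 hf0 LT).
  exact: (on_line_flag hC0 hf0 LT hC' hf').
have [c2|c2] := eqVneq (C x o2) 0; last first.
  have := perm_unit (tperm o0 o2) (exchange_unit hf c2); set f' := _ \o _ => fu.
  have [C' [hC' hf']] := frame_exists hC fu.
  have f'0 : f' o0 = x by rewrite /f' /= tpermL.
  have out : C (f' o0) o2 != 0 by rewrite f'0.
  exact: (mult_line_outside hC hf C_row d0 bd kaga gen w_om hC' hf' out (flag _ _ hC' hf' f'0)).
have [c1|c1] := eqVneq (C x o1) 0.
  rewrite (mult_first_line hC hf C_row d0 bd kaga gen w_om) //.
  have -> : line_class C0 x = line_class C0 (f o0).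
    apply/(line_class_eq hC0 hf0 LT); apply: parallel_sym.
    have := on_line_frame hC0 hf0 x hC hf; rewrite c1 c2 eqxx /on_line.
    by case: asboolP.
  have -> : height (line_class C0 (f o0)) = on_line C0 (f o0).
    by apply: funext => m; rewrite (height_line hC0 hf0 LT).
  exact: (on_line_flag hC0 hf0 LT hC hf).
have := perm_unit (tperm o0 o1) (exchange_unit hf c1); set f' := _ \o _ => fu.
have [C' [hC' hf']] := frame_exists hC fu.
have f'0 : f' o0 = x by rewrite /f' /= tpermL.
have f'1 : f' o1 = f o0 by rewrite /f' /= tpermR.
have f'2 : f' o2 = f o2 by rewrite /f' /= tpermD.
have j2 : C' (f o1) o2 = 0.
  have := frame_rel hC hC' hf' (f o1) o2.
  by rewrite sum_I3 f'0 f'1 f'2 c2 !(frameE _ _ hf) /= !mulr0 !add0r mulr1.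
exact: (mult_line_through hC hf C_row d0 bd kaga gen w_om hC' hf' f'1 f'2 j2 (flag _ _ hC' hf' f'0)).
Qed.

(** Outside trop(E) the initial ideal is everything. Inside, the ray has a flag with positive
    weights, and either its point is not the singular one, or its flag agrees with that of the curve
    but the weights do not, or its line is another one through the singular point. *)
Lemma curve_mult_other v : primitive v -> ~ (exists x, v = line_class C0 x) ->
  b = 0%N \/ ~ flag_weights C (tri d b 0)%N (height v) -> mult v = 0.
Proof.
move=> pv nline nflag; have [c0 w_om] := lattice_vec_height R v.
have [L0T|L0N] := pselect (init_ideal (lattice_vec R v) L0 = setT).
  have -> : init_ideal (lattice_vec R v) P = setT.
    apply/seteqP; split=> // x _; apply: (init_idealS (L0_curve hC (curve_coord_neq0 C_row d0 kaga gen))).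
    by rewrite L0T.
  exact: multiplicity_setT.
have [C' [f' [e0 [e1 [hC' hf' e10 cop flag]]]]] := flag_exists hC0 hf0 pv L0N.
have e1_gt0 : (0 < e1)%N.
  rewrite lt0n; apply/eqP => e1_0; apply: nline; exists (f' o0).
  move: cop flag; rewrite e1_0 /coprime gcdn0 => /eqP-> flag.
  rewrite -[LHS]modone_pi_height; congr modone_pi; apply/rowP => m; rewrite !mxE; congr Posz.
  have C_row' := coord_row LT hC'.
  have /(@flag_weightsP K n C' 1 0 _ C_row' isT) -> := flag.
  by have /(@flag_weightsP K n C' 1 0 _ C_row' isT) -> := on_line_flag hC0 hf0 LT hC' hf'.
have [i2|i2] := eqVneq (C' (f o0) o2) 0; last first.
  apply: (mult_other_point hC hf C_row d0 bd kaga gen w_om hC' hf' e1_gt0 e10 cop flag).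
  by constructor 1.
have [j2|j2] := eqVneq (C' (f o1) o2) 0; last first.
  apply: (mult_other_point hC hf C_row d0 bd kaga gen w_om hC' hf' e1_gt0 e10 cop flag).
  by constructor 2.
have [b0|b0] := posnP b.
  apply: (mult_other_point hC hf C_row d0 bd kaga gen w_om hC' hf' e1_gt0 e10 cop flag).
  by constructor 3.
have {}nflag : ~ flag_weights C (tri d b 0)%N (height v) by case: nflag => // b00; rewrite b00 in b0.
have C_row' := coord_row LT hC'.
have [ln|] := boolP ((e0 == e1) || (C' (f o0) o1 == 0)).
  have flag' := same_flag C_row C_row' hC hf hC' hf' i2 j2 ln e10 flag.
  apply: (mult_other_branch hC hf C_row d0 bd kaga gen w_om b0 e1_gt0 e10 cop _ flag').
  by case=> e0d e1b; apply: nflag; rewrite -e0d -e1b.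
rewrite negb_or => /andP[ne i1].
have k2 : C' (f o2) o2 != 0.
  apply/eqP => k2; have := frame_rel hC' hC hf (f' o2) o2.
  by rewrite sum_I3 i2 j2 k2 !mulr0 !addr0 (frameE _ _ hf') => /eqP; rewrite oner_eq0.
(* A frame with the same flag whose second element is x_i, as [mult_sector_above] requires. *)
pose g := tri (f' o0) (f o0) (f o2).
have gu : rowsub g C' \in unitmx.
  apply: triangular_unit.
    by elim/I3P; elim/I3P => //= _; rewrite /g /tri /= ?(frameE _ _ hf').
  by elim/I3P; rewrite /g /tri //= (frameE _ _ hf') oner_neq0.
have [C2 [hC2 hg]] := frame_exists hC' gu.
have flag2 : flag_weights C2 (tri e0 e1 0)%N (height v).
  apply: (same_flag (coord_row LT hC2) C_row' hC2 hg hC' hf') flag => //.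
    by rewrite /g /= (frameE _ _ hf').
  by rewrite /g /= (frameE _ _ hf') eqxx orbT.
apply: (mult_sector_above hC hf C_row d0 bd kaga gen w_om hC2 hg erefl erefl _ e1_gt0 _ cop flag2).
  have := frame_rel hC' hC2 hg (f o1) o2; rewrite sum_I3 /g /= (frameE _ _ hf') i2 j2 /= !mulr0 !add0r.
  by move=> /esym/eqP; rewrite mulf_eq0 (negPf k2) orbF => /eqP.
by rewrite ltn_neqAle e10 andbT eq_sym.
Qed.

End CurveCycle.

Lemma sum_pick (T : eqType) (s : seq T) (p : pred T) (F : T -> int) v : uniq s -> p v ->
  (v \notin s -> F v = 0) -> \sum_(u <- s | p u) F u * (v == u)%:Z = F v.
Proof.
move=> us pv out; have [vs|/out Fv] := boolP (v \in s).
  rewrite big_mkcond (bigD1_seq v) //= pv eqxx mulr1 big1 ?addr0 // => u uv.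
  by rewrite eq_sym (negPf uv) mulr0 if_same.
by rewrite Fv big1 // => u _; have [<-|_] := eqVneq v u; rewrite ?Fv ?mul0r ?mulr0.
Qed.

(** * Decomposition of a tropical cycle into curves *)

Section Surjectivity.
Context (K : closedFieldType) (n dm : nat) (M : 'M[K]_(dm, n.+1)) (R : realType).
Context (C0 : 'M[K]_(n.+1, 3)) (f0 : 'I_3 -> 'I_n.+1) (hC0 : coordinates M C0) (hf0 : frame C0 f0).
Hypothesis LT : linear_ideal M <> setT.
Local Notation L0 := (deg0_part (linear_ideal M)).
Local Notation trop := (@trop_curve K n R).
Local Notation line := (line_class C0).
Local Notation is_line v := (exists x, v = line x).

Lemma root_of_unit (ka : K) d : (0 < d)%N -> ka != 0 -> exists ga, ka * ga ^+ d = 1.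
Proof.
move=> d0 ka0; have /closed_rootP[ga] : size ('X^d - (ka^-1)%:P) != 1.
  by rewrite size_XnsubC // eqSS -lt0n.
rewrite rootE !hornerE subr_eq0 => /eqP e.
by exists ga; rewrite e mulfV.
Qed.

Lemma curve_exists C f a b : coordinates M C -> frame C f -> (0 < a + b)%N -> coprime b (a + b) ->
  exists P, [/\ curves L0 P,
    forall v, ~ is_line v -> b = 0%N \/ ~ flag_weights C (tri (a + b) b 0)%N (height v) -> trop P v = 0,
    forall v, primitive v -> (0 < b)%N -> flag_weights C (tri (a + b) b 0)%N (height v) -> trop P v = 1 &
    forall x, trop P (line x) =
      Posz (if C x o2 != 0 then (a + b)%N else if C x o1 != 0 then a else (b == 0%N))].
Proof.
move=> hC hf d0 bd; have [la [ka gen]] := generic_exists C d0.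
have ka0 : ka != 0 by case: gen.
have [ga kaga] := root_of_unit d0 ka0.
exists (curve_ideal (curve_coord_neq0 (coord_row LT hC) d0 kaga gen)); split.
- exact: (curve_curves LT hC hf d0 kaga gen).
- move=> v nl nf; rewrite /trop_curve; case: asboolP => // pv.
  exact: (curve_mult_other R hC0 hf0 LT hC hf d0 bd kaga gen pv nl nf).
- move=> v pv b0 flag; rewrite /trop_curve asboolT //.
  have [c0 w_om] := lattice_vec_height R v.
  exact: (mult_singular_branch hC hf (coord_row LT hC) d0 bd kaga gen w_om b0 flag).
- move=> x; rewrite /trop_curve asboolT; last exact: (primitive_line hC0 hf0 LT x).
  exact: (curve_mult_line R hC0 hf0 LT hC hf d0 bd kaga gen x).
Qed.

(** For a = 1, b = 0 the curve is the generic line x_k = ka (x_j - la x_i), which meets every line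
    of the arrangement once. *)
Lemma general_line_exists : exists P, [/\ curves L0 P,
  forall v, ~ is_line v -> trop P v = 0 & forall x, trop P (line x) = 1].
Proof.
have [P [cP h0 _ h1]] := @curve_exists C0 f0 1 0 hC0 hf0 isT isT.
exists P; split=> // [v nl|x]; first by apply: h0 => //; left.
by rewrite h1; do 2!case: eqVneq.
Qed.

(** With b = e1 and a = e0 - e1 the multiplicities d, a, 0 on the lines are e0 minus the heights 0,
    e1, e0 of u. This uniform shape matches the balancing condition. *)
Lemma ray_curve_exists u : primitive u -> ~ is_line u -> init_ideal (lattice_vec R u) L0 <> setT ->
  exists P (D : int), [/\ curves L0 P,
    forall v, ~ is_line v -> trop P v = (v == u)%:Z & forall x, trop P (line x) = D - (height u x)%:Z].
Proof.
move=> pu nl nT; have [C [f [e0 [e1 [hC hf e10 cop flag]]]]] := flag_exists hC0 hf0 pu nT.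
have C_row := coord_row LT hC; have hu := (flag_weightsP _ C_row e10).1 flag.
have e1_gt0 : (0 < e1)%N.
  rewrite lt0n; apply/eqP => e1_0; apply: nl; exists (f o0).
  move: cop flag; rewrite e1_0 /coprime gcdn0 => /eqP-> flag'.
  rewrite -[LHS]modone_pi_height; congr modone_pi; apply/rowP => m; rewrite !mxE; congr Posz.
  have /(@flag_weightsP K n C 1 0 _ C_row isT) -> := flag'.
  by have /(@flag_weightsP K n C 1 0 _ C_row isT) -> := on_line_flag hC0 hf0 LT hC hf.
have ab : (e0 - e1 + e1 = e0)%N by rewrite subnK.
have d0 : (0 < e0 - e1 + e1)%N by rewrite ab (leq_trans e1_gt0).
have bd : coprime e1 (e0 - e1 + e1) by rewrite ab coprime_sym.
have [P [cP h0 h1 h2]] := curve_exists hC hf d0 bd; rewrite ab in h0 h1 h2.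
exists P, e0%:Z; split=> // [v nlv|x].
  have [->|ne] := eqVneq v u; first exact: h1.
  apply: h0 => //; right => /(flag_weightsP _ C_row e10) hv; case/eqP: ne.
  rewrite -[LHS]modone_pi_height -[RHS]modone_pi_height; congr modone_pi.
  by apply/rowP => m; rewrite !mxE hv hu.
rewrite h2 hu /flag_val; case: eqP => _ /=; last by rewrite subr0.
by case: eqP => _ /=; rewrite ?subrr ?subzn // (gtn_eqF e1_gt0).
Qed.

Lemma trop_surjective : set_surj [set: Z1 L0] (Z1trop (trop_set R L0)) (Trop R L0).
Proof.
move=> m [[fin prim bal] supp]; pose s := fset_set [set u | m u <> 0].
have ms u : (u \in s) = (m u != 0).
  by rewrite in_fset_set //; apply/idP/idP => [/set_mem mu|/eqP mu]; [exact/eqP|exact: mem_set].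
have [G [cG G0 G1]] := general_line_exists.
pose YG : set_type (curves L0) := SigSub (mem_set cG).
(* The pair [(YG, 0)] is a default for rays outside the support of [m] and for the rays e_l. *)
have ex u : exists y : set_type (curves L0) * int, m u <> 0 -> ~ is_line u ->
    (forall v, ~ is_line v -> trop (val y.1) v = (v == u)%:Z) /\
    (forall x, trop (val y.1) (line x) = y.2 - (height u x)%:Z).
  have [mu|mu] := pselect (m u <> 0); last by exists (YG, 0).
  have [lu|nlu] := pselect (is_line u); first by exists (YG, 0).
  have [P [D [cP h1 h2]]] := ray_curve_exists (prim u mu) nlu (ray_trop_set (supp u mu)).
  by exists (SigSub (mem_set cP), D).
have [Y hY] := choice ex.
pose lp u := `[< is_line u >].
have sumv (p : pred (modone int n)) v : p v -> \sum_(u <- s | p u) m u * (v == u)%:Z = m v.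
  by move=> pv; apply: sum_pick => //; rewrite ?fset_uniq // ms negbK => /eqP.
(* Balancing says that m(e_l) plus the sum of m(u) times the height of u on l, over the rays u that
   are no e_l, is a constant c independent of l. The height is D_u minus the multiplicity of e_l in
   trop(C_u), so after subtracting the curves every e_l keeps k = c - sum of m(u) D_u. *)
have [k hk] : exists k : int, forall x,
    m (line x) - \sum_(u <- s | ~~ lp u) m u * trop (val (Y u).1) (line x) = k.
  have : \sum_(u <- s) u *~ m u = 0 by move: bal; rewrite fsbig_finite.
  have lpart u : lp u -> u *~ m u = modone_pi (m u *: \row_x (line x == u)%:Z).
    move=> /asboolP[x0 ux]; rewrite -modone_piMz; congr (_ *~ _); rewrite {1}ux.
    by congr modone_pi; apply/rowP => x; rewrite !mxE ux (line_class_on hC0 hf0 LT).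
  rewrite (bigID lp) /= (eq_bigr _ lpart) modone_pi_sum.
  have npart u : u *~ m u = modone_pi (m u *: natrow (height u)).
    by rewrite -modone_piMz modone_pi_height.
  rewrite (eq_bigr _ (fun u _ => npart u)) modone_pi_sum modone_piD -[RHS](modone_pi0 n).
  move=> /modone_piP[c /rowP e].
  exists (c - \sum_(u <- s | ~~ lp u) m u * (Y u).2) => x.
  have := e x; rewrite !(mxE, summxE).
  have -> : \sum_(u <- s | lp u) (m u *: \row_y (line y == u)%:Z) 0 x = m (line x).
    rewrite -[RHS](sumv lp); last by apply/asboolP; exists x.
    by apply: eq_bigr => u _; rewrite !mxE.
  have -> : \sum_(u <- s | ~~ lp u) (m u *: natrow (height u)) 0 x =
      \sum_(u <- s | ~~ lp u) m u * (Y u).2 -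
      \sum_(u <- s | ~~ lp u) m u * trop (val (Y u).1) (line x).
    rewrite -sumrB [LHS]big_seq_cond [RHS]big_seq_cond; apply: eq_bigr => u /andP[us nlu].
    have [mu nl] : m u <> 0 /\ ~ is_line u by split; [apply/eqP; rewrite -ms|exact/asboolPn].
    have [_ ->] := hY u mu nl.
    by rewrite !mxE mulrBr opprB addrC subrK.
  by rewrite add0r => <-; rewrite addrA [RHS]addrAC addrK.
exists [freeg ((k, YG) :: [seq (m u, (Y u).1) | u <- [seq u <- s | ~~ lp u]])] => //.
rewrite /Trop fglift_Freeg; apply: funext => v.
have -> : prelift (fun Y0 : set_type (curves L0) => trop (\val Y0))
    ((k, YG) :: [seq (m u, (Y u).1) | u <- s & ~~ lp u]) v =
    k * trop G v + \sum_(u <- s | ~~ lp u) m u * trop (val (Y u).1) v.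
  by rewrite /prelift big_cons big_map big_filter /= addrfctE fct_sumE.
have [[x ->]|nl] := pselect (is_line v); first by rewrite G1 mulr1 -(hk x) subrK.
have nlp : ~~ lp v by exact/asboolPn.
rewrite G0 // mulr0 add0r -[RHS](sumv (predC lp) v nlp) [LHS]big_seq_cond [RHS]big_seq_cond.
apply: eq_bigr => u /andP[us nlu].
have [mu nlu'] : m u <> 0 /\ ~ is_line u by split; [apply/eqP; rewrite -ms|exact/asboolPn].
by have [-> //] := hY u mu nlu'.
Qed.

End Surjectivity.

Theorem proposition5p3 (R : realType) (K : closedFieldType) (n : nat)
    (hn : (2 <= n)%N) (A : 'M[K]_(n - 2, n.+1)) (indep : row_free A)
    (dimL : dim_quot (linear_ideal A) 3) :
  let L0 := deg0_part (linear_ideal A) in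
  set_surj [set: Z1 L0] (Z1trop (trop_set R L0)) (Trop R L0).
Proof.
have rkA : (\rank A + 3 = n.+1)%N by rewrite (eqP indep); lia.
have LT : linear_ideal A <> setT.
  (* The first member of a chain witnessing the dimension is a prime containing L, so L is
     proper. *)
  by move=> e; have [[c [/(_ 0%N isT)[[_ c1 _] sub] _]] _] := dimL; apply/c1/sub; rewrite e.
have [C [f [hC hf]]] := coordinates_frame_exist rkA.
exact: (@trop_surjective K n _ A R C f hC hf LT).
Qed.
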